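(* Let $p\in(1,2]$, $s\in(1+1/p,2)$ and $f\in W^s_p(\mathbb{R})$. Then for every $\lambda\in\mathbb{R}$ with $|\lambda|\ge1$, the operator $\lambda-\mathbb{A}(f)$ is an isomorphism of $L_p(\mathbb{R})$, i.e. $\lambda-\mathbb{A}(f)\in\operatorname{Isom}(L_p(\mathbb{R}))$.
   Context: $W^s_p(\mathbb{R})$ is the Sobolev–Slobodeckij space. For $f\in W^s_p(\mathbb{R})$, $\mathbb{A}(f)\in\mathcal{L}(L_p(\mathbb{R}))$ is the (bounded extension of the) singular integral operator \[ \mathbb{A}(f)[\overline{\omega}](x):=\frac1\pi\operatorname{PV}\int_{\mathbb{R}}\frac{yf'(x)-(f(x)-f(x-y))}{y^2+(f(x)-f(x-y))^2}\overline{\omega}(x-y)\,dy . \] $\operatorname{Isom}(X)$ denotes bounded linear bijections of $X$ with bounded inverse. *)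

(* Defs.v *)
From HB Require Import structures.
From mathcomp Require Import all_boot all_order all_algebra.
From mathcomp Require Import all_classical all_reals all_analysis.
Set Implicit Arguments. Unset Strict Implicit. Unset Printing Implicit Defensive.
Import Order.TTheory GRing.Theory Num.Theory.
Import numFieldNormedType.Exports.
Local Open Scope classical_set_scope.
Local Open Scope ring_scope.

Section Defs.
Variable R : realType.
Local Notation mu := (@lebesgue_measure R).

Definition normLp (p : R) (u : R -> R) : \bar R := Lnorm mu p%:E (EFin \o u).

Definition inLp (p : R) (u : R -> R) : Prop :=
  measurable_fun setT u /\ (normLp p u < +oo)%E.

Definition oint (a b : R) (u : R -> R) : R :=
  if a <= b then Rintegral mu `[a, b] u else - Rintegral mu `[b, a] u.

Definition gagliardo_finite (p r : R) (u : R -> R) : Prop :=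
  (\int[mu]_x \int[mu]_y
     ((`|u x - u y| `^ p) / (`|x - y| `^ (1 + r * p)))%:E < +oo)%E.

(* Sobolev-Slobodeckij space W^s_p(R) for 1 < s < 2:  f is (the absolutely
   continuous representative of) an L_p function whose derivative g (given
   by f x = f 0 + int_0^x g) lies in W^{s-1}_p(R), i.e. g in L_p with finite
   Gagliardo seminorm of order s-1. *)
Definition W_sp (p s : R) (f g : R -> R) : Prop :=
  [/\ inLp p f, inLp p g, gagliardo_finite p (s - 1) g &
      forall x, f x = f 0 + oint 0 x g].

(* kernel of A(f), with f' represented by g *)
Definition kerA (f g : R -> R) (x y : R) : R :=
  (y * g x - (f x - f (x - y))) / (y ^+ 2 + (f x - f (x - y)) ^+ 2).

Definition truncA (f g : R -> R) (w : R -> R) (eps x : R) : R :=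
  pi^-1 * Rintegral mu [set y | eps < `|y|] (fun y => kerA f g x y * w (x - y)).

Definition compactly_supported_cont (w : R -> R) : Prop :=
  continuous w /\ exists M : R, forall x, M < `|x| -> w x = 0.

Definition bounded_Lp_op (p : R) (T : (R -> R) -> (R -> R)) : Prop :=
  [/\ forall u, inLp p u -> inLp p (T u),
      forall u v, inLp p u -> inLp p v ->
        {ae mu, forall x, u x = v x} -> {ae mu, forall x, T u x = T v x},
      forall (a : R) u v, inLp p u -> inLp p v ->
        {ae mu, forall x, T (fun z => a * u z + v z) x = a * T u x + T v x} &
      exists C : R, forall u, inLp p u -> (normLp p (T u) <= C%:E * normLp p u)%E].

(* T is (a representative of) the bounded extension of the principal value
   operator A(f) to L_p(R): it is bounded on L_p and on the dense subspace
   C_c(R) it is given a.e. by the principal value integral. *)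
Definition is_opA (p : R) (f g : R -> R) (T : (R -> R) -> (R -> R)) : Prop :=
  bounded_Lp_op p T /\
  forall w, compactly_supported_cont w ->
    {ae mu, forall x, truncA f g w eps x @[eps --> 0^'+] --> T w x}.

(* S belongs to Isom(L_p(R)): bounded linear, surjective, with bounded inverse
   (the inverse estimate gives injectivity modulo a.e. equality). *)
Definition isom_Lp (p : R) (S : (R -> R) -> (R -> R)) : Prop :=
  [/\ bounded_Lp_op p S,
      forall h, inLp p h -> exists2 u, inLp p u & {ae mu, forall x, S u x = h x} &
      exists C : R, forall u, inLp p u -> (normLp p u <= C%:E * normLp p (S u))%E].

End Defs.

(* Main.v *)
Require Import Defs.
From HB Require Import structures.
From mathcomp Require Import all_boot all_order all_algebra.
From mathcomp Require Import all_classical all_reals all_analysis.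
From mathcomp Require Import measurable_realfun ring lra.
Set Implicit Arguments. Unset Strict Implicit. Unset Printing Implicit Defensive.
Import Order.TTheory GRing.Theory Num.Theory.
Import numFieldNormedType.Exports.
Local Open Scope classical_set_scope.
Local Open Scope ring_scope.

(* By the Morrey-Campanato argument f has a bounded derivative G, Hoelder
   continuous with exponent al = s - 1 - 1/p, so the kernel of A(f) is only
   weakly singular and the principal value is an absolutely convergent integral.
   The Gagliardo seminorm bounds this kernel pointwise in such a way that A(f)
   maps L_q1 to L_q2 whenever q1, q2 lie in [p, 2] and 1/q1 - 1/q2 < al.

   In L_2 one has ||u|| <= C ||(lambda - A(f)) u|| for |lambda| >= 1 by a Rellich
   identity: with z(x) = x + i f(x), let P and Q be the real and (up to sign)
   imaginary parts of the boundary values of the Cauchy integral of u over the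
   graph.  Since the square of a decaying analytic function integrates to zero
   along the graph, RI (P^2 - Q^2 + 2 G P Q) = 0, and by the jump relations both
   boundary values are combinations of u, A(f) u and one further function; the
   identities for the two sides of the graph control u.

   As A(f) improves integrability, the estimate passes from L_q to L_q' when
   |1/q - 1/q'| < al, hence from L_2 to L_p in finitely many steps.
   Surjectivity then follows by continuation in lambda from |lambda| large. *)

(** The Hoelder exponent alone settles only the diagonal: at infinity the kernel is bounded by
    |[G x]| / |x - s| up to better terms, which is not integrable in s. Hence the kernel is split at
    distance 1, and its factors depending on x (the Gagliardo energy of [G] at x, |[G x]| and
    |[f x]|) are kept: they lie in L_q2 and supply the integrability in x. Hoelder's inequality in s
    then asks 1/|t| to lie in the conjugate space L_q1' at infinity, which holds because q1 <= 2
    forces q1' >= 2. In L_2 the condition |lambda| >= 1 is decisive through one term, (lambda^2 - 1)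
    u^2, of the combined Rellich identities. No resolvent constant depends on lambda, so the
    continuation from large |lambda| can use steps of one fixed size. The jump relations are proved
    for Lipschitz functions of compact support only, and density carries the estimate over to L_2.
    Contour integration is replaced by explicit real antiderivatives, a logarithm and an angle. An
    arbitrary extension [T] is identified with the integral operator by density as well. *)

Section MeasurableFunctions.
Context d (T : measurableType d) (R : realType).
Implicit Types f g : T -> R.

(** Inversion takes the value 0 at 0 and is discontinuous there, so that point is split off and
    continuity does the rest. *)
Lemma measurable_inv : measurable_fun [set: R] (fun x : R => x^-1).
Proof.
have m0 : measurable [set 0 : R] by [].
rewrite (_ : [set: R] = [set 0] `|` [set~ 0]); last by rewrite setUv.
apply/measurable_funU => //; first exact: measurableC.
split.
  by apply: eq_measurable_fun (measurable_cst (0 : R)) => x /[!inE] ->; rewrite invr0.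
apply: open_continuous_measurable_fun; first by rewrite openC; exact: closed_eq.
by move=> x /[!inE] /= /eqP x0; apply: inv_continuous.
Qed.

Lemma measurable_funVr f : measurable_fun setT f ->
  measurable_fun setT (fun x => (f x)^-1).
Proof. by move=> mf; exact: (measurableT_comp measurable_inv). Qed.

Lemma measurable_fun_powR f (a : R) : measurable_fun setT f ->
  measurable_fun setT (fun x => f x `^ a).
Proof. by move=> mf; exact: (measurableT_comp (measurable_powR a)). Qed.

Lemma measurable_fun_abs f : measurable_fun setT f ->
  measurable_fun setT (fun x => `|f x|).
Proof. by move=> mf; exact: measurableT_comp. Qed.

Lemma measurable_fun_EFin f : measurable_fun setT f ->
  measurable_fun setT (fun x => (f x)%:E).
Proof. by move=> mf; exact/measurable_EFinP. Qed.

Lemma measurable_fun_lt_nat f g : measurable_fun setT f -> measurable_fun setT g ->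
  measurable_fun setT (fun x => (f x < g x)%R%:R : R).
Proof.
move=> mf mg; rewrite (_ : (fun x => _) =
  (fun x => if f x < g x then 1 else 0)); last by apply/funext => x; case: ifP.
apply: measurable_fun_ifT => //; exact: measurable_fun_ltr.
Qed.

Lemma measurable_fun_le_nat f g : measurable_fun setT f -> measurable_fun setT g ->
  measurable_fun setT (fun x => (f x <= g x)%R%:R : R).
Proof.
move=> mf mg; rewrite (_ : (fun x => _) =
  (fun x => if f x <= g x then 1 else 0)); last by apply/funext => x; case: ifP.
apply: measurable_fun_ifT => //; exact: measurable_fun_ler.
Qed.

Lemma measurable_fun_opp f : measurable_fun setT f ->
  measurable_fun setT (fun x => - f x).
Proof. by move=> mf; exact: measurableT_comp. Qed.

Lemma measurable_fun_exp f n : measurable_fun setT f ->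
  measurable_fun setT (fun x => f x ^+ n).
Proof. by move=> mf; exact: measurable_funX. Qed.

End MeasurableFunctions.

Ltac meas_step := first
  [ assumption
  | lazymatch goal with
    | |- measurable_fun _ (fun x => @GRing.add _ (@?a x) (@?b x)) => apply: measurable_funD
    | |- measurable_fun _ (fun x => @GRing.opp _ (@?a x)) => apply: measurable_fun_opp
    | |- measurable_fun _ (fun x => @GRing.mul _ (@?a x) (@?b x)) => apply: measurable_funM
    | |- measurable_fun _ (fun x => @GRing.inv _ (@?a x)) => apply: measurable_funVr
    | |- measurable_fun _ (fun x => @GRing.exp _ (@?a x) _) => apply: measurable_fun_exp
    | |- measurable_fun _ (fun x => @powR _ (@?a x) _) => apply: measurable_fun_powR
    | |- measurable_fun _ (fun x => @Num.norm _ _ (@?a x)) => apply: measurable_fun_abs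
    end
  | apply: measurable_cst
  | apply: measurable_id
  | apply: measurable_fst
  | apply: measurable_snd
  | apply: measurable_fun_EFin
  | apply: measurable_fun_lt_nat
  | apply: measurable_fun_le_nat
  | match goal with h : measurable_fun setT ?u |- measurable_fun setT (fun x => ?u (@?t x)) =>
      apply: (measurableT_comp h) end ].
Ltac meas := repeat meas_step.

(** * Real-valued Lebesgue integrals *)

Section IntegrationTools.
Context {R : realType}.
Local Notation mu := (@lebesgue_measure R).
Implicit Types f g h : R -> R.

Lemma ae_imp (P Q : R -> Prop) : {ae mu, forall x, P x} -> (forall x, P x -> Q x) ->
  {ae mu, forall x, Q x}.
Proof. by move=> aeP PQ; apply: (filterS (F := almost_everywhere mu)) aeP. Qed.

Lemma ae_imp2 (P1 P2 Q : R -> Prop) : {ae mu, forall x, P1 x} -> {ae mu, forall x, P2 x} ->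
  (forall x, P1 x -> P2 x -> Q x) -> {ae mu, forall x, Q x}.
Proof. by move=> ae1 ae2 PQ; apply: (filterS2 (F := almost_everywhere mu)) ae1 ae2. Qed.

Definition L1 h := mu.-integrable setT (EFin \o h).

Definition unit_cut (t : R) : R := (`|t| < 1)%R%:R.

Lemma unit_cut_ge0 t : 0 <= unit_cut t.
Proof. by rewrite /unit_cut ler0n. Qed.

Lemma unit_cut_le1 t : unit_cut t <= 1.
Proof. by rewrite /unit_cut; case: ltP. Qed.

Lemma measurable_unit_cut : measurable_fun setT unit_cut.
Proof. by rewrite /unit_cut; meas. Qed.

Lemma L1_measurable h : L1 h -> measurable_fun setT h.
Proof. by move/measurable_int/measurable_EFinP. Qed.

Lemma L1_le h g : measurable_fun setT h -> (forall x, `|h x| <= g x) -> L1 g -> L1 h.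
Proof.
move=> mh hg; apply: le_integrable => //; first exact/measurable_EFinP.
by move=> x _ /=; rewrite lee_fin (le_trans (hg x))// ler_norm.
Qed.

Lemma L1D h g : L1 h -> L1 g -> L1 (fun x => h x + g x).
Proof. by move=> ih ig; exact: (integrableD measurableT ih ig). Qed.

Lemma L1B h g : L1 h -> L1 g -> L1 (fun x => h x - g x).
Proof. by move=> ih ig; exact: (integrableB measurableT ih ig). Qed.

Lemma L1Z a h : L1 h -> L1 (fun x => a * h x).
Proof. by move=> ih; exact: (integrableZl measurableT _ ih). Qed.

Lemma L1abs h : L1 h -> L1 (fun x => `|h x|).
Proof. by move=> ih; exact: integrable_norm. Qed.

Lemma L1_ge0P h : measurable_fun setT h -> (forall x, 0 <= h x) ->
  L1 h <-> (\int[mu]_x (h x)%:E < +oo)%E.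
Proof.
move=> mh h0; split.
  move/integrableP => [_]; rewrite (_ : (fun x => _) = (fun x => (h x)%:E)) //.
  by apply/funext => x /=; rewrite ger0_norm.
move=> hoo; apply/integrableP; split; first exact/measurable_EFinP.
by under eq_integral do rewrite /= ger0_norm//.
Qed.

(** Total by convention: an infinite integral is sent to 0 by [fine], so integrability has to be
    carried separately by [L1]. *)
Definition RI h := Rintegral mu setT h.

Lemma RI_EFin h : L1 h -> (\int[mu]_x (h x)%:E = (RI h)%:E)%E.
Proof. by move=> ih; rewrite /RI /Rintegral fineK//; exact: integrable_fin_num. Qed.

Lemma RI_le h g : L1 h -> L1 g -> (forall x, h x <= g x) -> RI h <= RI g.
Proof. by move=> ih ig hg; exact: le_Rintegral. Qed.

Lemma RI_ge0 h : (forall x, 0 <= h x) -> 0 <= RI h.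
Proof. by move=> h0; exact: Rintegral_ge0. Qed.

Lemma RI_D h g : L1 h -> L1 g -> RI (fun x => h x + g x) = RI h + RI g.
Proof. by move=> ih ig; exact: RintegralD. Qed.

Lemma RI_B h g : L1 h -> L1 g -> RI (fun x => h x - g x) = RI h - RI g.
Proof. by move=> ih ig; exact: RintegralB. Qed.

Lemma RI_Z a h : L1 h -> RI (fun x => a * h x) = a * RI h.
Proof. by move=> ih; exact: RintegralZl. Qed.

Lemma RI_abs h : L1 h -> `|RI h| <= RI (fun x => `|h x|).
Proof. by move=> ih; exact: le_normr_Rintegral. Qed.

Lemma RI_abs_le h g : measurable_fun setT h -> (forall x, `|h x| <= g x) -> L1 g ->
  `|RI h| <= RI g.
Proof.
move=> mh hg ig; have ih := L1_le mh hg ig.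
by apply: (le_trans (RI_abs ih)); apply: RI_le => //; exact: L1abs.
Qed.

Lemma eq_ae_RI h g : measurable_fun setT h -> measurable_fun setT g ->
  {ae mu, forall x, h x = g x} -> RI h = RI g.
Proof.
move=> mh mg hg; rewrite /RI /Rintegral; congr fine.
apply: ae_eq_integral => //; [exact/measurable_EFinP|exact/measurable_EFinP|].
by apply: (ae_imp hg) => x /= ->.
Qed.

Lemma eq_ae_L1 h g : measurable_fun setT g ->
  {ae mu, forall x, h x = g x} -> L1 h -> L1 g.
Proof.
move=> mg hg ih; have mh := L1_measurable ih.
apply/integrableP; split; first exact/measurable_EFinP.
move/integrableP : ih => [_]; congr (_ < _)%E; apply: ae_eq_integral => //.
- by apply: measurableT_comp => //; exact/measurable_EFinP.
- by apply: measurableT_comp => //; exact/measurable_EFinP.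
- by apply: (ae_imp hg) => x /= ->.
Qed.

Lemma RI_dct (F : nat -> R -> R) h g : (forall n, measurable_fun setT (F n)) ->
  measurable_fun setT h -> {ae mu, forall x, F n x @[n --> \oo] --> h x} ->
  (forall n x, `|F n x| <= g x) -> L1 g -> L1 h /\ RI (F n) @[n --> \oo] --> RI h.
Proof.
move=> mF mh Fh Fg ig.
have Fh' : {ae mu, forall x, setT x -> (EFin \o F n) x @[n --> \oo] --> (EFin \o h) x}.
  apply: (ae_imp Fh) => x Px _; apply/fine_cvgP; split; last exact: Px.
  exact: nearW.
have Fg' : {ae mu, forall x n, setT x -> (`|(EFin \o F n) x| <= (EFin \o g) x)%E}.
  by apply: aeW => x n _ /=; rewrite lee_fin.
have [ih _ cv] := @dominated_convergence _ (measurableTypeR R) R mu setT measurableT _ _ _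
  (fun n => (measurable_EFinP _ _).2 (mF n)) ((measurable_EFinP _ _).2 mh) Fh' ig Fg'.
split => //; rewrite /RI /Rintegral.
apply: fine_cvg; rewrite fineK; first exact: cv.
exact: integrable_fin_num.
Qed.

(** By uniqueness of Lebesgue measure it suffices to compare intervals: the reflection exchanges the
    open and the closed endpoint and keeps the length. *)
Lemma lebesgue_measure_reflect (x : R) (A : set R) : measurable A ->
  pushforward mu ((fun y => x - y) : _ -> measurableTypeR R) A = mu A.
Proof.
move=> mA; have mphi : measurable_fun setT (fun y : measurableTypeR R => x - y : measurableTypeR R) by meas.
pose phi : {mfun measurableTypeR R >-> measurableTypeR R} := @mfun_Sub _ _ (measurableTypeR R) (measurableTypeR R) _ (mem_set mphi).
apply/esym; apply: (@lebesgue_measure_unique _ (pushforward mu phi)) => //= _ [[a b]] _ <-.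
rewrite /pushforward /= (_ : _ @^-1` _ = `[x - b, x - a[%classic); last first.
  by apply/seteqP; split => y /=; rewrite !in_itv/= => /andP[? ?]; apply/andP; split; lra.
rewrite !lebesgue_measure_itv/= !lte_fin ltrD2l ltrN2; case: ifP => // ab.
by rewrite -!EFinB; congr (_%:E); ring.
Qed.

Lemma ge0_integral_reflect (x : R) (h : R -> \bar R) : measurable_fun setT h ->
  (forall y, 0 <= h y)%E -> (\int[mu]_y h (x - y)%R = \int[mu]_y h y)%E.
Proof.
move=> mh h0; have mphi : measurable_fun setT (fun y : measurableTypeR R => x - y : measurableTypeR R) by meas.
transitivity (\int[pushforward mu ((fun y => x - y)%R : _ -> measurableTypeR R)]_y h y)%E.
  by rewrite ge0_integral_pushforward.
by apply: eq_measure_integral => A mA _; exact: lebesgue_measure_reflect.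
Qed.

Lemma RI_reflect (x : R) h : measurable_fun setT h -> RI (fun y => h (x - y)) = RI h.
Proof.
move=> mh; rewrite /RI /Rintegral; congr fine.
rewrite integralE [in RHS]integralE; congr (_ - _)%E.
  rewrite -(ge0_integral_reflect x (h := (EFin \o h)^\+%E))//; last exact/measurable_funepos/measurable_EFinP.
  by apply: eq_integral => y _; rewrite !funeposE.
rewrite -(ge0_integral_reflect x (h := (EFin \o h)^\-%E))//; last exact/measurable_funeneg/measurable_EFinP.
by apply: eq_integral => y _; rewrite !funenegE.
Qed.

Lemma L1_reflect (x : R) h : L1 h -> L1 (fun y => h (x - y)).
Proof.
move=> /integrableP[/measurable_EFinP mh hoo]; apply/integrableP; split.
  by apply/measurable_EFinP; meas.
rewrite (ge0_integral_reflect x (h := fun y => `|(h y)%:E|%E))//.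
by apply: measurableT_comp => //; exact/measurable_EFinP.
Qed.

Lemma tonelli (F : R * R -> R) : measurable_fun setT F -> (forall z, 0 <= F z) ->
  (\int[mu]_x \int[mu]_y (F (x, y))%:E = \int[mu]_y \int[mu]_x (F (x, y))%:E)%E.
Proof.
move=> mF F0; apply: (@fubini_tonelli _ _ (measurableTypeR R) (measurableTypeR R) R mu mu (fun z => (F z)%:E)) => //.
exact/measurable_EFinP.
Qed.

Lemma measurable_ge0_section_integral (F : R * R -> R) :
  measurable_fun setT F -> (forall z, 0 <= F z) ->
  measurable_fun setT (fun x => \int[mu]_y (F (x, y))%:E)%E.
Proof.
move=> mF F0; apply: (@measurable_fun_fubini_tonelli_F _ _ (measurableTypeR R) (measurableTypeR R) R mu (fun z => (F z)%:E)) => //.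
exact/measurable_EFinP.
Qed.

Lemma measurable_section_RI (F : R * R -> R) :
  measurable_fun setT F -> measurable_fun setT (fun x => RI (fun y => F (x, y))).
Proof.
move=> mF; rewrite /RI /Rintegral.
apply: (measurableT_comp (@fine_measurable R setT measurableT)) => //.
rewrite (_ : (fun x => _) = (fun x => \int[mu]_y ((EFin \o F)^\+ (x, y))
   - \int[mu]_y ((EFin \o F)^\- (x, y)))%E); last first.
  by apply/funext => x; rewrite integralE; congr (_ - _)%E; apply: eq_integral => y _; rewrite !(funeposE, funenegE).
apply: emeasurable_funB.
  apply: (@measurable_fun_fubini_tonelli_F _ _ (measurableTypeR R) (measurableTypeR R) R mu (EFin \o F)^\+%E) => //.
  exact/measurable_funepos/measurable_EFinP.
apply: (@measurable_fun_fubini_tonelli_F _ _ (measurableTypeR R) (measurableTypeR R) R mu (EFin \o F)^\-%E) => //.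
exact/measurable_funeneg/measurable_EFinP.
Qed.

(** A product of integrable functions dominates [F], so [F] is integrable on the plane and so is
    each of its sections; the latter makes the inner [RI] true integrals and not default values. *)
Lemma fubini_dominated (F : R * R -> R) a b : measurable_fun setT F ->
  (forall x y, `|F (x, y)| <= a x * b y) -> L1 a -> L1 b ->
  RI (fun x => RI (fun y => F (x, y))) = RI (fun y => RI (fun x => F (x, y))).
Proof.
move=> mF Fab ia ib.
have ma := L1_measurable ia; have mb := L1_measurable ib.
have secx x : L1 (fun y => F (x, y)).
  by apply: L1_le (Fab x) (L1Z _ ib); exact: measurableT_comp.
have secy y : L1 (fun x => F (x, y)).
  apply: (@L1_le _ (fun x => b y * a x)); first exact: measurableT_comp.
    by move=> x; rewrite mulrC; exact: Fab.
  exact: L1Z.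
have mEF : measurable_fun setT (EFin \o F) by exact/measurable_EFinP.
have iF : (mu \x mu)%E.-integrable setT (EFin \o F).
  apply/integrable12ltyP => //.
  apply: (@le_lt_trans _ _ (\int[mu]_x (`|a x|%:E * \int[mu]_y `|b y|%:E))%E).
    apply: ge0_le_integral => //.
    - by move=> x _; exact: integral_ge0.
    - apply: (@measurable_fun_fubini_tonelli_F _ _ (measurableTypeR R) (measurableTypeR R) R mu (fun z => `|F z|%:E)) => //.
      exact/measurable_EFinP/measurableT_comp.
    - by apply: emeasurable_funM => //; exact/measurable_EFinP/measurableT_comp.
    - move=> x _; rewrite -ge0_integralZl//; last exact/measurable_EFinP/measurableT_comp.
      apply: ge0_le_integral => //.
      + by apply/measurable_EFinP/measurableT_comp => //; exact: measurableT_comp.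
      + by apply/measurable_EFinP/measurable_funM => //; exact: measurableT_comp.
      + by move=> y _; rewrite -EFinM lee_fin (le_trans (Fab x y))// -normrM ler_norm.
  rewrite (RI_EFin (L1abs ib)) ge0_integralZr//; last 2 first.
  - exact/measurable_EFinP/measurableT_comp.
  - by rewrite lee_fin; exact: RI_ge0.
  by rewrite (RI_EFin (L1abs ia)) -EFinM ltry.
rewrite /RI {1}/Rintegral [in RHS]/Rintegral; congr fine.
transitivity (\int[mu]_x \int[mu]_y (F (x, y))%:E)%E.
  by apply: eq_integral => x _; rewrite RI_EFin.
rewrite (Fubini iF); apply: eq_integral => y _.
by rewrite -RI_EFin.
Qed.

End IntegrationTools.

(** * L_p norms *)

Section LebesgueNorms.
Context {R : realType}.
Local Notation mu := (@lebesgue_measure R).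
Implicit Types (u v h : R -> R) (q : R).

Definition nrm q u : R := fine (normLp q u).

Lemma normLpE q u : normLp q u = ((\int[mu]_x (`|u x| `^ q)%:E) `^ q^-1)%E.
Proof. by rewrite /normLp unlock. Qed.

Lemma inLpP q u : 0 < q -> inLp q u <->
  measurable_fun setT u /\ L1 (fun x => `|u x| `^ q).
Proof.
move=> q0; split => -[mu_ h]; (split; first by []).
  apply/L1_ge0P; [by meas|by move=> x; exact: powR_ge0|].
  by move: h; rewrite normLpE => /lty_poweRy; apply; rewrite invr_eq0 gt_eqF.
rewrite normLpE poweR_lty//.
by apply/L1_ge0P; [by meas|by move=> x; exact: powR_ge0|].
Qed.

Lemma inLp_measurable q u : inLp q u -> measurable_fun setT u.
Proof. by case. Qed.

Lemma inLp_L1 q u : 0 < q -> inLp q u -> L1 (fun x => `|u x| `^ q).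
Proof. by move=> q0 /inLpP[]. Qed.

Lemma nrm_EFin q u : inLp q u -> (nrm q u)%:E = normLp q u.
Proof. by move=> [_ h]; rewrite /nrm fineK// ge0_fin_numE// Lnorm_ge0. Qed.

Lemma nrm_ge0 q u : 0 <= nrm q u.
Proof. by rewrite /nrm fine_ge0// Lnorm_ge0. Qed.

Lemma nrmE q u : 0 < q -> inLp q u -> nrm q u = RI (fun x => `|u x| `^ q) `^ q^-1.
Proof. by move=> q0 hu; rewrite /nrm normLpE RI_EFin ?poweR_EFin//; exact: inLp_L1. Qed.

Lemma nrm_powR q u : 0 < q -> inLp q u -> nrm q u `^ q = RI (fun x => `|u x| `^ q).
Proof.
move=> q0 hu; rewrite nrmE// -powRrM mulVf ?gt_eqF// powRr1//.
by apply: RI_ge0 => x; exact: powR_ge0.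
Qed.

Lemma inLp_le q u v : 0 < q -> measurable_fun setT v -> inLp q u ->
  (forall x, `|v x| <= `|u x|) -> inLp q v.
Proof.
move=> q0 mv hu vu; apply/inLpP => //; split => //.
apply: (L1_le (g := fun x => `|u x| `^ q)); [by meas| |exact: inLp_L1].
by move=> x; rewrite ger0_norm ?powR_ge0// ge0_ler_powR// ?nnegrE// ltW.
Qed.

Lemma nrm_le q u v : 0 < q -> inLp q v -> inLp q u ->
  (forall x, `|v x| <= `|u x|) -> nrm q v <= nrm q u.
Proof.
move=> q0 hv hu vu; rewrite (nrmE q0 hu) (nrmE q0 hv); apply: ge0_ler_powR.
- by rewrite invr_ge0 ltW.
- by rewrite nnegrE; apply: RI_ge0 => x; exact: powR_ge0.
- by rewrite nnegrE; apply: RI_ge0 => x; exact: powR_ge0.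
apply: RI_le; [exact: inLp_L1|exact: inLp_L1|].
by move=> x; rewrite ge0_ler_powR// ?nnegrE// ltW.
Qed.

Lemma inLp_ae q u v : 0 < q -> measurable_fun setT v -> inLp q u ->
  {ae mu, forall x, u x = v x} -> inLp q v.
Proof.
move=> q0 mv hu uv; have mu_ := inLp_measurable hu; apply/inLpP => //; split => //.
apply: (eq_ae_L1 (h := fun x => `|u x| `^ q)); [by meas| |exact: inLp_L1].
by apply: (ae_imp uv) => x ->.
Qed.

Lemma nrm_ae q u v : 0 < q -> inLp q u -> inLp q v ->
  {ae mu, forall x, u x = v x} -> nrm q u = nrm q v.
Proof.
move=> q0 hu hv uv; rewrite (nrmE q0 hu) (nrmE q0 hv); apply: (f_equal (fun t => t `^ q^-1)).
have mu_ := inLp_measurable hu; have mv := inLp_measurable hv.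
by apply: eq_ae_RI; [by meas|by meas|apply: (ae_imp uv) => x ->].
Qed.

Lemma normLpD_le q u v : 1 <= q -> measurable_fun setT u -> measurable_fun setT v ->
  (normLp q (fun x => u x + v x)%R <= normLp q u + normLp q v)%E.
Proof. by move=> q1 mu_ mv; exact: minkowski_EFin. Qed.

Lemma inLpD q u v : 1 <= q -> inLp q u -> inLp q v -> inLp q (fun x => u x + v x).
Proof.
move=> q1 [mu_ hu] [mv hv]; split; first by meas.
by apply: le_lt_trans (normLpD_le q1 mu_ mv) _; rewrite lte_add_pinfty.
Qed.

Lemma nrmD q u v : 1 <= q -> inLp q u -> inLp q v ->
  nrm q (fun x => u x + v x) <= nrm q u + nrm q v.
Proof.
move=> q1 hu hv; rewrite -lee_fin EFinD !nrm_EFin//; last exact: inLpD.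
by apply: normLpD_le => //; exact: inLp_measurable (_ : inLp q _).
Qed.

Lemma inLpZ q a u : 0 < q -> inLp q u -> inLp q (fun x => a * u x).
Proof.
move=> q0 hu; have mu_ := inLp_measurable hu; apply/inLpP => //; split; first by meas.
apply: (L1_le (g := fun x => `|a| `^ q * `|u x| `^ q)); first by meas.
  by move=> x; rewrite ger0_norm ?powR_ge0// normrM powRM.
by apply: L1Z; exact: inLp_L1.
Qed.

Lemma nrmZ q a u : 0 < q -> inLp q u -> nrm q (fun x => a * u x) = `|a| * nrm q u.
Proof.
move=> q0 hu; rewrite (nrmE q0 hu) (nrmE q0 (inLpZ a q0 hu)).
rewrite (_ : (fun x => _) = (fun x => `|a| `^ q * `|u x| `^ q)); last first.
  by apply/funext => x; rewrite normrM powRM.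
rewrite RI_Z; last exact: inLp_L1.
rewrite powRM ?powR_ge0//; last by apply: RI_ge0 => x; exact: powR_ge0.
by rewrite -powRrM mulfV ?gt_eqF// powRr1.
Qed.

Lemma inLpN q u : 0 < q -> inLp q u -> inLp q (fun x => - u x).
Proof.
move=> q0 hu; apply: (inLp_le q0 _ hu); last by move=> x; rewrite normrN.
by have := inLp_measurable hu => mu_; meas.
Qed.

Lemma nrmN q u : 0 < q -> inLp q u -> nrm q (fun x => - u x) = nrm q u.
Proof.
move=> q0 hu; have hNu := inLpN q0 hu.
by apply/eqP; rewrite eq_le; apply/andP; split; apply: nrm_le => // x; rewrite normrN.
Qed.

Lemma inLpB q u v : 1 <= q -> inLp q u -> inLp q v -> inLp q (fun x => u x - v x).
Proof. by move=> q1 hu hv; apply: inLpD => //; apply: inLpN => //; lra. Qed.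

Lemma nrmB q u v : 1 <= q -> inLp q u -> inLp q v ->
  nrm q (fun x => u x - v x) <= nrm q u + nrm q v.
Proof.
move=> q1 hu hv; have q0 : 0 < q by lra.
have hNv := inLpN q0 hv.
by rewrite -(nrmN q0 hv); exact: nrmD.
Qed.

Lemma inLp0 q : 0 < q -> inLp q (fun _ : R => 0).
Proof.
move=> q0; apply/inLpP => //; split => //.
rewrite (_ : (fun x => _) = cst 0); first exact: integrable0.
by apply/funext => x; rewrite normr0 powR0// gt_eqF.
Qed.

Lemma nrm0 q : 0 < q -> nrm q (fun _ : R => 0) = 0.
Proof.
move=> q0; have := nrmZ 0 q0 (inLp0 q0); rewrite normr0 [RHS]mul0r => {2}<-.
by congr nrm; apply/funext => x; rewrite mul0r.
Qed.

Lemma inLpabs q u : 0 < q -> inLp q u -> inLp q (fun x => `|u x|).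
Proof.
move=> q0 hu; apply: (inLp_le q0 _ hu); last by move=> x; rewrite normr_id.
by have := inLp_measurable hu => mu_; meas.
Qed.

Lemma nrmabs q u : 0 < q -> inLp q u -> nrm q (fun x => `|u x|) = nrm q u.
Proof.
move=> q0 hu; have hNu := inLpabs q0 hu.
by apply/eqP; rewrite eq_le; apply/andP; split; apply: nrm_le => // x; rewrite normr_id.
Qed.

Lemma nrm_eq0 q u : 0 < q -> inLp q u -> nrm q u = 0 -> {ae mu, forall x, u x = 0}.
Proof.
move=> q0 hu u0; have mu_ := inLp_measurable hu.
have : normLp q u = 0%E by rewrite -nrm_EFin// u0.
have q0' : (0 < q%:E)%E by rewrite lte_fin.
move=> /(Lnorm_eq0_eq0 (mu := mu) ((measurable_EFinP _ _).2 mu_) q0') h.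
by apply: (filterS (F := almost_everywhere mu)) h => x /= /(_ I) [].
Qed.

Lemma hoelder_inLp q q' u v : 0 < q -> 0 < q' -> q^-1 + q'^-1 = 1 ->
  inLp q u -> inLp q' v ->
  L1 (fun x => u x * v x) /\ RI (fun x => `|u x * v x|) <= nrm q u * nrm q' v.
Proof.
move=> q0 q'0 qq' hu hv.
have mu_ := inLp_measurable hu; have mv := inLp_measurable hv.
have := hoelder mu mu_ mv q0 q'0 qq'.
rewrite -/(normLp q u) -/(normLp q' v) -!nrm_EFin// -EFinM Lnorm1 => h.
have i : L1 (fun x => u x * v x).
  apply/integrableP; split; first by apply/measurable_EFinP; meas.
  exact: le_lt_trans h (ltry _).
by split => //; move: h; rewrite (RI_EFin (L1abs i)).
Qed.

(** |u|^q2 = |u|^(q2 - q1) |u|^q1, and the first factor is at most M^(q2 - q1). *)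
Lemma inLp_bounded q1 q2 (M : R) u : 0 < q1 -> q1 <= q2 -> inLp q1 u ->
  (forall x, `|u x| <= M) -> inLp q2 u.
Proof.
move=> q10 q12 hu uM; have mu_ := inLp_measurable hu.
have q20 : 0 < q2 by lra.
apply/inLpP => //; split => //.
apply: (L1_le (g := fun x => M `^ (q2 - q1) * `|u x| `^ q1)); first by meas.
  move=> x; rewrite ger0_norm ?powR_ge0//.
  have M0 : 0 <= M by apply: le_trans (uM x).
  have -> : `|u x| `^ q2 = `|u x| `^ (q2 - q1) * `|u x| `^ q1.
    by rewrite -powRD subrK// gt_eqF.
  by rewrite ler_wpM2r ?powR_ge0// ge0_ler_powR// ?nnegrE//; lra.
by apply: L1Z; exact: inLp_L1.
Qed.

End LebesgueNorms.

(** * Fundamental theorem of calculus and integrability of model kernels *)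

Section ExplicitIntegrals.
Context {R : realType}.
Local Notation mu := (@lebesgue_measure R).

Lemma derivable_continuous1 (F : R -> R) (x : R) : derivable F x 1 -> {for x, continuous F}.
Proof. by move=> dF; apply: differentiable_continuous; apply/derivable1_diffP. Qed.

Lemma ftc_segment (F h : R -> R) (a b : R) : a <= b ->
  (forall x, a <= x <= b -> is_derive x 1 F (h x)) -> (forall x, a <= x <= b -> {for x, continuous h}) ->
  (\int[mu]_(x in `[a, b]) (h x)%:E = (F b - F a)%:E)%E.
Proof.
rewrite le_eqVlt => /predU1P[<- _ _|ab dF ch]; first by rewrite set_itv1 integral_set1 subrr.
have cF x : a <= x <= b -> {for x, continuous F}.
  by move=> /dF [dFx _]; exact: derivable_continuous1.
rewrite EFinB; apply: continuous_FTC2 => //.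
- apply: continuous_in_subspaceT => x /[!inE]/=; rewrite in_itv/= => xab; exact: ch.
- split.
  + by move=> x; rewrite in_itv/= => /andP[? ?]; case: (dF x) => //; apply/andP; split; exact: ltW.
  + by apply: cvg_at_right_filter; apply: cF; rewrite lexx ltW.
  + by apply: cvg_at_left_filter; apply: cF; rewrite lexx ltW.
- move=> x; rewrite in_itv/= => /andP[? ?]; rewrite derive1E.
  by have [|_ ->] := dF x; first (apply/andP; split; exact: ltW).
Qed.

Lemma indic_itvE (i : interval R) (x : R) : \1_[set` i] x = (x \in i)%:R :> R.
Proof. by rewrite indicE; congr (_%:R); congr nat_of_bool; apply/idP/idP; rewrite inE. Qed.

Lemma L1_restrict (D : set R) (h : R -> R) : measurable D ->
  mu.-integrable D (EFin \o h) -> L1 (fun x => \1_D x * h x).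
Proof.
move=> mD ih; rewrite /L1.
have := (@integrable_mkcond _ (measurableTypeR R) R mu _ (EFin \o h) mD).1 ih.
apply: eq_integrable => // x _.
by rewrite /= patchE indicE; case: ifP => xD; rewrite ?mul1r ?mul0r.
Qed.

Lemma RI_restrict (D : set R) (h : R -> R) :
  RI (fun x => \1_D x * h x) = Rintegral mu D h.
Proof.
rewrite /RI Rintegral_mkcond; apply: eq_Rintegral => x _.
by rewrite patchE indicE; case: ifP => xD; rewrite ?mul1r ?mul0r.
Qed.

Lemma L1_segment_continuous (h : R -> R) (a b : R) : (forall x, a <= x <= b -> {for x, continuous h}) ->
  mu.-integrable `[a, b] (EFin \o h).
Proof.
move=> ch; apply: continuous_compact_integrable; first exact: segment_compact.
by apply: continuous_in_subspaceT => x /[!inE]/=; rewrite in_itv/= => xab; exact: ch.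
Qed.

Lemma L1_indic_segment (a b : R) : L1 (\1_(`[a, b]) : R -> R).
Proof.
have -> : (\1_(`[a, b]) : R -> R) = (fun x => \1_(`[a, b]) x * 1) by apply/funext => x; rewrite mulr1.
apply: L1_restrict => //; apply: L1_segment_continuous => x _; exact: cst_continuous.
Qed.

Lemma L1_inv_sqr_ge1 : L1 (fun t : R => \1_(`[1, +oo[) t * (t ^+ 2)^-1).
Proof.
apply: L1_restrict => //.
have h0 (x : R) : 1 <= x -> 0 <= (x ^+ 2)^-1 by move=> _; rewrite invr_ge0 sqr_ge0.
have cV (x : R) : x != 0 -> {for x, continuous (fun y : R => (y ^+ 2)^-1)}.
  move=> x0; apply: (@continuousV R R (fun y : R => y ^+ 2)); first by rewrite expf_eq0.
  exact: exprn_continuous.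
have e : (\int[mu]_(x in `[1%R, +oo[) ((x ^+ 2)^-1)%:E = 0%:E - (- (1^-1))%:E)%E.
  apply: (ge0_continuous_FTC2y (F := fun x : R => - x^-1)) => //.
  - apply: continuous_in_subspaceT => x /[!inE]/=; rewrite in_itv/= andbT => x1.
    by apply: cV; rewrite gt_eqF// (lt_le_trans _ x1).
  - rewrite -[X in _ --> X]oppr0; apply: cvgN; apply/gtr0_cvgV0; last exact: cvg_id.
    exact: nbhs_pinfty_gt.
  - move=> x x1; have x0 : x != 0 by rewrite gt_eqF// (lt_trans _ x1).
    by apply: derivableN; apply: derivableV.
  - apply: cvg_at_right_filter; apply: cvgN; apply: inv_continuous; exact: oner_neq0.
  - move=> x; rewrite in_itv/= andbT => x1; have x0 : x != 0 by rewrite gt_eqF// (lt_trans _ x1).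
    rewrite derive1E deriveN; last exact: derivableV.
    by rewrite deriveV// derive_id scaler1 opprK.
apply/integrableP; split.
  apply/measurable_EFinP; apply: measurable_funTS; by meas.
rewrite (@eq_integral _ (measurableTypeR R) R mu _ (fun x => ((x ^+ 2)^-1)%:E)); last first.
  by move=> x _; rewrite /= ger0_norm// invr_ge0 sqr_ge0.
by rewrite e -EFinB ltry.
Unshelve. all: by end_near. Qed.

Lemma L1_far : L1 (fun t : R => (1 - unit_cut t) * (t ^+ 2)^-1).
Proof.
have i1 := L1_inv_sqr_ge1; have i2 := L1_reflect 0 i1.
apply: L1_le (L1D i1 i2).
  by have := @measurable_unit_cut R => ?; meas.
move=> t; rewrite ger0_norm; last first.
  by rewrite mulr_ge0 ?invr_ge0 ?sqr_ge0// subr_ge0 unit_cut_le1.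
rewrite sub0r sqrrN -mulrDl ler_wpM2r ?invr_ge0 ?sqr_ge0//.
rewrite /unit_cut !indic_itvE !in_itv/= !andbT.
case: ltP => h; first by rewrite subrr addr_ge0.
by rewrite subr0 -natrD ler1n addn_gt0 !lt0b; move: h; rewrite ler_normr.
Qed.

(** The power may be unbounded at 0, so the integral over ]0, 1] is the limit of those over
    [1/(n+1), 1], each at most 1/b by the antiderivative t^b / b. Negative t are covered by a
    reflected copy. *)
Lemma L1_near (b : R) : 0 < b -> L1 (fun t : R => unit_cut t * `|t| `^ (b - 1)).
Proof.
move=> b0; pose h (t : R) := \1_(`[0, 1]) t * t `^ (b - 1).
have mh : measurable_fun setT (fun t : R => t `^ (b - 1)) by meas.
have ih : L1 h.
  apply: L1_restrict => //; apply/integrableP; split.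
    by apply/measurable_EFinP; exact: measurable_funTS.
  rewrite (@eq_integral _ (measurableTypeR R) R mu _ (fun x => (x `^ (b - 1))%:E)); last first.
    by move=> x _; rewrite /= ger0_norm// powR_ge0.
  rewrite -integral_itv_obnd_cbnd; last by apply/measurable_EFinP; exact: measurable_funTS.
  have := @ge0_nondecreasing_set_cvg_integral _ (measurableTypeR R) R (fun n : nat => `[(n.+1%:R^-1 : R), 1]%classic)
    (fun x => (x `^ (b - 1))%:E) mu _ _ _ _.
  have -> : \bigcup_i `[(i.+1%:R^-1 : R), 1]%classic = `]0, 1]%classic.
    apply/seteqP; split => x /=.
      move=> [n _] /=; rewrite !in_itv/= => /andP[nx ->]; rewrite andbT.
      by apply: lt_le_trans nx; rewrite invr_gt0 ltr0n.
    rewrite in_itv/= => /andP[x0 x1].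
    have [n nx] := ltr_add_invr x0; exists n => //=.
    by rewrite in_itv/= x1 andbT; move: nx; rewrite add0r => /ltW.
  have mh' i : measurable_fun `[(i.+1%:R^-1 : R), 1] (fun x : measurableTypeR R => (x `^ (b - 1))%:E).
    by apply/measurable_EFinP; exact: measurable_funTS.
  have nd : nondecreasing_seq (fun n : nat => `[(n.+1%:R^-1 : R), 1]%classic).
    move=> m n mn; rewrite subsetEset => x /=; rewrite !in_itv/= => /andP[mx ->]; rewrite andbT.
    by apply: le_trans mx; rewrite lef_pV2 ?posrE ?ltr0n// ler_nat.
  have x0 (i : nat) (x : measurableTypeR R) : `[(i.+1%:R^-1 : R), 1]%classic x -> (0%R <= (x `^ (b - 1))%:E)%E.
    by rewrite lee_fin powR_ge0.
  move=> /(_ nd (fun=> measurable_itv _) mh' x0) cv.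
  rewrite (_ : (\int[_]_(x in _) _)%E = limn (fun i : nat => \int[mu]_(x in `[i.+1%:R^-1%R, 1%R]) (x `^ (b - 1))%:E)%E); last first.
    by apply/esym/cvg_lim.
  apply: (@le_lt_trans _ _ (b^-1)%:E); last exact: ltry.
  apply: lime_le.
    exact: cvgP cv.
  apply: nearW => n.
  have n0 : 0 < n.+1%:R^-1 :> R by rewrite invr_gt0 ltr0n.
  have -> : (\int[mu]_(x in `[n.+1%:R^-1%R, 1%R]) (x `^ (b - 1))%:E =
    (b^-1 * 1 `^ b - b^-1 * n.+1%:R^-1 `^ b)%:E)%E.
    apply: (@ftc_segment (fun x => b^-1 * x `^ b)).
    - by rewrite invf_le1 ?ler1n ?ltr0n.
    - move=> x /andP[nx _]; have xp := lt_le_trans n0 nx.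
      have dx := is_derive1_powR b xp.
      rewrite (_ : x `^ (b - 1) = b^-1 *: (b * x `^ (b - 1))); first exact: is_deriveZ.
      by rewrite /GRing.scale /= mulrA mulVf ?mul1r// gt_eqF.
    - move=> x /andP[nx _]; have xp := lt_le_trans n0 nx.
      by apply: derivable_continuous1; have [] := is_derive1_powR (b - 1) xp.
  rewrite lee_fin powR1 mulr1 lerBlDr lerDl mulr_ge0 ?powR_ge0// invr_ge0; exact: ltW.
apply: (L1_le _ _ (L1D ih (L1_reflect 0 ih))).
  by have := @measurable_unit_cut R => ?; meas.
move=> t; rewrite ger0_norm ?mulr_ge0 ?powR_ge0 ?unit_cut_ge0//.
rewrite /h /unit_cut !indic_itvE !in_itv/= sub0r.
have [t0|t0] := leP 0 t.
  rewrite ger0_norm//; apply: (@le_trans _ _ ((true && (t <= 1))%R%:R * t `^ (b - 1))).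
    by rewrite ler_wpM2r ?powR_ge0//=; case: ltP => t1; rewrite ?ler0n// (ltW t1).
  by rewrite lerDl mulr_ge0 ?ler0n ?powR_ge0.
rewrite ltr0_norm// oppr_ge0 (ltW t0) /= mul0r add0r.
by case: (ltP (- t) 1) => t1; rewrite ?mul0r ?mulr_ge0 ?powR_ge0// (ltW t1).
Qed.

(** The majorant is 1 on the unit window ([L1_near] with exponent 0) and 1/t^2 outside. *)
Lemma L1_inv1sqr : L1 (fun t : R => (1 + t ^+ 2)^-1).
Proof.
apply: L1_le (L1D (L1_near (ltr01 : 0 < 1 :> R)) L1_far); first by meas.
move=> t; rewrite ger0_norm; last by rewrite invr_ge0 addr_ge0 ?sqr_ge0.
rewrite subrr powRr0 mulr1 /unit_cut; case: ltP => h.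
  by rewrite subrr mul0r addr0 invf_le1 ?lerDl ?sqr_ge0// ltr_wpDr ?sqr_ge0.
rewrite subr0 mul1r add0r lef_pV2 ?posrE ?ltr_wpDr ?sqr_ge0//; first by rewrite lerDr.
by rewrite -real_normK ?num_real// exprn_gt0// (lt_le_trans _ h).
Qed.

End ExplicitIntegrals.

(** * Polar coordinates along a curve *)

Section PolarDerivatives.
Context {R : realType}.
Implicit Types (F X Y : R -> R).

Lemma is_derive_div F X (dF dX x : R) : X x != 0 -> is_derive x 1 F dF -> is_derive x 1 X dX ->
  is_derive x 1 (fun y => F y / X y) ((dF * X x - F x * dX) / X x ^+ 2).
Proof.
move=> X0 hF hX; have hV := is_deriveV X0 hX.
apply: (is_derive_eq (is_deriveM hF hV)).
rewrite /GRing.scale /=; field; exact: X0.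
Qed.

Lemma is_derive_norm_sqr X Y (dX dY x : R) : is_derive x 1 X dX -> is_derive x 1 Y dY ->
  is_derive x 1 (fun y => X y ^+ 2 + Y y ^+ 2) (2 * (X x * dX + Y x * dY)).
Proof.
move=> hX hY.
have sq (Z : R -> R) (dZ : R) : is_derive x 1 Z dZ -> is_derive x 1 (fun y => Z y ^+ 2) (2 * (Z x * dZ)).
  move=> hZ; apply: (is_derive_eq (is_deriveM hZ hZ)).
  by rewrite /GRing.scale /= mulr_natl mulr2n.
by apply: (is_derive_eq (is_deriveD (sq _ _ hX) (sq _ _ hY))); rewrite -mulrDr.
Qed.

Lemma is_derive_ln_norm X Y (dX dY x : R) : 0 < X x ^+ 2 + Y x ^+ 2 ->
  is_derive x 1 X dX -> is_derive x 1 Y dY ->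
  is_derive x 1 (fun y => ln (X y ^+ 2 + Y y ^+ 2) / 2)
    ((X x * dX + Y x * dY) / (X x ^+ 2 + Y x ^+ 2)).
Proof.
move=> D0 hX hY; have hD := is_derive_norm_sqr hX hY.
have h := @is_derive1_comp _ (@ln R) (fun y => X y ^+ 2 + Y y ^+ 2) x _ _ (is_derive1_ln D0) hD.
rewrite (_ : (fun y => _) = (fun y => 2^-1 *: ln (X y ^+ 2 + Y y ^+ 2))); last first.
  by apply/funext => y; rewrite /GRing.scale /= mulrC.
apply: (is_derive_eq (is_deriveZ 2^-1 h)).
rewrite /GRing.scale /=; field; exact: lt0r_neq0.
Qed.

(* Half-angle form of the angle from the positive y-axis: smooth off the
   half-line X = 0, Y <= 0, hence along any curve Y > 0 at X = 0. *)
Definition angle (a b : R) : R := 2 * atan (a / (b + Num.sqrt (a ^+ 2 + b ^+ 2))).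

(** When a is nonzero the square root exceeds |b|, so the denominator can vanish only on the
    half-line a = 0, b <= 0. *)
Lemma angle_den_gt0 (a b : R) : a != 0 \/ 0 < b -> 0 < b + Num.sqrt (a ^+ 2 + b ^+ 2).
Proof.
move=> h; have [b0|b0] := ltP 0 b; first by rewrite ltr_pwDl// sqrtr_ge0.
have a0 : a != 0 by case: h => // h; move: (lt_le_trans h b0); rewrite ltxx.
rewrite -ltrBlDl sub0r -(ger0_norm (_ : 0 <= - b)) ?oppr_ge0// -sqrtr_sqr.
have D0 : 0 < a ^+ 2 + b ^+ 2 by rewrite ltr_pwDl ?sqr_ge0// exprn_even_gt0.
by rewrite (ltr_sqrt _ D0) sqrrN ltrDr exprn_even_gt0.
Qed.

(** The sign is opposite to that of the usual argument because the angle runs clockwise from the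
    vertical. *)
Lemma is_derive_angle X Y (dX dY x : R) : X x != 0 \/ 0 < Y x ->
  is_derive x 1 X dX -> is_derive x 1 Y dY ->
  is_derive x 1 (fun y => angle (X y) (Y y))
    ((dX * Y x - X x * dY) / (X x ^+ 2 + Y x ^+ 2)).
Proof.
move=> h hX hY; have den0 := angle_den_gt0 h.
have D0 : 0 < X x ^+ 2 + Y x ^+ 2.
  case: h => [X0|Y0]; first by rewrite ltr_pwDl ?sqr_ge0// exprn_even_gt0.
  by rewrite ltr_wpDl ?sqr_ge0// exprn_gt0.
have hD := is_derive_norm_sqr hX hY.
have hr := @is_derive1_comp _ Num.sqrt (fun y => X y ^+ 2 + Y y ^+ 2) x _ _ (is_derive1_sqrt D0) hD.
have hq := @is_derive_div X (fun y => Y y + Num.sqrt (X y ^+ 2 + Y y ^+ 2)) _ _ x (lt0r_neq0 den0) hX (is_deriveD hY hr).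
have ha := is_derive1_comp (is_derive1_atan _) hq.
apply: (is_derive_eq (is_deriveZ 2 ha)).
rewrite /= /GRing.scale /=.
have r0 : 0 < Num.sqrt (X x ^+ 2 + Y x ^+ 2) by rewrite sqrtr_gt0.
have rD : Num.sqrt (X x ^+ 2 + Y x ^+ 2) ^+ 2 = X x ^+ 2 + Y x ^+ 2 by rewrite sqr_sqrtr// ltW.
move: r0 rD den0; set r := Num.sqrt _ => r0 rD den0.
have e1 : X x ^+ 2 = r ^+ 2 - Y x ^+ 2 by rewrite rD addrK.
(* With r the modulus, this is 1 + tan^2 of the half angle, simplified through X^2 = r^2 - Y^2. *)
have -> : (1 + (X x / (Y x + r)) ^+ 2)^-1 = (Y x + r) / (2 * r).
  rewrite expr_div_n e1.
  have -> : 1 + (r ^+ 2 - Y x ^+ 2) / (Y x + r) ^+ 2 = (2 * r) / (Y x + r).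
    by field; rewrite gt_eqF.
  by rewrite invf_div.
rewrite -rD.
have -> : (dX * (Y x + r) - X x * (dY + (2 * r)^-1 * (2 * (X x * dX + Y x * dY)))) =
   (Y x + r) * (dX * Y x - X x * dY) / r.
  apply: (@mulIf _ r); first by rewrite gt_eqF.
  rewrite divfK ?gt_eqF//.
  have -> : (2 * r)^-1 * (2 * (X x * dX + Y x * dY)) = (X x * dX + Y x * dY) / r.
    by field; rewrite gt_eqF.
  transitivity (dX * (Y x + r) * r - X x * (dY * r) - X x ^+ 2 * dX - X x * Y x * dY).
    by field; rewrite gt_eqF.
  rewrite e1; ring.
by field; rewrite !gt_eqF.
Qed.

Lemma cvg_sqr (w : nat -> R) (l : R) : w n @[n --> \oo] --> l -> w n ^+ 2 @[n --> \oo] --> l ^+ 2.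
Proof. by move=> wl; rewrite expr2; under eq_fun do rewrite expr2; exact: cvgM. Qed.

Lemma cvg_ratio_0 (a b : nat -> R) (M : R) : `|a n| @[n --> \oo] --> +oo ->
  (forall n, `|b n| <= M) -> b n / a n @[n --> \oo] --> 0.
Proof.
move=> ha hb; apply/norm_cvg0P.
have h0 : M / `|a n| @[n --> \oo] --> 0.
  rewrite -(mulr0 M); apply: cvgM; first exact: cvg_cst.
  by apply/gtr0_cvgV0 => //; move/cvgryPgt : ha => /(_ 0).
apply: (@squeeze_cvgr _ _ _ _ (fun=> 0) (fun n => M / `|a n|)) => //; last exact: cvg_cst.
apply: nearW => n; rewrite normr_ge0/= normrM normfV.
by rewrite ler_wpM2r ?invr_ge0.
Qed.

(** The ratio b / |a| tends to 0, so the direction becomes horizontal. The limit is left as 2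
    atan(+1 or -1), since only differences of two such limits matter. *)
Lemma cvg_angle (a b : nat -> R) (M : R) (sg : bool) : (forall n, (0 < (-1) ^+ sg * a n)%R) ->
  `|a n| @[n --> \oo] --> +oo -> (forall n, `|b n| <= M) ->
  angle (a n) (b n) @[n --> \oo] --> 2 * atan ((-1) ^+ sg).
Proof.
move=> sa ha hb.
have hw : b n / `|a n| @[n --> \oo] --> 0.
  by apply: (cvg_ratio_0 (M := M)) => //; apply: cvg_trans ha; apply: near_eq_cvg; apply: nearW => n; rewrite normr_id.
have cphi : (-1) ^+ sg / (b n / `|a n| + Num.sqrt (1 + (b n / `|a n|) ^+ 2)) @[n --> \oo] -->
   ((-1) ^+ sg / (0 + Num.sqrt (1 + 0 ^+ 2)) : R).
  apply: cvgM; first exact: cvg_cst.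
  apply: cvgV; first by rewrite expr0n/= addr0 sqrtr1 add0r oner_neq0.
  apply: cvgD => //; apply: (@cvg_comp _ _ _ _ Num.sqrt); last exact: sqrt_continuous.
  by apply: cvgD; [exact: cvg_cst|exact: cvg_sqr].
apply: cvgM; first exact: cvg_cst.
apply: (@cvg_comp _ _ _ _ atan); last exact: continuous_atan.
move: cphi; rewrite expr0n/= addr0 sqrtr1 add0r divr1.
apply: cvg_trans; apply: near_eq_cvg; apply: nearW => n.
have a0 : 0 < `|a n| by rewrite normr_gt0; apply: contraTneq (sa n) => ->; rewrite mulr0 ltxx.
have -> : (-1) ^+ sg = a n / `|a n|.
  move: (sa n); case: (sg) => /=; rewrite ?expr1 ?expr0 ?mulN1r ?mul1r.
    by rewrite oppr_gt0 => an; rewrite ltr0_norm// invrN mulrN mulfV// lt_eqF.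
  by move=> an; rewrite gtr0_norm// mulfV// gt_eqF.
have -> : Num.sqrt (1 + (b n / `|a n|) ^+ 2) = Num.sqrt (a n ^+ 2 + b n ^+ 2) / `|a n|.
  apply: (@mulIf _ `|a n|); first exact: lt0r_neq0.
  rewrite divfK ?lt0r_neq0//.
  transitivity (Num.sqrt (1 + (b n / `|a n|) ^+ 2) * Num.sqrt (a n ^+ 2)); first by rewrite sqrtr_sqr.
  rewrite -sqrtrM ?addr_ge0 ?sqr_ge0//; congr Num.sqrt.
  rewrite mulrDl mul1r; congr (_ + _).
  by rewrite expr_div_n real_normK ?num_real// divfK// expf_neq0// -normr_gt0.
by rewrite -mulrDl invf_div mulrA divfK// gt_eqF.
Qed.

(** Each logarithm diverges, but the quotient of the squared moduli tends to 1, because a1 / a2 = 1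
    + c / a2. *)
Lemma cvg_ln_norm (a1 b1 a2 b2 : nat -> R) (M : R) (c : R) : (forall n, a1 n - a2 n = c) ->
  (forall n, a1 n != 0) -> (forall n, a2 n != 0) ->
  `|a1 n| @[n --> \oo] --> +oo -> `|a2 n| @[n --> \oo] --> +oo ->
  (forall n, `|b1 n| <= M) -> (forall n, `|b2 n| <= M) ->
  ln (a1 n ^+ 2 + b1 n ^+ 2) - ln (a2 n ^+ 2 + b2 n ^+ 2) @[n --> \oo] --> 0.
Proof.
move=> a12 a10 a20 ha1 ha2 hb1 hb2.
have D0 (x y : R) : x != 0 -> 0 < x ^+ 2 + y ^+ 2.
  by move=> x0; rewrite ltr_pwDl ?sqr_ge0// exprn_even_gt0.
have v1 := cvg_ratio_0 ha1 hb1; have v2 := cvg_ratio_0 ha2 hb2.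
have v3 := cvg_ratio_0 ha2 (fun=> lexx `|c|).
have h : (1 + c / a2 n) ^+ 2 * ((1 + (b1 n / a1 n) ^+ 2) / (1 + (b2 n / a2 n) ^+ 2)) @[n --> \oo]
   --> ((1 + 0) ^+ 2 * ((1 + 0 ^+ 2) / (1 + 0 ^+ 2)) : R).
  apply: cvgM; first by apply: cvg_sqr; apply: cvgD; [exact: cvg_cst|].
  apply: cvgM; first by apply: cvgD; [exact: cvg_cst|exact: cvg_sqr].
  apply: cvgV; first by rewrite expr0n addr0 oner_neq0.
  by apply: cvgD; [exact: cvg_cst|exact: cvg_sqr].
rewrite -[X in _ --> X](ln1 R).
have -> : (fun n => ln (a1 n ^+ 2 + b1 n ^+ 2) - ln (a2 n ^+ 2 + b2 n ^+ 2)) =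
  (fun n => ln ((1 + c / a2 n) ^+ 2 * ((1 + (b1 n / a1 n) ^+ 2) / (1 + (b2 n / a2 n) ^+ 2)))).
  apply/funext => n; rewrite -ln_div ?posrE ?D0//; congr ln.
  have -> : c = a1 n - a2 n by rewrite a12.
  field; rewrite a10 a20 !gt_eqF ?D0//.
apply: (@cvg_comp _ _ _ _ (@ln R)); first exact: h.
by rewrite expr0n !addr0 expr1n divr1 mulr1; apply: continuous_ln; exact: ltr01.
Qed.

End PolarDerivatives.

(** * The Rellich identity *)

Section RellichIdentity.
Context {R : realType}.
Local Notation mu := (@lebesgue_measure R).

Implicit Types x y s t eta M : R.

Lemma lipschitz_of_derive (f G : R -> R) (B : R) : (forall x : R, is_derive x 1 f (G x)) ->
  (forall x, `|G x| <= B) -> forall x y, `|f x - f y| <= B * `|x - y|.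
Proof.
move=> df GB; have lt x y : x < y -> `|f x - f y| <= B * `|x - y|.
  move=> xy; rewrite distrC (distrC x); have [c _ ->] : exists2 c, c \in `]x, y[ & f y - f x = G c * (y - x).
    apply: MVT => //; apply: continuous_in_subspaceT => z _.
    by apply: derivable_continuous1; case: (df z).
  by rewrite normrM ler_wpM2r.
move=> x y; have [|yx|<-] := ltgtP x y; first exact: lt.
  by rewrite distrC (distrC x); exact: lt.
by rewrite !subrr normr0 mulr0.
Qed.

Variables (f G : R -> R) (B F0 : R).
Hypothesis df : forall x : R, is_derive x 1 f (G x).
Hypothesis cG : continuous G.
Hypothesis GB : forall x, `|G x| <= B.
Hypothesis fB : forall x, `|f x| <= F0.

Let cf x : {for x, continuous f}.
Proof. by apply: derivable_continuous1; case: (df x). Qed.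

Let mf : measurable_fun setT f.
Proof. by apply: continuous_measurable_fun => x; exact: cf. Qed.

Let mG : measurable_fun setT G. Proof. exact: continuous_measurable_fun. Qed.

(** Let z(x) = x + i f(x) and Z = z(x) - z(s) + i eta. Then [Dd] is |Z|^2 and 1/Z = [KP] - i [KQ]. A
    positive eta evaluates the Cauchy kernel above the graph. *)
Definition Dd (eta x s : R) := (x - s) ^+ 2 + (f x - f s + eta) ^+ 2.
Definition KP (eta x s : R) := (x - s) / Dd eta x s.
Definition KQ (eta x s : R) := (f x - f s + eta) / Dd eta x s.

Lemma Dd_ge0 eta x s : 0 <= Dd eta x s.
Proof. by rewrite /Dd addr_ge0 ?sqr_ge0. Qed.

Lemma Dd_gt0 eta x s : x != s \/ eta != 0 -> 0 < Dd eta x s.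
Proof.
rewrite lt0r Dd_ge0 andbT /Dd paddr_eq0 ?sqr_ge0// !sqrf_eq0 subr_eq0.
have [->|//] := eqVneq x s; rewrite subrr add0r /=; by case.
Qed.

Lemma KPQ_sqr eta x s : KP eta x s ^+ 2 + KQ eta x s ^+ 2 = (Dd eta x s)^-1.
Proof.
have [D0|D0] := eqVneq (Dd eta x s) 0.
  by rewrite /KP /KQ D0 invr0 !mulr0 expr0n addr0.
by rewrite /KP /KQ !expr_div_n -mulrDl -/(Dd eta x s) expr2 invfM mulrA mulfV ?mul1r.
Qed.

Lemma KP_sqr_le eta x s : KP eta x s ^+ 2 <= (Dd eta x s)^-1.
Proof. by rewrite -KPQ_sqr lerDl sqr_ge0. Qed.

Lemma KQ_sqr_le eta x s : KQ eta x s ^+ 2 <= (Dd eta x s)^-1.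
Proof. by rewrite -KPQ_sqr lerDr sqr_ge0. Qed.

(** Close to s the graph changes by at most B |x - s|, so part of the vertical gap eta survives;
    elsewhere |x - s| itself is bounded below. The outcome is an integrable decay 1/(1 + x^2),
    uniform for s in a bounded set. *)
Lemma Dd_lower eta M : 0 < eta -> 0 <= M -> exists2 c : R, 0 < c &
  forall x s, `|s| <= M -> c * (1 + x ^+ 2) <= Dd eta x s.
Proof.
move=> eta0 M0; have B0 : 0 <= B by exact: le_trans (normr_ge0 (G 0)) (GB 0).
(* Chosen so that eta - B e >= e. *)
pose e := eta / (2 * (B + 1)).
have e0 : 0 < e by rewrite divr_gt0// mulr_gt0// ltr_pwDr.
have eB : e * (2 * (B + 1)) = eta by rewrite divfK// gt_eqF// mulr_gt0// ltr_pwDr.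
have De x s : e ^+ 2 <= Dd eta x s.
  rewrite /Dd; have [xs|xs] := lerP e `|x - s|.
    rewrite -(real_normK (num_real (x - s))).
    apply: (@le_trans _ _ (`|x - s| ^+ 2)); last by rewrite lerDl sqr_ge0.
    by rewrite lerXn2r// nnegrE ltW.
  have := lipschitz_of_derive df GB x s; rewrite ler_norml => /andP[h _].
  have h2 : B * `|x - s| <= B * e by rewrite ler_wpM2l// ltW.
  have h3 : e <= f x - f s + eta by nra.
  have := sqr_ge0 (x - s); nra.
have K0 : 0 < 2 + (2 * M ^+ 2 + 1) / e ^+ 2.
  by rewrite ltr_pwDl// divr_ge0 ?sqr_ge0// addr_ge0// mulr_ge0// sqr_ge0.
exists (2 + (2 * M ^+ 2 + 1) / e ^+ 2)^-1; first by rewrite invr_gt0.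
move=> x s sM; rewrite mulrC ler_pdivrMr// mulrDr.
have h1 : Dd eta x s * ((2 * M ^+ 2 + 1) / e ^+ 2) >= 2 * M ^+ 2 + 1.
  rewrite mulrA ler_pdivlMr ?exprn_gt0// mulrC ler_wpM2r//.
  by rewrite addr_ge0// mulr_ge0// sqr_ge0.
have h2 : (x - s) ^+ 2 <= Dd eta x s by rewrite /Dd lerDl sqr_ge0.
have h3 : s ^+ 2 <= M ^+ 2 by rewrite -(real_normK (num_real s)) lerXn2r// nnegrE.
(* This square equals 2 (x - s)^2 + 2 s^2 - x^2. *)
have h4 := sqr_ge0 (x - 2 * s); nra.
Qed.

(** The real part of z'(x) / (Z_s Z_t), with z' = 1 + i G and Z_r = z(x) - z(r) + i eta: the
    bilinear kernel behind the squared Cauchy integral. *)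
Definition pairK (eta s t x : R) := KP eta x s * KP eta x t - KQ eta x s * KQ eta x t
  + G x * (KP eta x s * KQ eta x t + KQ eta x s * KP eta x t).

Lemma is_derive_X s x : is_derive x 1 (fun y : R => y - s) 1.
Proof. by apply: (is_derive_eq (is_deriveB (is_derive_id x 1) (is_derive_cst s x 1))); rewrite subr0. Qed.

Lemma is_derive_Y eta s x : is_derive x 1 (fun y : R => f y - f s + eta) (G x).
Proof.
apply: (is_derive_eq (is_deriveD (is_deriveB (df x) (is_derive_cst (f s) x 1)) (is_derive_cst eta x 1))).
by rewrite subr0 addr0.
Qed.

Lemma continuous_KPQ eta s x : eta != 0 ->
  {for x, continuous (KP eta ^~ s)} /\ {for x, continuous (KQ eta ^~ s)}.
Proof.
move=> e0; have D0 : Dd eta x s != 0 by rewrite gt_eqF// Dd_gt0//; right.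
have dD := is_derive_norm_sqr (is_derive_X s x) (is_derive_Y eta s x).
split; apply: derivable_continuous1.
  by have [] := @is_derive_div _ (fun y => y - s) (fun y => Dd eta y s) _ _ x D0 (is_derive_X s x) dD.
by have [] := @is_derive_div _ (fun y => f y - f s + eta) (fun y => Dd eta y s) _ _ x D0 (is_derive_Y eta s x) dD.
Qed.

(** Partial fractions: 1/(Z_s Z_t) = (1/Z_s - 1/Z_t) / (z(s) - z(t)), so an antiderivative is the
    real part of (log Z_s - log Z_t) / (z(s) - z(t)). The minus sign appears because [angle] runs
    against the argument. *)
Lemma pairK_antiderivative eta s t x : 0 < eta -> s != t ->
  is_derive x 1 (fun y => (s - t) / ((s - t) ^+ 2 + (f s - f t) ^+ 2) *:
      (ln (Dd eta y s) / 2 - ln (Dd eta y t) / 2) -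
    (f s - f t) / ((s - t) ^+ 2 + (f s - f t) ^+ 2) *:
      (angle (y - s) (f y - f s + eta) - angle (y - t) (f y - f t + eta)))
  (pairK eta s t x).
Proof.
move=> eta0 st.
have Xr r : x - r != 0 \/ 0 < f x - f r + eta.
  have [->|xr] := eqVneq x r; first by right; rewrite subrr add0r.
  by left; rewrite subr_eq0.
have D0 r : 0 < (x - r) ^+ 2 + (f x - f r + eta) ^+ 2.
  by apply: Dd_gt0; right; rewrite gt_eqF.
have dl r := @is_derive_ln_norm _ (fun y => y - r) (fun y => f y - f r + eta) _ _ _ (D0 r) (is_derive_X r x) (is_derive_Y eta r x).
have da r := @is_derive_angle _ (fun y => y - r) (fun y => f y - f r + eta) _ _ _ (Xr r) (is_derive_X r x) (is_derive_Y eta r x).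
apply: (is_derive_eq (is_deriveB
  (is_deriveZ ((s - t) / ((s - t) ^+ 2 + (f s - f t) ^+ 2)) (is_deriveB (dl s) (dl t)))
  (is_deriveZ ((f s - f t) / ((s - t) ^+ 2 + (f s - f t) ^+ 2)) (is_deriveB (da s) (da t))))).
rewrite /GRing.scale /= /pairK /KP /KQ /Dd.
have c0 : 0 < (s - t) ^+ 2 + (f s - f t) ^+ 2.
  by rewrite ltr_pwDl ?sqr_ge0// exprn_even_gt0//= subr_eq0.
have := D0 s; have := D0 t; move: c0.
have -> : s - t = (x - t) - (x - s) by ring.
have -> : f s - f t = (f x - f t + eta) - (f x - f s + eta) by ring.
move: (x - s) (x - t) (f x - f s + eta) (f x - f t + eta) (G x) => a b c d g c0 D1 D2.
by field; rewrite !gt_eqF.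
Qed.

Lemma cvg_normr_shift (A s : R) (sg : bool) :
  `|(-1) ^+ sg * (A + n%:R) - s| @[n --> \oo] --> +oo.
Proof.
apply/cvgryPge => C; near=> n.
have nA : C + `|A| + `|s| <= n%:R by near: n; exact: nbhs_infty_ger.
have := ler_norm s; have := lerNnormlW (lexx `|s|); have := lerNnormlW (lexx `|A|) => h1 h2 h3.
case: sg; rewrite ?expr1 ?expr0 ?mul1r ?mulN1r ler_normr; apply/orP; [right|left]; lra.
Unshelve. all: by end_near. Qed.

Lemma L1_pairK eta s t : 0 < eta -> L1 (pairK eta s t).
Proof.
move=> eta0; have B0 : 0 <= B by exact: le_trans (normr_ge0 (G 0)) (GB 0).
have [c c0 Dc] := Dd_lower eta0 (addr_ge0 (normr_ge0 s) (normr_ge0 t)).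
have Dr r x : `|r| <= `|s| + `|t| -> (Dd eta x r)^-1 <= c^-1 * (1 + x ^+ 2)^-1.
  have Dp : 0 < Dd eta x r by apply: Dd_gt0; right; rewrite gt_eqF.
  have xp : 0 < c * (1 + x ^+ 2) by rewrite mulr_gt0// ltr_pwDl// sqr_ge0.
  by move=> rst; rewrite -invfM lef_pV2//; exact: Dc.
have Ds x := Dr s x (ltac:(by rewrite lerDl)).
have Dt x := Dr t x (ltac:(by rewrite lerDr)).
apply: (L1_le (g := fun x => (1 + B) * c^-1 * (1 + x ^+ 2)^-1)); last exact: L1Z (L1_inv1sqr).
  by rewrite /pairK /KP /KQ /Dd; meas.
move=> x; rewrite -[X in _ <= X]mulrA; have := Ds x; have := Dt x; rewrite -!KPQ_sqr /pairK.
move: (KP eta x s) (KP eta x t) (KQ eta x s) (KQ eta x t) (c^-1 * _) => a b d e k h1 h2.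
have h : `|a * b - d * e + G x * (a * e + d * b)| <= `|a * b - d * e| + `|G x| * `|a * e + d * b|.
  by apply: (le_trans (ler_normD _ _)); rewrite normrM.
apply: (le_trans h).
have h3 : `|a * b - d * e| <= k by rewrite ler_norml; apply/andP; split; have := sqr_ge0 (a - b); have := sqr_ge0 (a + b); have := sqr_ge0 (d - e); have := sqr_ge0 (d + e); nra.
have h4 : `|a * e + d * b| <= k by rewrite ler_norml; apply/andP; split; have := sqr_ge0 (a - e); have := sqr_ge0 (a + e); have := sqr_ge0 (d - b); have := sqr_ge0 (d + b); nra.
have h5 : `|G x| * `|a * e + d * b| <= B * k by rewrite ler_pM.
by rewrite mulrDl mul1r lerD.
Qed.

(** The antiderivative vanishes at both ends: the graph is bounded, so far away the differences
    between s and t in logarithm and angle disappear. *)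
Lemma RI_pairK eta s t : 0 < eta -> s != t -> RI (pairK eta s t) = 0.
Proof.
move=> eta0 st; have ip := L1_pairK s t eta0; have mp := L1_measurable ip.
have eN0 : eta != 0 by rewrite gt_eqF.
(* The abscissae s and t lie strictly between the endpoints -[a n] and [a n], so x - s and x - t
   have a fixed sign at each end. *)
pose a n : R := `|s| + `|t| + 1 + n%:R.
pose Phi y := (s - t) / ((s - t) ^+ 2 + (f s - f t) ^+ 2) *:
      (ln (Dd eta y s) / 2 - ln (Dd eta y t) / 2) -
    (f s - f t) / ((s - t) ^+ 2 + (f s - f t) ^+ 2) *:
      (angle (y - s) (f y - f s + eta) - angle (y - t) (f y - f t + eta)).
have cp x : {for x, continuous (pairK eta s t)}.
  have [Ps Qs] := continuous_KPQ s x eN0; have [Pt Qt] := continuous_KPQ t x eN0.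
  apply: cvgD; first by apply: cvgB; apply: cvgM.
  by apply: cvgM; [exact: cG|apply: cvgD; apply: cvgM].
have a0 n : 0 <= a n by rewrite /a !addr_ge0.
have h n : RI (fun x => \1_(`[- a n, a n]) x * pairK eta s t x) = Phi (a n) - Phi (- a n).
  rewrite RI_restrict /Rintegral; transitivity (fine (Phi (a n) - Phi (- a n))%:E) => //.
  rewrite (@ftc_segment R Phi (pairK eta s t) (- a n) (a n) _ (fun x _ => pairK_antiderivative x eta0 st) (fun x _ => cp x))//.
  by have := a0 n; lra.
have [_ cv] : L1 (pairK eta s t) /\ RI (fun x => \1_(`[- a n, a n]) x * pairK eta s t x) @[n --> \oo] --> RI (pairK eta s t).
  apply: (RI_dct (g := fun x => `|pairK eta s t x|)) => //; last exact: L1abs.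
  - by move=> n; apply: measurable_funM.
  - apply: aeW => x; apply: cvg_near_cst; near=> n.
    have xn : `|x| <= n%:R by near: n; exact: nbhs_infty_ger.
    rewrite indic_itvE in_itv/= (_ : _ && _) ?mul1r//.
    rewrite -ler_norml /a (le_trans xn)// lerDr !addr_ge0//.
  - move=> n x; rewrite normrM ler_piMl// indic_itvE; by case: (_ \in _); rewrite ?normr1 ?normr0.
have Xs r (sg : bool) : (r = s \/ r = t) -> forall n, 0 < (-1) ^+ sg * ((-1) ^+ sg * a n - r).
  move=> rst n; have : `|r| < a n.
    rewrite /a; have : 0 <= n%:R :> R by []. have := normr_ge0 s; have := normr_ge0 t.
    by case: rst => ->; lra.
  by rewrite ltr_norml => /andP[? ?]; case: sg; rewrite ?expr1 ?expr0 ?mul1r ?mulN1r; lra.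
have Xs0 r (sg : bool) : (r = s \/ r = t) -> forall n, (-1) ^+ sg * a n - r != 0.
  by move=> rst n; apply: contraTneq (Xs _ sg rst n) => ->; rewrite mulr0 ltxx.
have Yb r y : `|f y - f r + eta| <= 2 * F0 + eta.
  rewrite (le_trans (ler_normD _ _))// (gtr0_norm eta0) lerD2r (le_trans (ler_normB _ _))//.
  by have := fB y; have := fB r; lra.
(* The sign bit [sg] treats the right and the left end together. *)
have lim (sg : bool) : Phi ((-1) ^+ sg * a n) @[n --> \oo] --> 0.
  rewrite -[X in _ --> X]addr0 -[X in _ --> _ + X]oppr0; apply: cvgB.
    rewrite -[X in _ --> X](mulr0 ((s - t) / ((s - t) ^+ 2 + (f s - f t) ^+ 2))).
    apply: cvgM; first exact: cvg_cst.
    have hl : (ln (Dd eta ((-1) ^+ sg * a n) s) - ln (Dd eta ((-1) ^+ sg * a n) t)) * 2^-1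
        @[n --> \oo] --> (0 * 2^-1 : R).
      apply: cvgM; last exact: cvg_cst.
      apply: (cvg_ln_norm (c := t - s) (M := 2 * F0 + eta)) => [n|n|n| | |n|n].
      + ring.
      + by apply: Xs0; left.
      + by apply: Xs0; right.
      + exact: cvg_normr_shift.
      + exact: cvg_normr_shift.
      + exact: Yb.
      + exact: Yb.
    by move: hl; rewrite mul0r; under eq_fun do rewrite mulrBl.
  rewrite -[X in _ --> X](mulr0 ((f s - f t) / ((s - t) ^+ 2 + (f s - f t) ^+ 2))).
  apply: cvgM; first exact: cvg_cst.
  rewrite -[X in _ --> X](subrr (2 * atan ((-1) ^+ sg))); apply: cvgB.
    by apply: (cvg_angle (M := 2 * F0 + eta)) => [||n]; [apply: Xs; left|exact: cvg_normr_shift|exact: Yb].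
  by apply: (cvg_angle (M := 2 * F0 + eta)) => [||n]; [apply: Xs; right|exact: cvg_normr_shift|exact: Yb].
have cv0 : Phi (a n) - Phi (- a n) @[n --> \oo] --> 0.
  rewrite -[X in _ --> X](subrr 0); apply: cvgB.
    by have := lim false; under eq_fun do rewrite expr0 mul1r.
  by have := lim true; under eq_fun do rewrite expr1 mulN1r.
apply: (cvg_unique _ cv) => //.
by move: cv0; apply: cvg_trans; apply: near_eq_cvg; apply: nearW => n; rewrite h.
Unshelve. all: by end_near. Qed.

Lemma sqr_le_norm (a b : R) : 0 <= b -> a ^+ 2 <= b ^+ 2 -> `|a| <= b.
Proof. by move=> b0 ab; rewrite -(@ler_pXn2r _ 2)// ?nnegrE// real_normK ?num_real. Qed.

Lemma measurable_Dd eta : measurable_fun setT (fun z : R * R => Dd eta z.1 z.2).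
Proof. by rewrite /Dd; meas. Qed.

Lemma measurable_KP eta : measurable_fun setT (fun z : R * R => KP eta z.1 z.2).
Proof. by have := measurable_Dd eta => ?; rewrite /KP; meas. Qed.

Lemma measurable_KQ eta : measurable_fun setT (fun z : R * R => KQ eta z.1 z.2).
Proof. by have := measurable_Dd eta => ?; rewrite /KQ; meas. Qed.

Definition Pp eta (u : R -> R) x := RI (fun s => KP eta x s * u s).
Definition Qq eta (u : R -> R) x := RI (fun s => KQ eta x s * u s).

Lemma RI_0 : RI (fun _ : R => 0) = 0.
Proof. by rewrite /RI /Rintegral integral0. Qed.

Lemma measurable_section (F : R * R -> R) x : measurable_fun setT F -> measurable_fun setT (fun s => F (x, s)).
Proof. by move=> mF; exact: measurableT_comp. Qed.

Lemma measurable_section2 (F : R * R -> R) x : measurable_fun setT F -> measurable_fun setT (fun s => F (s, x)).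
Proof. by move=> mF; exact: measurableT_comp. Qed.

Lemma measurable_swapped (F : R * R -> R) : measurable_fun setT F -> measurable_fun setT (fun z => F (z.2, z.1)).
Proof. by move=> mF; apply: (measurableT_comp mF); exact: measurable_swap. Qed.

Lemma measurable_Pp eta u : measurable_fun setT u -> measurable_fun setT (Pp eta u).
Proof.
move=> mu_; apply: (measurable_section_RI (F := fun z => KP eta z.1 z.2 * u z.2)).
by have := measurable_KP eta => ?; meas.
Qed.

Lemma measurable_Qq eta u : measurable_fun setT u -> measurable_fun setT (Qq eta u).
Proof.
move=> mu_; apply: (measurable_section_RI (F := fun z => KQ eta z.1 z.2 * u z.2)).
by have := measurable_KQ eta => ?; meas.
Qed.

(* The graph shifted upwards by eta; the double integral over (s, t) vanishes
   term by term, for each s <> t, by RI_pairK. *)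
Lemma rellich_shifted eta u M : 0 < eta -> 0 <= M -> L1 u -> (forall s, M < `|s| -> u s = 0) ->
  RI (fun x => Pp eta u x ^+ 2 - Qq eta u x ^+ 2 + 2 * G x * (Pp eta u x * Qq eta u x)) = 0.
Proof.
move=> eta0 M0 iu u0; have mu_ := L1_measurable iu; have iau := L1abs iu.
have B0 : 0 <= B by exact: le_trans (normr_ge0 (G 0)) (GB 0).
have mP := measurable_KP eta; have mQ := measurable_KQ eta.
have mPp := measurable_Pp eta mu_; have mQq := measurable_Qq eta mu_.
have [c c0 Dc] := Dd_lower eta0 M0.
(* Square root of the bound on 1/[Dd]: for s in the support of u each kernel is at most [w x], and
   products of two kernels are dominated by the integrable square of [w]. *)
pose w x := Num.sqrt (c^-1 * (1 + x ^+ 2)^-1).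
have w0 x : 0 <= w x by exact: sqrtr_ge0.
have w2 x : w x * w x = c^-1 * (1 + x ^+ 2)^-1.
  rewrite -expr2 sqr_sqrtr//; apply: mulr_ge0; rewrite invr_ge0 ?addr_ge0 ?sqr_ge0//; exact: ltW.
have Kw x s k : k ^+ 2 <= (Dd eta x s)^-1 -> `|k * u s| <= w x * `|u s|.
  move=> kD; have [sM|/u0 ->] := leP `|s| M; last by rewrite mulr0 normr0 mulr0.
  rewrite normrM ler_wpM2r//; apply: sqr_le_norm => //; apply: (le_trans kD).
  rewrite expr2 w2 -invfM lef_pV2 ?Dc//.
    by rewrite posrE; apply: Dd_gt0; right; rewrite gt_eqF.
  by rewrite posrE mulr_gt0// ltr_pwDl// sqr_ge0.
have Pw x s : `|KP eta x s * u s| <= w x * `|u s| by apply: Kw; exact: KP_sqr_le.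
have Qw x s : `|KQ eta x s * u s| <= w x * `|u s| by apply: Kw; exact: KQ_sqr_le.
have iP x : L1 (fun s => KP eta x s * u s).
  apply: (L1_le _ (Pw x)); last exact: L1Z.
  by have := measurable_section x mP => /= ?; meas.
have iQ x : L1 (fun s => KQ eta x s * u s).
  apply: (L1_le _ (Qw x)); last exact: L1Z.
  by have := measurable_section x mQ => /= ?; meas.
pose K := RI (fun s => `|u s|).
have K0 : 0 <= K by exact: RI_ge0.
have PK x : `|Pp eta u x| <= w x * K.
  rewrite /K -RI_Z//; apply: RI_abs_le (Pw x) (L1Z _ iau); exact: L1_measurable.
have QK x : `|Qq eta u x| <= w x * K.
  rewrite /K -RI_Z//; apply: RI_abs_le (Qw x) (L1Z _ iau); exact: L1_measurable.
have iw a : L1 (fun x => a * (w x * w x)).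
  by under eq_fun do rewrite w2; apply: L1Z; apply: L1Z; exact: L1_inv1sqr.
(* The integrand equals [al] P + [be] Q. Expanding only this last copy of P and Q lets Fubini be
   applied to s first and to t afterwards. *)
pose al x := Pp eta u x + G x * Qq eta u x.
pose be x := G x * Pp eta u x - Qq eta u x.
have alb x : `|al x| <= (1 + B) * K * w x.
  rewrite (le_trans (ler_normD _ _))// normrM mulrDl mul1r mulrDl lerD//; first by rewrite mulrC.
  by rewrite -mulrA ler_pM// mulrC.
have beb x : `|be x| <= (1 + B) * K * w x.
  rewrite (le_trans (ler_normB _ _))// normrM mulrDl mul1r mulrDl addrC lerD//; first by rewrite mulrC.
  by rewrite -mulrA ler_pM// mulrC.
have mal : measurable_fun setT al by rewrite /al; meas.
have mbe : measurable_fun setT be by rewrite /be; meas.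
pose F (z : R * R) := al z.1 * (KP eta z.1 z.2 * u z.2) + be z.1 * (KQ eta z.1 z.2 * u z.2).
have -> : (fun x => Pp eta u x ^+ 2 - Qq eta u x ^+ 2 + 2 * G x * (Pp eta u x * Qq eta u x)) =
    (fun x => RI (fun s => F (x, s))).
  apply/funext => x; rewrite /F /= RI_D ?RI_Z//; [|exact: L1Z|exact: L1Z].
  by rewrite -/(Pp eta u x) -/(Qq eta u x) /al /be; ring.
rewrite (fubini_dominated (a := fun x => 2 * (1 + B) * K * (w x * w x)) (b := fun s => `|u s|))//.
- rewrite -[RHS]RI_0; congr RI; apply/funext => s.
  pose a x := u s * (KP eta x s + G x * KQ eta x s).
  pose b x := u s * (G x * KP eta x s - KQ eta x s).
  pose Fs (z : R * R) := a z.1 * (KP eta z.1 z.2 * u z.2) + b z.1 * (KQ eta z.1 z.2 * u z.2).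
  have -> : (fun x => F (x, s)) = (fun x => RI (fun t => Fs (x, t))).
    apply/funext => x; rewrite /Fs /= RI_D ?RI_Z//; [|exact: L1Z|exact: L1Z].
    by rewrite -/(Pp eta u x) -/(Qq eta u x) /F /al /be /a /b /=; ring.
  have mPs := measurable_section2 s mP; have mQs := measurable_section2 s mQ.
  have ma : measurable_fun setT a by rewrite /a; meas.
  have mb : measurable_fun setT b by rewrite /b; meas.
  have mFs : measurable_fun setT Fs by rewrite /Fs; meas.
  have ab x : `|a x| <= (1 + B) * `|u s| * w x.
    rewrite /a mulrDr (le_trans (ler_normD _ _))// mulrDl mul1r mulrDl lerD//.
      by rewrite mulrC [X in _ <= X]mulrC; exact: Pw.
    rewrite mulrCA normrM -mulrA ler_pM//; first by rewrite mulrC [X in _ <= X]mulrC; exact: Qw.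
  have bb x : `|b x| <= (1 + B) * `|u s| * w x.
    rewrite /b mulrBr (le_trans (ler_normB _ _))// mulrDl mul1r mulrDl addrC lerD//.
      by rewrite mulrC [X in _ <= X]mulrC; exact: Qw.
    rewrite mulrCA normrM -mulrA ler_pM//; first by rewrite mulrC [X in _ <= X]mulrC; exact: Pw.
  rewrite (fubini_dominated (a := fun x => 2 * (1 + B) * `|u s| * (w x * w x)) (b := fun t => `|u t|))//.
    rewrite -[RHS]RI_0; apply: eq_ae_RI => //.
      by apply: (measurable_section_RI (F := fun z => Fs (z.2, z.1))); exact: measurable_swapped.
    (* The diagonal t = s, not covered by [RI_pairK], is a null set. *)
    exists [set s]; split => //; first exact: lebesgue_measure_set1.
    move=> t /= ts; apply: contrapT => /eqP st; apply: ts.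
    have -> : (fun x => Fs (x, t)) = (fun x => u s * u t * pairK eta s t x).
      by apply/funext => x; rewrite /Fs /a /b /pairK /=; ring.
    by rewrite RI_Z ?RI_pairK ?mulr0// ?L1_pairK// eq_sym.
  move=> x t; rewrite /Fs /=; apply: (le_trans (ler_normD _ _)); rewrite (normrM (a x)) (normrM (b x)).
  have h1 := ler_pM (normr_ge0 _) (normr_ge0 _) (ab x) (Pw x t).
  have h2 := ler_pM (normr_ge0 _) (normr_ge0 _) (bb x) (Qw x t).
  by apply: (le_trans (lerD h1 h2)); rewrite le_eqVlt; apply/orP; left; apply/eqP; ring.
- by rewrite /F; meas.
- move=> x t; rewrite /F /=; apply: (le_trans (ler_normD _ _)); rewrite (normrM (al x)) (normrM (be x)).
  have h1 := ler_pM (normr_ge0 _) (normr_ge0 _) (alb x) (Pw x t).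
  have h2 := ler_pM (normr_ge0 _) (normr_ge0 _) (beb x) (Qw x t).
  by apply: (le_trans (lerD h1 h2)); rewrite le_eqVlt; apply/orP; left; apply/eqP; ring.
Qed.

End RellichIdentity.

(** * Jump relations *)

Section PlemeljLimit.
Context {R : realType}.
Local Notation mu := (@lebesgue_measure R).
Implicit Types x y s t eta M : R.

Lemma L1_unit_cut : L1 (@unit_cut R).
Proof.
have := L1_near (ltr01 : 0 < 1 :> R); congr L1; apply/funext => t.
by rewrite subrr powRr0 mulr1.
Qed.

(* Desingularisation of a Cauchy-type kernel K at s = x: far from x the kernel
   is bounded, near x one subtracts u x and the kernel Kl of the tangent line. *)
Definition desing (K Kl u : R -> R) x s :=
  (1 - unit_cut (x - s)) * (K s * u s) + unit_cut (x - s) * (K s * (u s - u x))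
  + u x * (unit_cut (x - s) * (K s - Kl s)).

Lemma desingE (K Kl u : R -> R) x s :
  K s * u s = desing K Kl u x s + u x * (unit_cut (x - s) * Kl s).
Proof. rewrite /desing; ring. Qed.

Section Desingularisation.
Variables (x L U Hc al : R) (u : R -> R).
Hypotheses (iu : L1 u) (uL : forall s, `|u s - u x| <= L * `|x - s|)
  (uU : `|u x| <= U) (al0 : 0 < al).

Definition desing_bound s := `|u s| + L * unit_cut (x - s)
  + U * Hc * (unit_cut (x - s) * `|x - s| `^ (al - 1)).

Lemma L1_desing_bound : L1 desing_bound.
Proof.
apply: L1D; first apply: L1D; first exact: L1abs.
  by apply: L1Z; exact: (L1_reflect x L1_unit_cut).
by apply: L1Z; exact: (L1_reflect x (L1_near al0)).
Qed.

(** By translation invariance the value does not involve x, which turns the pointwise majorant into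
    a bound on the Cauchy integrals that is uniform in x. *)
Lemma RI_desing_bound : RI desing_bound = RI (fun s => `|u s|) + L * RI (@unit_cut R)
  + U * Hc * RI (fun t => unit_cut t * `|t| `^ (al - 1)).
Proof.
have i1 := L1abs iu; have i2 := L1_reflect x L1_unit_cut; have i3 := L1_reflect x (L1_near al0).
rewrite /desing_bound RI_D; [|by apply: L1D => //; exact: L1Z|exact: L1Z].
rewrite (RI_D i1 (L1Z L i2)) (RI_Z L i2) (RI_Z (U * Hc) i3).
rewrite (RI_reflect x (h := @unit_cut R)); last exact: measurable_unit_cut.
rewrite (RI_reflect x (h := fun t => unit_cut t * `|t| `^ (al - 1)))//.
exact: L1_measurable (L1_near al0).
Qed.

Lemma measurable_cut_shift : measurable_fun setT (fun s => unit_cut (x - s)).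
Proof. by have := @measurable_unit_cut R => ?; meas. Qed.

Lemma measurable_desing (K Kl : R -> R) : measurable_fun setT K -> measurable_fun setT Kl ->
  measurable_fun setT (desing K Kl u x).
Proof.
move=> mK mKl; have mc := measurable_cut_shift; have mu_ := L1_measurable iu.
by rewrite /desing; meas.
Qed.

Lemma desing_le (K Kl : R -> R) s : `|K s| * `|x - s| <= 1 ->
  `|K s - Kl s| <= Hc * `|x - s| `^ (al - 1) -> `|desing K Kl u x s| <= desing_bound s.
Proof.
move=> K1 KH; have U0 : 0 <= U by exact: le_trans uU.
rewrite /desing /desing_bound; apply: (le_trans (ler_normD _ _)).
have c01 := unit_cut_ge0 (x - s); have c1 := unit_cut_le1 (x - s).
apply: lerD; last first.
  rewrite !normrM (ger0_norm c01) -mulrA ler_pM// ?mulr_ge0//.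
  by rewrite mulrCA ler_wpM2l.
apply: (le_trans (ler_normD _ _)); apply: lerD.
  rewrite normrM normrM mulrA ler_piMl// ger0_norm ?subr_ge0// /unit_cut.
  case: ltP => h; first by rewrite subrr mul0r.
  by rewrite subr0 mul1r; apply: le_trans K1; rewrite ler_peMr.
rewrite normrM (ger0_norm c01) mulrC ler_wpM2r// normrM.
have L0 : 0 <= L * `|x - s| by exact: le_trans (uL s).
have [e|ne] := eqVneq (x - s) 0.
  have : u s - u x = 0 by apply/eqP; rewrite -normr_le0 (le_trans (uL s))// e normr0 mulr0.
  move=> ->; rewrite normr0 mulr0.
  (* A negative L would contradict the Lipschitz bound at the point x - 1. *)
  have [//|L0'] := leP 0 L; exfalso.
  have := le_trans (normr_ge0 _) (uL (x - 1)); rewrite opprB addrCA subrr addr0 normr1 mulr1; lra.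
have Lp : 0 <= L by move: L0; rewrite pmulr_lge0// normr_gt0.
apply: (le_trans (ler_wpM2l (normr_ge0 _) (uL s))).
by rewrite mulrCA ler_piMr.
Qed.

(** The desingularised part converges by dominated convergence. What remains is u x times the
    explicit integral [J n] of the tangent kernel, and its limit [Jl] carries the jump. The last
    clause is uniform in n and later feeds the dominated convergence in x. *)
Lemma plemelj_limit (K Kl : nat -> R -> R) (K0 Kl0 : R -> R) (J : nat -> R) (Jl : R) :
  (forall n, measurable_fun setT (K n)) -> (forall n, measurable_fun setT (Kl n)) ->
  measurable_fun setT K0 -> measurable_fun setT Kl0 ->
  (forall n s, `|K n s| * `|x - s| <= 1) ->
  (forall n s, `|K n s - Kl n s| <= Hc * `|x - s| `^ (al - 1)) ->
  (forall s, s != x -> K n s @[n --> \oo] --> K0 s) ->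
  (forall s, s != x -> Kl n s @[n --> \oo] --> Kl0 s) ->
  (forall n, L1 (fun s => unit_cut (x - s) * Kl n s)) ->
  (forall n, RI (fun s => unit_cut (x - s) * Kl n s) = J n) ->
  J n @[n --> \oo] --> Jl ->
  [/\ L1 (desing K0 Kl0 u x), RI (fun s => K n s * u s) @[n --> \oo] --> RI (desing K0 Kl0 u x) + u x * Jl
  & forall n, `|RI (fun s => K n s * u s)| <= RI desing_bound + U * `|J n| ].
Proof.
move=> mK mKl mK0 mKl0 K1 KH cK cKl iKl JE Jcv; have U0 : 0 <= U by exact: le_trans uU.
have le n s : `|desing (K n) (Kl n) u x s| <= desing_bound s by exact: desing_le.
have ib := L1_desing_bound.
have [id cv] : L1 (desing K0 Kl0 u x) /\
    RI (desing (K n) (Kl n) u x) @[n --> \oo] --> RI (desing K0 Kl0 u x).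
  apply: (RI_dct _ _ _ le ib); [by move=> n; exact: measurable_desing|exact: measurable_desing|].
  exists [set x]; split => //; first exact: lebesgue_measure_set1.
  move=> s /= ns; apply: contrapT => /eqP sx; apply: ns; rewrite /desing.
  apply: cvgD; first apply: cvgD.
  - by apply: cvgM; [exact: cvg_cst|apply: cvgM; [exact: cK|exact: cvg_cst]].
  - by apply: cvgM; [exact: cvg_cst|apply: cvgM; [exact: cK|exact: cvg_cst]].
  - apply: cvgM; first exact: cvg_cst.
    by apply: cvgM; [exact: cvg_cst|apply: cvgB; [exact: cK|exact: cKl]].
have E n : RI (fun s => K n s * u s) = RI (desing (K n) (Kl n) u x) + u x * J n.
  have -> : (fun s => K n s * u s) = (fun s => desing (K n) (Kl n) u x s + u x * (unit_cut (x - s) * Kl n s)).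
    by apply/funext => s; exact: desingE.
  rewrite RI_D ?RI_Z ?JE//; last exact: L1Z.
  by apply: L1_le (le n) ib; exact: measurable_desing.
split => //.
  under eq_fun do rewrite E.
  by apply: cvgD => //; apply: cvgM => //; exact: cvg_cst.
move=> n; rewrite E (le_trans (ler_normD _ _))// lerD//.
  by apply: RI_abs_le (le n) ib; exact: measurable_desing.
by rewrite normrM ler_wpM2r.
Qed.

End Desingularisation.

(** * Explicit integrals of the Cauchy kernel of a straight line *)

Section TangentKernel.
Variable g : R.
Let om := (1 + g ^+ 2)^-1.
Let g2 : 0 < 1 + g ^+ 2. Proof. by rewrite ltr_pwDl// sqr_ge0. Qed.

(** Squared modulus of t + i (g t + eta): the graph is replaced by its tangent line of slope g. *)
Definition Dl eta t := t ^+ 2 + (g * t + eta) ^+ 2.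

Lemma Dl_gt0 eta t : 0 < eta -> 0 < Dl eta t.
Proof.
move=> eta0; rewrite /Dl lt0r addr_ge0 ?sqr_ge0// andbT paddr_eq0 ?sqr_ge0// !sqrf_eq0.
by have [->|//] := eqVneq t 0; rewrite mulr0 add0r gt_eqF.
Qed.

Lemma is_derive_lin (a b t : R) : is_derive t 1 (fun y : R => a * y + b) a.
Proof.
apply: (is_derive_eq (is_deriveD (is_deriveZ a (is_derive_id t 1)) (is_derive_cst b t 1))).
by rewrite addr0 /GRing.scale /= mulr1.
Qed.

Lemma tangent_log eta t : 0 < eta ->
  is_derive t 1 (fun y => ln (Dl eta y) / 2) ((t + g * (g * t + eta)) / Dl eta t).
Proof.
move=> eta0; apply: (is_derive_eq (@is_derive_ln_norm _ id (fun y => g * y + eta) _ _ t (Dl_gt0 t eta0) (is_derive_id t 1) (is_derive_lin g eta t))).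
by rewrite mulr1 [(g * t + eta) * g]mulrC.
Qed.

(** Completing the square: (1 + g^2) [Dl] = ((1 + g^2) t + g eta)^2 + eta^2. *)
Lemma tangent_atan eta t : 0 < eta ->
  is_derive t 1 (fun y => atan ((1 + g ^+ 2) / eta * y + g)) (eta / Dl eta t).
Proof.
move=> eta0.
apply: (is_derive_eq (@is_derive1_comp _ atan (fun y => (1 + g ^+ 2) / eta * y + g) t _ _ (is_derive1_atan _) (is_derive_lin ((1 + g ^+ 2) / eta) g t))).
have D0 := Dl_gt0 t eta0; move: D0; rewrite /Dl => D0.
have -> : 1 + ((1 + g ^+ 2) / eta * t + g) ^+ 2 =
  (1 + g ^+ 2) * (t ^+ 2 + (g * t + eta) ^+ 2) / eta ^+ 2 by field; rewrite gt_eqF.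
by field; rewrite !gt_eqF.
Qed.

(** [logJ] and [atanJ] are the increments over [-1, 1] of the antiderivatives in [tangent_log] and
    [tangent_atan]. As eta tends to 0 the first vanishes by symmetry of the window and the second
    tends to pi, which is the source of the jump. *)
Definition logJ eta := ln (Dl eta 1) / 2 - ln (Dl eta (-1)) / 2.
Definition atanJ eta := atan ((1 + g ^+ 2) / eta + g) + atan ((1 + g ^+ 2) / eta - g).

(** The open window of [unit_cut] and the closed segment differ by the two endpoints, a null set. *)
Lemma RI_cut_ftc (F h : R -> R) : (forall t : R, is_derive t 1 F (h t)) -> continuous h ->
  L1 (fun t => unit_cut t * h t) /\ RI (fun t => unit_cut t * h t) = F 1 - F (-1).
Proof.
move=> dF ch.
have mh : measurable_fun setT h by exact: continuous_measurable_fun.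
have ae : {ae mu, forall t, \1_(`[-1, 1]) t * h t = unit_cut t * h t}.
  exists [set -1; 1]; split.
  - by apply: measurableU.
  - by apply: countable_lebesgue_measure0; apply: finite_set_countable; exact: finite_set2.
  - move=> t /= nt; apply: contrapT => /not_orP[t1 t2]; apply: nt.
    rewrite indic_itvE in_itv/= /unit_cut ltr_norml !lt_neqAle.
    by rewrite (eq_sym (-1)); case: eqP => //= _; case: eqP => //= _; rewrite ?andbT.
have i1 : L1 (fun t => \1_(`[-1, 1]) t * h t).
  by apply: L1_restrict => //; apply: L1_segment_continuous => t _; exact: ch.
have mc : measurable_fun setT (fun t => unit_cut t * h t).
  by have := @measurable_unit_cut R => ?; meas.
split; first exact: eq_ae_L1 ae i1.
rewrite -(eq_ae_RI (L1_measurable i1) mc ae) RI_restrict /Rintegral.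
rewrite (@ftc_segment R F h (-1) 1 _ (fun t _ => dF t) (fun t _ => ch t))//.
Qed.

Lemma continuous_tangent eta (a b : R) : 0 < eta -> continuous (fun t => (a * t + b) / Dl eta t).
Proof.
move=> eta0 t; apply: derivable_continuous1.
have dD := is_derive_norm_sqr (is_derive_id t 1) (is_derive_lin g eta t).
have D0 : Dl eta t != 0 by rewrite gt_eqF// Dl_gt0.
by have [] := @is_derive_div _ (fun t => a * t + b) (fun t => Dl eta t) _ _ t D0 (is_derive_lin a b t) dD.
Qed.

(** (1 + g^2) t = (t + g (g t + eta)) - g eta, which splits the numerator into the two derivatives
    computed above. *)
Lemma RI_tangentP eta : 0 < eta -> L1 (fun t => unit_cut t * (t / Dl eta t)) /\
  RI (fun t => unit_cut t * (t / Dl eta t)) = om * logJ eta - om * g * atanJ eta.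
Proof.
move=> eta0.
have dF t : is_derive t 1 (fun y => om *: (ln (Dl eta y) / 2) - (om * g) *: atan ((1 + g ^+ 2) / eta * y + g)) (t / Dl eta t).
  apply: (is_derive_eq (is_deriveB (is_deriveZ om (tangent_log t eta0)) (is_deriveZ (om * g) (tangent_atan t eta0)))).
  have D0 := Dl_gt0 t eta0; rewrite /GRing.scale /= /om; field; by rewrite !gt_eqF.
have ct : continuous (fun t => t / Dl eta t).
  by have := @continuous_tangent eta 1 0 eta0; under eq_fun do rewrite mul1r addr0.
have [h1 h2] := RI_cut_ftc dF ct; split => //.
rewrite h2 /GRing.scale /= /logJ /atanJ mulr1 mulrN1.
rewrite (_ : - ((1 + g ^+ 2) / eta) + g = - ((1 + g ^+ 2) / eta - g)) ?atanN; ring.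
Qed.

Lemma RI_tangentQ eta : 0 < eta -> L1 (fun t => unit_cut t * ((g * t + eta) / Dl eta t)) /\
  RI (fun t => unit_cut t * ((g * t + eta) / Dl eta t)) = om * g * logJ eta + om * atanJ eta.
Proof.
move=> eta0.
have dF t : is_derive t 1 (fun y => (om * g) *: (ln (Dl eta y) / 2) + om *: atan ((1 + g ^+ 2) / eta * y + g)) ((g * t + eta) / Dl eta t).
  apply: (is_derive_eq (is_deriveD (is_deriveZ (om * g) (tangent_log t eta0)) (is_deriveZ om (tangent_atan t eta0)))).
  have D0 := Dl_gt0 t eta0; rewrite /GRing.scale /= /om; field; by rewrite !gt_eqF.
have [h1 h2] := RI_cut_ftc dF (@continuous_tangent eta g eta eta0); split => //.
rewrite h2 /GRing.scale /= /logJ /atanJ mulr1 mulrN1.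
rewrite (_ : - ((1 + g ^+ 2) / eta) + g = - ((1 + g ^+ 2) / eta - g)) ?atanN; ring.
Qed.

Lemma atanJ_bound eta : `|atanJ eta| <= pi.
Proof.
have b (y : R) : `|atan y| <= pi / 2.
  by rewrite ler_norml; have := atan_gtNpi2 y; have := atan_ltpi2 y => ? ?; apply/andP; split; lra.
rewrite /atanJ (le_trans (ler_normD _ _))//.
by have := b ((1 + g ^+ 2) / eta + g); have := b ((1 + g ^+ 2) / eta - g); lra.
Qed.

Lemma logJ_bound eta B : `|g| <= B -> 0 < eta <= 1 -> `|logJ eta| <= (B + 1) ^+ 2.
Proof.
move=> gB /andP[eta0 eta1]; have B0 : 0 <= B by exact: le_trans gB.
have b (t : R) : `|t| = 1 -> 0 <= ln (Dl eta t) <= (B + 1) ^+ 2.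
  move=> t1; have t2 : t ^+ 2 = 1 by rewrite -real_normK ?num_real// t1 expr1n.
  rewrite /Dl t2; apply/andP; split; first by rewrite ln_ge0// lerDl sqr_ge0.
  apply: (le_trans (le_ln1Dx _)); first by rewrite (lt_le_trans _ (sqr_ge0 _)).
  rewrite -(real_normK (num_real (g * t + eta))) lerXn2r// ?nnegrE ?addr_ge0//.
  by rewrite (le_trans (ler_normD _ _))// normrM t1 mulr1 (gtr0_norm eta0) lerD.
have := b 1 (normr1 _); have := b (-1); rewrite normrN normr1 => /(_ erefl) /andP[? ?] /andP[? ?].
by rewrite /logJ ler_norml; apply/andP; split; lra.
Qed.

Lemma cvg_logJ (e : nat -> R) : e n @[n --> \oo] --> 0 -> logJ (e n) @[n --> \oo] --> 0.
Proof.
move=> e0; have h (t : R) : `|t| = 1 -> ln (Dl (e n) t) / 2 @[n --> \oo] --> ln (1 + g ^+ 2) / 2.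
  move=> t1; have t2 : t ^+ 2 = 1 by rewrite -real_normK ?num_real// t1 expr1n.
  apply: cvgM; last exact: cvg_cst.
  apply: (@cvg_comp _ _ _ _ (@ln R)); last by apply: continuous_ln.
  rewrite /Dl t2; apply: cvgD; first exact: cvg_cst.
  have hg : g * t + e n @[n --> \oo] --> g * t.
    by rewrite -[X in _ --> X]addr0; apply: cvgD => //; exact: cvg_cst.
  by rewrite -[g ^+ 2]mulr1 -t2 -exprMn; exact: cvg_sqr.
rewrite -[X in _ --> X](subrr (ln (1 + g ^+ 2) / 2)) /logJ; apply: cvgB; apply: h; rewrite ?normrN normr1//.
Qed.

Lemma cvg_atanJ (e : nat -> R) : (forall n, 0 < e n) -> e n @[n --> \oo] --> 0 -> atanJ (e n) @[n --> \oo] --> pi.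
Proof.
move=> ep e0.
have ey : (e n)^-1 @[n --> \oo] --> +oo.
  apply/(gtr0_cvgV0 (f := fun n => (e n)^-1)); first by apply: nearW => n; rewrite invr_gt0.
  move: e0; apply: cvg_trans; apply: near_eq_cvg; apply: nearW => n.
  by rewrite /unstable.inv_fun invrK.
have h b : atan ((1 + g ^+ 2) / e n + b) @[n --> \oo] --> pi / 2.
  apply: cvg_comp (@cvgy_atan R); apply/cvgryPge => A; near=> n.
  have hA : A - b <= (e n)^-1 by near: n; move/cvgryPge : ey => /(_ (A - b)).
  rewrite -lerBlDr (le_trans hA)// ler_peMl ?invr_ge0 ?(ltW (ep n))// lerDl sqr_ge0 //.
rewrite (_ : pi = pi / 2 + pi / 2); last by field.
by apply: cvgD; exact: h.
Unshelve. all: by end_near. Qed.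

End TangentKernel.
End PlemeljLimit.

(** * The Rellich identity for the boundary values *)

Section RellichBoundary.
Context {R : realType}.
Local Notation mu := (@lebesgue_measure R).
Implicit Types x y s t eta M : R.

(** Mean value theorem at an intermediate point c. The error is written with the factor (x - s)^2
    because [K_tangent] divides its square by two squared moduli, each at least (x - s)^2. *)
Lemma taylor_hoelder (f G : R -> R) (H al : R) : (forall x : R, is_derive x 1 f (G x)) ->
  0 < al -> (forall x y, `|G x - G y| <= H * `|x - y| `^ al) ->
  forall x s, `|f x - f s - G x * (x - s)| <= H * `|x - s| `^ (al - 1) * (x - s) ^+ 2.
Proof.
move=> df al0 GH x s; have [->|xs] := eqVneq x s.
  by rewrite !subrr mulr0 subr0 normr0 expr0n/= mulr0.
have H0 : 0 <= H.
  have := le_trans (normr_ge0 _) (GH 1 0); by rewrite subr0 normr1 powR1 mulr1.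
have [c cb e] : exists2 c, `|x - c| <= `|x - s| & f x - f s = G c * (x - s).
  have cf (a b : R) : {within `[a, b], continuous f}.
    apply: continuous_in_subspaceT => z _.
    by apply: derivable_continuous1; case: (df z).
  have [lt|lt|eq] := ltgtP x s; last by rewrite eq eqxx in xs.
    have [c] := MVT lt (fun z _ => df z) (@cf _ _).
    rewrite in_itv/= => /andP[h1 h2] h3; exists c.
      by rewrite !ltr0_norm ?subr_lt0//; lra.
    by rewrite -opprB h3; ring.
  have [c] := MVT lt (fun z _ => df z) (@cf _ _).
  rewrite in_itv/= => /andP[h1 h2] h3; exists c => //.
  by rewrite !gtr0_norm ?subr_gt0//; lra.
have xs0 : 0 < `|x - s| by rewrite normr_gt0 subr_eq0.
rewrite e -mulrBl normrM -(real_normK (num_real (x - s))) expr2 mulrA ler_wpM2r//.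
rewrite -mulrA -[X in _ * X](_ : `|x - s| `^ al = _).
  rewrite distrC; apply: (le_trans (GH x c)); rewrite ler_wpM2l// ge0_ler_powR// ?nnegrE//.
  exact: ltW.
by rewrite -{3}(powRr1 (ltW xs0)) -powRD ?subrK// (gt_eqF xs0) implybT.
Qed.

Variables (f G : R -> R) (B F0 H al : R).
Hypothesis df : forall x : R, is_derive x 1 f (G x).
Hypothesis cG : continuous G.
Hypothesis GB : forall x, `|G x| <= B.
Hypothesis fB : forall x, `|f x| <= F0.
Hypothesis al0 : 0 < al.
Hypothesis GH : forall x y, `|G x - G y| <= H * `|x - y| `^ al.

Let mf : measurable_fun setT f.
Proof.
apply: continuous_measurable_fun => x; apply: derivable_continuous1.
by case: (df x).
Qed.

Let mG : measurable_fun setT G. Proof. exact: continuous_measurable_fun. Qed.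

Let B0 : 0 <= B. Proof. exact: le_trans (normr_ge0 (G 0)) (GB 0). Qed.

Let H0 : 0 <= H.
Proof. by have := le_trans (normr_ge0 _) (GH 1 0); rewrite subr0 normr1 powR1 mulr1. Qed.

Definition KPl eta x s := (x - s) / Dl (G x) eta (x - s).
Definition KQl eta x s := (G x * (x - s) + eta) / Dl (G x) eta (x - s).

Lemma le1_of_sqr (k eta x s : R) : k ^+ 2 <= (Dd f eta x s)^-1 -> `|k| * `|x - s| <= 1.
Proof.
move=> kD; rewrite -normrM; apply: sqr_le_norm => //.
have [D0|D0] := eqVneq (Dd f eta x s) 0.
  move: kD; rewrite D0 invr0 => h.
  have -> : k = 0 by apply/eqP; rewrite -sqrf_eq0 eq_le h sqr_ge0.
  by rewrite mul0r expr0n expr1n.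
have Dp : 0 < Dd f eta x s by rewrite lt0r D0 Dd_ge0.
rewrite exprMn expr1n; apply: (le_trans (ler_wpM2r (sqr_ge0 _) kD)).
by rewrite mulrC ler_pdivrMr// mul1r /Dd lerDl sqr_ge0.
Qed.

Lemma KP_le1 eta x s : `|KP f eta x s| * `|x - s| <= 1.
Proof. by apply: (le1_of_sqr (eta := eta)); exact: KP_sqr_le. Qed.

Lemma KQ_le1 eta x s : `|KQ f eta x s| * `|x - s| <= 1.
Proof. by apply: (le1_of_sqr (eta := eta)); exact: KQ_sqr_le. Qed.

Lemma Dl_ge eta x s : (x - s) ^+ 2 <= Dl (G x) eta (x - s).
Proof. by rewrite /Dl lerDl sqr_ge0. Qed.

(* With z = X + iY and w the tangent point, |1/z - 1/w| = |z - w| / (|z| |w|). *)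
Lemma K_tangent eta x s : x != s ->
  (KP f eta x s - KPl eta x s) ^+ 2 + (KQ f eta x s - KQl eta x s) ^+ 2
   <= (H * `|x - s| `^ (al - 1)) ^+ 2.
Proof.
move=> xs; have X0 : 0 < (x - s) ^+ 2 by rewrite exprn_even_gt0//= subr_eq0.
have D0 : 0 < Dd f eta x s by apply: Dd_gt0; left.
have Dl0 : 0 < Dl (G x) eta (x - s) by exact: lt_le_trans X0 (Dl_ge _ _ _).
have -> : (KP f eta x s - KPl eta x s) ^+ 2 + (KQ f eta x s - KQl eta x s) ^+ 2 =
   (f x - f s - G x * (x - s)) ^+ 2 / (Dd f eta x s * Dl (G x) eta (x - s)).
  move: D0 Dl0; rewrite /KP /KQ /KPl /KQl /Dd /Dl => D0 Dl0; field.
  by rewrite !gt_eqF.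
rewrite ler_pdivrMr ?mulr_gt0//.
have h := taylor_hoelder df al0 GH x s.
rewrite -(real_normK (num_real (f x - f s - _))).
have h2 : `|f x - f s - G x * (x - s)| ^+ 2 <= (H * `|x - s| `^ (al - 1) * (x - s) ^+ 2) ^+ 2.
  by rewrite lerXn2r// nnegrE mulr_ge0 ?sqr_ge0// mulr_ge0// powR_ge0.
apply: (le_trans h2); rewrite exprMn ler_wpM2l ?sqr_ge0// expr2 ler_pM ?sqr_ge0//.
  by rewrite /Dd lerDl sqr_ge0.
exact: Dl_ge.
Qed.

Lemma KP_tangent eta x s : `|KP f eta x s - KPl eta x s| <= H * `|x - s| `^ (al - 1).
Proof.
have c0 : 0 <= H * `|x - s| `^ (al - 1) by rewrite mulr_ge0// powR_ge0.
have [<-|xs] := eqVneq x s.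
  by rewrite /KP /KPl !subrr !mul0r subrr normr0 mulr_ge0// powR_ge0.
apply: sqr_le_norm => //; apply: le_trans (K_tangent eta xs); by rewrite lerDl sqr_ge0.
Qed.

Lemma KQ_tangent eta x s : `|KQ f eta x s - KQl eta x s| <= H * `|x - s| `^ (al - 1).
Proof.
have c0 : 0 <= H * `|x - s| `^ (al - 1) by rewrite mulr_ge0// powR_ge0.
have [<-|xs] := eqVneq x s.
  by rewrite /KQ /KQl /Dd /Dl !subrr mulr0 subrr normr0 mulr_ge0// powR_ge0.
apply: sqr_le_norm => //; apply: le_trans (K_tangent eta xs); by rewrite lerDr sqr_ge0.
Qed.

Let e (n : nat) : R := n.+1%:R^-1.
Let e_gt0 n : 0 < e n. Proof. by rewrite invr_gt0 ltr0n. Qed.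
Let e_le1 n : e n <= 1. Proof. by rewrite invf_le1 ?ltr0n// ler1n. Qed.
Let e_cvg : e n @[n --> \oo] --> 0. Proof. exact: cvg_harmonic. Qed.

Lemma cvg_quot (a b c : R) : a != 0 -> a / (a ^+ 2 + (b + e n) ^+ 2) @[n --> \oo] --> a / (a ^+ 2 + (b + c * 0) ^+ 2)
   /\ (b + e n) / (a ^+ 2 + (b + e n) ^+ 2) @[n --> \oo] --> (b + c * 0) / (a ^+ 2 + (b + c * 0) ^+ 2).
Proof.
move=> a0; rewrite mulr0.
have h1 : b + e n @[n --> \oo] --> b + 0 by apply: cvgD => //; exact: cvg_cst.
have h2 : (a ^+ 2 + (b + e n) ^+ 2)^-1 @[n --> \oo] --> (a ^+ 2 + (b + 0) ^+ 2)^-1.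
  apply: cvgV; first by rewrite gt_eqF// ltr_pwDl ?sqr_ge0// exprn_even_gt0.
  by apply: cvgD; [exact: cvg_cst|exact: cvg_sqr].
by split; apply: cvgM => //; exact: cvg_cst.
Qed.

Lemma cvg_K x s : s != x ->
  [/\ KP f (e n) x s @[n --> \oo] --> KP f 0 x s, KQ f (e n) x s @[n --> \oo] --> KQ f 0 x s,
   KPl (e n) x s @[n --> \oo] --> KPl 0 x s & KQl (e n) x s @[n --> \oo] --> KQl 0 x s].
Proof.
move=> sx; have xs : x - s != 0 by rewrite subr_eq0 eq_sym.
have [h1 h2] := cvg_quot (f x - f s) 0 xs; have [h3 h4] := cvg_quot (G x * (x - s)) 0 xs.
by move: h1 h2 h3 h4; rewrite mulr0.
Qed.

(** At eta = 0 the tangent kernel is odd on the unit window, so integrating [desing] alone gives the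
    principal value. The traces add the one-sided jump produced by the limit pi of [atanJ]. *)
Definition pv_P u x := RI (desing (KP f 0 x) (KPl 0 x) u x).
Definition pv_Q u x := RI (desing (KQ f 0 x) (KQl 0 x) u x).
Definition trace_P u x := pv_P u x + u x * (- ((1 + G x ^+ 2)^-1 * G x * pi)).
Definition trace_Q u x := pv_Q u x + u x * ((1 + G x ^+ 2)^-1 * pi).

Variables (u : R -> R) (L U M : R).
Hypotheses (mu_ : measurable_fun setT u) (M0 : 0 <= M) (u0 : forall s, M < `|s| -> u s = 0)
  (uL : forall x s, `|u s - u x| <= L * `|x - s|) (uU : forall x, `|u x| <= U).

Lemma L1_compact_bounded : L1 u.
Proof.
apply: (L1_le (g := fun x => U * \1_(`[- M, M]) x)) => //; last by apply: L1Z; exact: L1_indic_segment.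
move=> x; rewrite indic_itvE in_itv/= -ler_norml.
case: (leP `|x| M) => h; first by rewrite mulr1.
by rewrite u0// normr0 mulr0.
Qed.

Lemma measurable_K1 x eta : measurable_fun setT (KP f eta x) /\ measurable_fun setT (KQ f eta x).
Proof. by split; rewrite /KP /KQ /Dd; meas. Qed.

Lemma measurable_Kl1 x eta : measurable_fun setT (KPl eta x) /\ measurable_fun setT (KQl eta x).
Proof. by split; rewrite /KPl /KQl /Dl; meas. Qed.

Lemma trace_limit x :
  [/\ L1 (desing (KP f 0 x) (KPl 0 x) u x), Pp f (e n) u x @[n --> \oo] --> trace_P u x &
   forall n, `|Pp f (e n) u x| <= RI (desing_bound x L U H al u) + U * ((1 + B) * ((B + 1) ^+ 2 + pi))] /\
  [/\ L1 (desing (KQ f 0 x) (KQl 0 x) u x), Qq f (e n) u x @[n --> \oo] --> trace_Q u x &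
   forall n, `|Qq f (e n) u x| <= RI (desing_bound x L U H al u) + U * ((1 + B) * ((B + 1) ^+ 2 + pi))].
Proof.
have iu := L1_compact_bounded; have U0 : 0 <= U by exact: le_trans (uU 0).
pose om := (1 + G x ^+ 2)^-1.
have om0 : 0 <= om by rewrite invr_ge0 addr_ge0// sqr_ge0.
have om1 : om <= 1 by rewrite invf_le1 ?lerDl ?sqr_ge0// ltr_pwDl// sqr_ge0.
have lj := cvg_logJ (G x) e_cvg; have aj := cvg_atanJ (G x) e_gt0 e_cvg.
have lb n := logJ_bound (GB x) (introT andP (conj (e_gt0 n) (e_le1 n))).
have ab n := atanJ_bound (G x) (e n).
have og : `|om * G x| <= B by rewrite normrM (ger0_norm om0) (le_trans _ (GB x))// ler_piMl.
have pi0 := @pi_ge0 R.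
have B1 : 0 <= (B + 1) ^+ 2 by exact: sqr_ge0.
have key (a b X Y : R) : `|a| <= 1 -> `|b| <= B -> `|X| <= (B + 1) ^+ 2 -> `|Y| <= pi ->
    `|a * X| + `|b * Y| <= (1 + B) * ((B + 1) ^+ 2 + pi) /\ `|b * X| + `|a * Y| <= (1 + B) * ((B + 1) ^+ 2 + pi).
  move: (@pi R) pi0 => p pi0 ha hb hX hY; rewrite !normrM.
  have := ler_pM (normr_ge0 _) (normr_ge0 _) ha hX; have := ler_pM (normr_ge0 _) (normr_ge0 _) hb hY.
  have := ler_pM (normr_ge0 _) (normr_ge0 _) ha hY; have := ler_pM (normr_ge0 _) (normr_ge0 _) hb hX.
  have := mulr_ge0 B0 B1; have := mulr_ge0 B0 pi0; rewrite !mul1r mulrDl (mulrDr B) !mul1r.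
  move: ((B + 1) ^+ 2) B1 hX => b2 B1 hX; by split; lra.
have nom : `|om| <= 1 by rewrite ger0_norm.
have cvP : om * logJ (G x) (e n) - om * G x * atanJ (G x) (e n) @[n --> \oo] --> - (om * G x * pi).
  by rewrite -[X in _ --> X]sub0r -{1}(mulr0 om); apply: cvgB; apply: cvgM => //; exact: cvg_cst.
have cvQ : om * G x * logJ (G x) (e n) + om * atanJ (G x) (e n) @[n --> \oo] --> om * pi.
  by rewrite -[X in _ --> X]add0r -{1}(mulr0 (om * G x)); apply: cvgD; apply: cvgM => //; exact: cvg_cst.
split.
  have [h1 h2 h3] := @plemelj_limit _ x L U H al u iu (uL x) (uU x) al0 (fun n => KP f (e n) x) (fun n => KPl (e n) x)
    (KP f 0 x) (KPl 0 x) (fun n => om * logJ (G x) (e n) - om * G x * atanJ (G x) (e n)) (- (om * G x * pi))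
    (fun n => (measurable_K1 x (e n)).1) (fun n => (measurable_Kl1 x (e n)).1)
    (measurable_K1 x 0).1 (measurable_Kl1 x 0).1 (fun n => KP_le1 (e n) x) (fun n => KP_tangent (e n) x)
    (fun s sx => let: And4 h _ _ _ := cvg_K sx in h) (fun s sx => let: And4 _ _ h _ := cvg_K sx in h)
    (fun n => L1_reflect x (RI_tangentP (G x) (e_gt0 n)).1)
    (fun n => etrans (RI_reflect x (L1_measurable (RI_tangentP (G x) (e_gt0 n)).1)) (RI_tangentP (G x) (e_gt0 n)).2) cvP.
  split => // n; apply: (le_trans (h3 n)); rewrite lerD2l ler_wpM2l// (le_trans (ler_normB _ _))//.
  exact: (key _ _ _ _ nom og (lb n) (ab n)).1.
have [h1 h2 h3] := @plemelj_limit _ x L U H al u iu (uL x) (uU x) al0 (fun n => KQ f (e n) x) (fun n => KQl (e n) x)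
    (KQ f 0 x) (KQl 0 x) (fun n => om * G x * logJ (G x) (e n) + om * atanJ (G x) (e n)) (om * pi)
    (fun n => (measurable_K1 x (e n)).2) (fun n => (measurable_Kl1 x (e n)).2)
    (measurable_K1 x 0).2 (measurable_Kl1 x 0).2 (fun n => KQ_le1 (e n) x) (fun n => KQ_tangent (e n) x)
    (fun s sx => let: And4 _ h _ _ := cvg_K sx in h) (fun s sx => let: And4 _ _ _ h := cvg_K sx in h)
    (fun n => L1_reflect x (RI_tangentQ (G x) (e_gt0 n)).1)
    (fun n => etrans (RI_reflect x (L1_measurable (RI_tangentQ (G x) (e_gt0 n)).1)) (RI_tangentQ (G x) (e_gt0 n)).2) cvQ.
split => // n; apply: (le_trans (h3 n)); rewrite lerD2l ler_wpM2l// (le_trans (ler_normD _ _))//.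
exact: (key _ _ _ _ nom og (lb n) (ab n)).2.
Qed.

(** For |x| >= 2 M + 1 the distance from x to the support of u is at least |x| / 2, so the kernel is
    at most 2 / |x|; for smaller |x| the bound [C1] is used. This is the square-integrable decay
    behind the passage to the limit. *)
Lemma decay_bound (C1 : R) (k : R -> R) x : measurable_fun setT k -> (forall s, `|k s| * `|x - s| <= 1) ->
  `|RI (fun s => k s * u s)| <= C1 ->
  RI (fun s => k s * u s) ^+ 2 <=
    (8 * RI (fun s => `|u s|) ^+ 2 + C1 ^+ 2 * (1 + (2 * M + 1) ^+ 2)) * (1 + x ^+ 2)^-1.
Proof.
move=> mk k1 kC; have iu := L1_compact_bounded; set K := RI (fun s => `|u s|).
have K0 : 0 <= K by exact: RI_ge0.
have x1 : 0 < 1 + x ^+ 2 by rewrite ltr_pwDl// sqr_ge0.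
have C0 : 0 <= C1 by exact: le_trans kC.
have M1 : 0 <= 2 * M + 1 by rewrite addr_ge0// mulr_ge0.
rewrite -(real_normK (num_real (RI _))) ler_pdivlMr//.
have [xM|xM] := leP (2 * M + 1) `|x|.
  have xp : 0 < `|x| by apply: lt_le_trans xM; rewrite ltr_wpDl ?mulr_ge0.
  have h : `|RI (fun s => k s * u s)| <= 2 / `|x| * K.
    rewrite /K -RI_Z; last exact: L1abs.
    apply: RI_abs_le; [by meas| |by apply: L1Z; exact: L1abs].
    move=> s; have [sM|/u0 ->] := leP `|s| M; last by rewrite mulr0 normr0 mulr0.
    rewrite normrM ler_wpM2r// ler_pdivlMr//; apply: le_trans (_ : `|k s| * (2 * `|x - s|) <= _).
      rewrite ler_wpM2l//; have := ler_normD (x - s) s.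
      by rewrite subrK; lra.
    by rewrite mulrCA ler_piMr// .
  have h2 : `|RI (fun s => k s * u s)| ^+ 2 <= (2 / `|x| * K) ^+ 2.
    by rewrite lerXn2r// nnegrE mulr_ge0// divr_ge0.
  (* The 8 is 4 times 2, from (2 / |x|)^2 and from 1 + x^2 <= 2 x^2, valid since |x| >= 1. *)
  apply: (@le_trans _ _ (8 * K ^+ 2)); last by rewrite lerDl mulr_ge0 ?sqr_ge0// addr_ge0// sqr_ge0.
  apply: (le_trans (ler_wpM2r (ltW x1) h2)).
  rewrite exprMn expr_div_n real_normK ?num_real//.
  have x2 : 1 <= x ^+ 2.
    by rewrite -real_normK ?num_real// expr_ge1// (le_trans _ xM)// lerDr mulr_ge0.
  have -> : 2 ^+ 2 / x ^+ 2 * K ^+ 2 * (1 + x ^+ 2) = K ^+ 2 * (4 * (1 + x ^+ 2) / x ^+ 2).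
    by field; rewrite -normr_gt0.
  rewrite mulrC ler_wpM2r ?sqr_ge0// ler_pdivrMr ?(lt_le_trans _ x2)//; lra.
apply: (@le_trans _ _ (C1 ^+ 2 * (1 + (2 * M + 1) ^+ 2))); last by rewrite lerDr mulr_ge0// sqr_ge0.
rewrite ler_pM ?sqr_ge0 ?(ltW x1)//; first by rewrite lerXn2r// nnegrE.
by rewrite lerD2l -real_normK ?num_real// lerXn2r// ?nnegrE// ltW.
Qed.

Lemma cvgn_le (v : nat -> R) (l c : R) : v n @[n --> \oo] --> l -> (forall n, v n <= c) -> l <= c.
Proof.
move=> vl vc; rewrite -(cvg_lim _ vl)//; apply: limr_le; first exact: cvgP vl.
exact: nearW.
Qed.

(** The limit eta = 1/(n+1) -> 0 in [rellich_shifted]: the Cauchy integrals converge pointwise to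
    the traces, and their squares stay below C / (1 + x^2) with C independent of n. *)
Lemma rellich_boundary : exists C : R,
  [/\ measurable_fun setT (trace_P u) /\ measurable_fun setT (trace_Q u),
     forall x, trace_P u x ^+ 2 <= C * (1 + x ^+ 2)^-1, forall x, trace_Q u x ^+ 2 <= C * (1 + x ^+ 2)^-1,
     L1 (fun x => trace_P u x ^+ 2 - trace_Q u x ^+ 2 + 2 * G x * (trace_P u x * trace_Q u x)) &
     RI (fun x => trace_P u x ^+ 2 - trace_Q u x ^+ 2 + 2 * G x * (trace_P u x * trace_Q u x)) = 0].
Proof.
have iu := L1_compact_bounded.
pose C1 := RI (fun s => `|u s|) + L * RI (@unit_cut R)
  + U * H * RI (fun t => unit_cut t * `|t| `^ (al - 1)) + U * ((1 + B) * ((B + 1) ^+ 2 + pi)).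
have bC x : RI (desing_bound x L U H al u) + U * ((1 + B) * ((B + 1) ^+ 2 + pi)) = C1.
  by rewrite RI_desing_bound.
pose C := 8 * RI (fun s => `|u s|) ^+ 2 + C1 ^+ 2 * (1 + (2 * M + 1) ^+ 2).
have Pb n x : Pp f (e n) u x ^+ 2 <= C * (1 + x ^+ 2)^-1.
  apply: decay_bound; [exact: (measurable_K1 _ _).1|exact: KP_le1|].
  by have [[_ _ h] _] := trace_limit x; rewrite -(bC x); exact: h.
have Qb n x : Qq f (e n) u x ^+ 2 <= C * (1 + x ^+ 2)^-1.
  apply: decay_bound; [exact: (measurable_K1 _ _).2|exact: KQ_le1|].
  by have [_ [_ _ h]] := trace_limit x; rewrite -(bC x); exact: h.
have cP x : Pp f (e n) u x @[n --> \oo] --> trace_P u x by have [[]] := trace_limit x.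
have cQ x : Qq f (e n) u x @[n --> \oo] --> trace_Q u x by have [_ []] := trace_limit x.
have mPn n : measurable_fun setT (Pp f (e n) u) by exact: (measurable_Pp df).
have mQn n : measurable_fun setT (Qq f (e n) u) by exact: (measurable_Qq df).
have mP : measurable_fun setT (trace_P u).
  by apply: (measurable_fun_cvg (h := fun n => Pp f (e n) u)) => // x _; exact: cP.
have mQ : measurable_fun setT (trace_Q u).
  by apply: (measurable_fun_cvg (h := fun n => Qq f (e n) u)) => // x _; exact: cQ.
pose E n x := Pp f (e n) u x ^+ 2 - Qq f (e n) u x ^+ 2 + 2 * G x * (Pp f (e n) u x * Qq f (e n) u x).
have [iE cv] : L1 (fun x => trace_P u x ^+ 2 - trace_Q u x ^+ 2 + 2 * G x * (trace_P u x * trace_Q u x)) /\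
   RI (E n) @[n --> \oo] --> RI (fun x => trace_P u x ^+ 2 - trace_Q u x ^+ 2 + 2 * G x * (trace_P u x * trace_Q u x)).
  apply: (RI_dct (g := fun x => (1 + B) * 2 * C * (1 + x ^+ 2)^-1)).
  - by move=> n; have := mPn n; have := mQn n; rewrite /E => ? ?; meas.
  - by meas.
  - apply: aeW => x; apply: cvgD.
      by apply: cvgB; apply: cvg_sqr; [exact: cP|exact: cQ].
    by apply: cvgM; [exact: cvg_cst|apply: cvgM; [exact: cP|exact: cQ]].
  - move=> n x; have := Pb n x; have := Qb n x; rewrite /E -[X in _ -> _ -> _ <= X]mulrA.
    move: (Pp _ _ _ _) (Qq _ _ _ _) (C * _) => a b k hb ha.
    have h : `|2 * (a * b)| <= 2 * k.
      by rewrite ler_norml; apply/andP; split; have := sqr_ge0 (a - b); have := sqr_ge0 (a + b); nra.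
    have h2 : `|a ^+ 2 - b ^+ 2| <= 2 * k.
      by rewrite ler_norml; apply/andP; split; have := sqr_ge0 a; have := sqr_ge0 b; lra.
    have -> : 2 * G x * (a * b) = G x * (2 * (a * b)) by ring.
    have -> : (1 + B) * 2 * k = 2 * k + B * (2 * k) by ring.
    apply: (le_trans (ler_normD _ _)); apply: lerD => //; rewrite (normrM (G x)).
    by rewrite ler_pM.
  - by apply: L1Z; exact: L1_inv1sqr.
exists C; split => //.
- by move=> x; apply: (cvgn_le (cvg_sqr (cP x))) => n; exact: Pb.
- by move=> x; apply: (cvgn_le (cvg_sqr (cQ x))) => n; exact: Qb.
apply: (cvg_unique _ cv) => //.
rewrite (_ : (fun n => RI (E n)) = fun=> 0); first exact: cvg_cst.
apply/funext => n; exact: (rellich_shifted df cG GB fB (e_gt0 n) M0 iu u0).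
Qed.

End RellichBoundary.

(** * The L_2 estimate for Lipschitz functions *)

Section RellichEstimate.
Context {R : realType}.
Local Notation mu := (@lebesgue_measure R).
Implicit Types x y s t eta M : R.

Definition kerS (f G : R -> R) x s : R :=
  ((x - s) * G x - (f x - f s)) / ((x - s) ^+ 2 + (f x - f s) ^+ 2).

Definition opA (f G u : R -> R) x : R := pi^-1 * RI (fun s => kerS f G x s * u s).

Lemma kerSE f G x s : kerS f G x s = G x * KP f 0 x s - KQ f 0 x s.
Proof. by rewrite /kerS /KP /KQ /Dd addr0; ring. Qed.

Variables (f G : R -> R) (B F0 H al : R).
Hypothesis df : forall x : R, is_derive x 1 f (G x).
Hypothesis cG : continuous G.
Hypothesis GB : forall x, `|G x| <= B.
Hypothesis fB : forall x, `|f x| <= F0.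
Hypothesis al0 : 0 < al.
Hypothesis GH : forall x y, `|G x - G y| <= H * `|x - y| `^ al.

Variables (u : R -> R) (L U M : R).
Hypotheses (mu_ : measurable_fun setT u) (M0 : 0 <= M) (u0 : forall s, M < `|s| -> u s = 0)
  (uL : forall x s, `|u s - u x| <= L * `|x - s|) (uU : forall x, `|u x| <= U).

(** Reflection in the horizontal axis turns the lower side of the graph into an upper side, so the
    boundary identity for -f and -G is the one for the other side of f. *)
Let Nf x := - f x.
Let NG x := - G x.

Let NKP x s : KP Nf 0 x s = KP f 0 x s.
Proof. by rewrite /KP /Dd /Nf !addr0; congr (_ / (_ + _)); ring. Qed.

Let NKQ x s : KQ Nf 0 x s = - KQ f 0 x s.
Proof.
rewrite /KQ /Dd /Nf !addr0 (_ : - f x - - f s = - (f x - f s)); last by ring.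
by rewrite sqrrN mulNr.
Qed.

Let NKPl x s : KPl NG 0 x s = KPl G 0 x s.
Proof. by rewrite /KPl /Dl /NG !addr0 mulNr sqrrN. Qed.

Let NKQl x s : KQl NG 0 x s = - KQl G 0 x s.
Proof. by rewrite /KQl /Dl /NG !addr0 mulNr sqrrN mulNr. Qed.

Let Ndf (x : R) : is_derive x 1 Nf (NG x).
Proof. exact: is_deriveN. Qed.

Let NcG : continuous NG. Proof. by move=> x; apply: cvgN; exact: cG. Qed.

Let NGB x : `|NG x| <= B. Proof. by rewrite normrN. Qed.
Let NfB x : `|Nf x| <= F0. Proof. by rewrite normrN. Qed.
Let NGH x y : `|NG x - NG y| <= H * `|x - y| `^ al.
Proof. by rewrite /NG -opprD normrN. Qed.

Let id1 x : L1 (desing (KP f 0 x) (KPl G 0 x) u x).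
Proof. by have [[]] := trace_limit df GB al0 GH mu_ u0 uL uU x. Qed.

Let id2 x : L1 (desing (KQ f 0 x) (KQl G 0 x) u x).
Proof. by have [_ []] := trace_limit df GB al0 GH mu_ u0 uL uU x. Qed.

(** At eta = 0 one has [KQl] = G [KPl], so the singular parts cancel in G [KP] - [KQ] and an
    absolutely convergent integral is left. *)
Lemma pv_opA x : L1 (fun s => kerS f G x s * u s) /\
  RI (fun s => kerS f G x s * u s) = G x * pv_P f G u x - pv_Q f G u x.
Proof.
have ae : {ae mu, forall s, G x * desing (KP f 0 x) (KPl G 0 x) u x s - desing (KQ f 0 x) (KQl G 0 x) u x s
    = kerS f G x s * u s}.
  apply: aeW => s; rewrite kerSE /desing.
  have -> : KQl G 0 x s = G x * KPl G 0 x s by rewrite /KQl /KPl addr0 mulrA.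
  ring.
have i3 := L1B (L1Z (G x) (id1 x)) (id2 x).
have mf : measurable_fun setT f.
  by apply: continuous_measurable_fun => z; apply: derivable_continuous1; case: (df z).
have mk : measurable_fun setT (fun s => kerS f G x s * u s) by rewrite /kerS; meas.
split; first exact: eq_ae_L1 ae i3.
rewrite -(eq_ae_RI (L1_measurable i3) mk ae) (RI_B (L1Z (G x) (id1 x)) (id2 x)).
by rewrite (RI_Z _ (id1 x)).
Qed.

Let om x := (1 + G x ^+ 2)^-1.

Let NtP x : trace_P Nf NG u x = pv_P f G u x + u x * (om x * G x * pi).
Proof.
rewrite /trace_P (_ : - _ = om x * G x * pi); last by rewrite /om /NG sqrrN; ring.
congr (_ + _); rewrite /pv_P; congr RI.
by apply/funext => s; rewrite /desing NKP NKPl.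
Qed.

Let NtQ x : trace_Q Nf NG u x = - pv_Q f G u x + u x * (om x * pi).
Proof.
rewrite /trace_Q /pv_Q /NG sqrrN; congr (_ + _).
transitivity (RI (fun s => -1 * desing (KQ f 0 x) (KQl G 0 x) u x s)).
  by congr RI; apply/funext => s; rewrite /desing NKQ NKQl; ring.
by rewrite (RI_Z (-1) (id2 x)) mulN1r.
Qed.

(** Here w = 1/(1 + g^2), and v, a, h stand for pi u, pi A(f) u and pi (lambda u - A(f) u); E1 and
    E2 are the Rellich integrands of the two sides. With b = P + g Q, the combination (E1 + E2)/2 -
    l (E2 - E1)/2 equals w (b^2 + (l^2 - 1) v^2 - h^2 - 2 g b h) and bounds b by h; then (E1 + E2)/2
    bounds v by b. *)
Let pointwise (l g w v P Q : R) (a := g * P - Q) (h := l * v - a)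
  (E1 := (P - w * g * v) ^+ 2 - (Q + w * v) ^+ 2 + 2 * g * ((P - w * g * v) * (Q + w * v)))
  (E2 := (P + w * g * v) ^+ 2 - (- Q + w * v) ^+ 2 - 2 * g * ((P + w * g * v) * (- Q + w * v))) :
  w * (1 + g ^+ 2) = 1 -> `|g| <= B -> 1 <= `|l| ->
  v ^+ 2 <= 2 * (1 + B ^+ 2) ^+ 2 * (1 + 2 * B ^+ 2) * h ^+ 2
   + 2 * (1 + B ^+ 2) ^+ 2 * ((E1 + E2) / 2 - l * (E2 - E1) / 2) - (1 + B ^+ 2) * ((E1 + E2) / 2).
Proof.
move=> wg gB l1; pose b := P + g * Q.
have w0 : 0 < w.
  have : 0 < w * (1 + g ^+ 2) by rewrite wg.
  by rewrite pmulr_lgt0// ltr_pwDl// sqr_ge0.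
have g2 : g ^+ 2 <= B ^+ 2.
  by rewrite -(real_normK (num_real g)) lerXn2r// nnegrE (le_trans _ gB).
have l2 : 1 <= l ^+ 2 by rewrite -real_normK ?num_real// expr_ge1.
have eP : P = w * (b + g * a).
  by rewrite -[LHS]mul1r -wg /b /a; ring.
have eQ : Q = w * (g * b - a).
  by rewrite -[LHS]mul1r -wg /b /a; ring.
have eS : (E1 + E2) / 2 = w * (b ^+ 2 - v ^+ 2 - a ^+ 2 + 2 * g * b * a).
  have -> : (E1 + E2) / 2 = (P ^+ 2 - Q ^+ 2 + 2 * g * P * Q) - w * (w * (1 + g ^+ 2)) * v ^+ 2.
    by rewrite /E1 /E2; field.
  rewrite wg mulr1 eP eQ.
  transitivity (w * (w * (1 + g ^+ 2)) * (b ^+ 2 - a ^+ 2 + 2 * g * b * a) - w * v ^+ 2); first by ring.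
  by rewrite wg; ring.
have eD : (E2 - E1) / 2 = 2 * w * (g * b * v - v * a).
  have -> : (E2 - E1) / 2 = 2 * w * v * (g * P + Q + g * (g * Q - P)).
    by rewrite /E1 /E2; field.
  rewrite /b /a; ring.
have eZ : (E1 + E2) / 2 - l * (E2 - E1) / 2 = w * (b ^+ 2 + (l ^+ 2 - 1) * v ^+ 2 - h ^+ 2 - 2 * g * b * h).
  by rewrite -mulrA eD eS /h; ring.
rewrite eZ eS.
have B2 : 0 <= B ^+ 2 by exact: sqr_ge0.
have wle1 : w <= 1 by have := mulr_ge0 (ltW w0) (sqr_ge0 g); lra.
have wB : 1 <= w * (1 + B ^+ 2) by rewrite -[X in X <= _]wg (ler_wpM2l (ltW w0))// lerD2l.
(* The difference of the two sides is w (a - g b)^2. *)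
have h1 : w * (b ^+ 2 - v ^+ 2 - a ^+ 2 + 2 * g * b * a) <= b ^+ 2 - w * v ^+ 2.
  have -> : b ^+ 2 = w * (1 + g ^+ 2) * b ^+ 2 by rewrite wg mul1r.
  have := mulr_ge0 (ltW w0) (sqr_ge0 (a - g * b)); nra.
(* Young's inequality 2 g b h <= b^2 / 2 + 2 g^2 h^2; the term (l^2 - 1) v^2 is dropped, being
   nonnegative. *)
have h2 : w * (b ^+ 2 / 2 - (1 + 2 * g ^+ 2) * h ^+ 2) <= w * (b ^+ 2 + (l ^+ 2 - 1) * v ^+ 2 - h ^+ 2 - 2 * g * b * h).
  apply: (ler_wpM2l (ltW w0)).
  have : 0 <= (l ^+ 2 - 1) * v ^+ 2 by rewrite mulr_ge0 ?sqr_ge0// subr_ge0.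
  have := sqr_ge0 (b / 2 - g * h) ; have := sqr_ge0 (b - 2 * g * h); lra.
have h3 : w * ((1 + 2 * g ^+ 2) * h ^+ 2) <= (1 + 2 * B ^+ 2) * h ^+ 2.
  rewrite mulrA ler_wpM2r ?sqr_ge0//; have := mulr_ge0 (ltW w0) (sqr_ge0 g); nra.
move: h1 h2; set S := w * (b ^+ 2 - v ^+ 2 - _ + _); set Z := w * (b ^+ 2 + _ - _ - _) => h1 h2.
have h4 : b ^+ 2 <= (1 + B ^+ 2) * (w * b ^+ 2).
  by rewrite mulrA ler_peMl ?sqr_ge0// mulrC.
have h5 : v ^+ 2 <= (1 + B ^+ 2) * (w * v ^+ 2).
  by rewrite mulrA ler_peMl ?sqr_ge0// mulrC.
have K0 : 0 <= 1 + B ^+ 2 by rewrite addr_ge0.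
have h6 : w * b ^+ 2 <= 2 * (Z + (1 + 2 * B ^+ 2) * h ^+ 2) by lra.
have h7 := ler_wpM2l K0 h6.
have h8 : w * v ^+ 2 <= (1 + B ^+ 2) * (2 * (Z + (1 + 2 * B ^+ 2) * h ^+ 2)) - S by lra.
have h9 := ler_wpM2l K0 h8; nra.
Qed.

Lemma rellich_estimate (lambda : R) : 1 <= `|lambda| ->
  RI (fun x => u x ^+ 2) <= 2 * (1 + B ^+ 2) ^+ 2 * (1 + 2 * B ^+ 2) *
     RI (fun x => (lambda * u x - opA f G u x) ^+ 2).
Proof.
move=> l1.
have [C [[mP mQ] Pb Qb iE E0]] := rellich_boundary df cG GB fB al0 GH mu_ M0 u0 uL uU.
have [C' [[mP' mQ'] Pb' Qb' iE' E0']] := rellich_boundary Ndf NcG NGB NfB al0 NGH mu_ M0 u0 uL uU.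
have pi0 := @pi_gt0 R.
have omG x : om x * (1 + G x ^+ 2) = 1 by rewrite /om mulVf// gt_eqF// ltr_pwDl// sqr_ge0.
have mG : measurable_fun setT G by exact: continuous_measurable_fun.
have iu := L1_compact_bounded mu_ u0 uU.
have iu2 : L1 (fun x => u x ^+ 2).
  apply: (L1_le (g := fun x => U * `|u x|)); [by meas| |by apply: L1Z; exact: L1abs].
  by move=> x; rewrite normrX expr2 ler_wpM2r.
pose R1 x := lambda * u x - opA f G u x.
(* In terms of the upper traces, A(f) u is u + (G P - Q) / pi; the decay of the traces then makes
   [R1] square integrable. *)
have R1E x : R1 x = (lambda - 1) * u x - pi^-1 * (G x * trace_P f G u x - trace_Q f G u x).
  rewrite /R1 /opA (pv_opA x).2 /trace_P /trace_Q -/(om x).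
  have -> : G x * (pv_P f G u x + u x * - (om x * G x * pi)) - (pv_Q f G u x + u x * (om x * pi)) =
    G x * pv_P f G u x - pv_Q f G u x - u x * pi * (om x * (1 + G x ^+ 2)) by ring.
  by rewrite omG; move: (@pi R) pi0 => p p0; field; rewrite gt_eqF.
have mR1 : measurable_fun setT R1.
  rewrite (_ : R1 = (fun x => (lambda - 1) * u x - pi^-1 * (G x * trace_P f G u x - trace_Q f G u x))).
    meas.
  by apply/funext => x; exact: R1E.
have iR1 : L1 (fun x => R1 x ^+ 2).
  apply: (L1_le (g := fun x => 2 * (lambda - 1) ^+ 2 * u x ^+ 2 + 4 * (pi^-1) ^+ 2 * (1 + B ^+ 2) * C * (1 + x ^+ 2)^-1)).
  - by apply: measurable_fun_exp.
  - move=> x; rewrite ger0_norm ?sqr_ge0// R1E; have := Pb x; have := Qb x.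
    rewrite -[X in _ -> _ -> _ <= _ + X]mulrA.
    move: (trace_P _ _ _ _) (trace_Q _ _ _ _) (C * _) (pi^-1) => P Q k p hQ hP.
    have G2 : G x ^+ 2 <= B ^+ 2.
      by rewrite -(real_normK (num_real (G x))) lerXn2r// nnegrE (le_trans _ (GB x)).
    have k0 : 0 <= k by exact: le_trans (sqr_ge0 _) hP.
    have h : (G x * P - Q) ^+ 2 <= 2 * ((1 + B ^+ 2) * k).
      apply: (@le_trans _ _ (2 * (G x ^+ 2 * P ^+ 2 + Q ^+ 2))).
        have := sqr_ge0 (G x * P + Q); nra.
      rewrite ler_wpM2l// mulrDl mul1r addrC lerD// ler_pM ?sqr_ge0//.
    have := ler_wpM2l (sqr_ge0 p) h.
    move: (G x * P - Q) => z hz; have := sqr_ge0 ((lambda - 1) * u x + p * z); nra.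
  - by apply: L1D; apply: L1Z => //; exact: L1_inv1sqr.
pose c0 := 2 * (1 + B ^+ 2) ^+ 2 * (1 + 2 * B ^+ 2).
pose E1 x := trace_P f G u x ^+ 2 - trace_Q f G u x ^+ 2 + 2 * G x * (trace_P f G u x * trace_Q f G u x).
pose E2 x := trace_P Nf NG u x ^+ 2 - trace_Q Nf NG u x ^+ 2 + 2 * NG x * (trace_P Nf NG u x * trace_Q Nf NG u x).
(* [c1] and [c2] collect the coefficients of the two Rellich integrands. They depend on lambda but
   multiply vanishing integrals, so the final constant does not. *)
pose c1 := 2 * (1 + B ^+ 2) ^+ 2 * (2^-1 + lambda / 2) - (1 + B ^+ 2) / 2.
pose c2 := 2 * (1 + B ^+ 2) ^+ 2 * (2^-1 - lambda / 2) - (1 + B ^+ 2) / 2.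
have pw x : pi ^+ 2 * u x ^+ 2 <= c0 * pi ^+ 2 * R1 x ^+ 2 + (c1 * E1 x + c2 * E2 x).
  have := @pointwise lambda (G x) (om x) (u x * pi) (pv_P f G u x) (pv_Q f G u x) (omG x) (GB x) l1.
  have -> : lambda * (u x * pi) - (G x * pv_P f G u x - pv_Q f G u x) = pi * R1 x.
    by rewrite /R1 /opA (pv_opA x).2; move: (@pi R) pi0 => p p0; field; rewrite gt_eqF.
  have <- : pi ^+ 2 * u x ^+ 2 = (u x * pi) ^+ 2 by ring.
  move=> h; apply: (le_trans h); rewrite le_eqVlt; apply/orP; left; apply/eqP.
  rewrite /c0 /c1 /c2 /E1 /E2 NtP NtQ /trace_P /trace_Q /NG -/(om x).
  by move: (@pi R) => p; field.
have i1 := L1Z (c0 * pi ^+ 2) iR1.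
have i2 := L1D (L1Z c1 iE) (L1Z c2 iE').
have := RI_le (L1Z (pi ^+ 2) iu2) (L1D i1 i2) pw.
rewrite (RI_D i1 i2) (RI_D (L1Z c1 iE) (L1Z c2 iE')) (RI_Z c1 iE) (RI_Z c2 iE') E0 E0' !mulr0 !addr0.
rewrite (RI_Z _ iu2) (RI_Z _ iR1) => h.
by rewrite -(ler_pM2l (exprn_gt0 2 pi0)) (mulrA (pi ^+ 2)) (mulrC (pi ^+ 2) c0).
Qed.

End RellichEstimate.

(** * Morrey-Campanato regularity *)

Section Iterated.
Context {R : realType}.
Local Notation mu := (@lebesgue_measure R).
Implicit Types f g h : R -> R.

(** Replacing h by min(h, g), which equals h almost everywhere, reduces to the comparison
    everywhere. *)
Lemma RI_le_ae h g : L1 h -> L1 g -> {ae mu, forall x, h x <= g x} -> RI h <= RI g.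
Proof.
move=> ih ig hg; have mh := L1_measurable ih; have mg := L1_measurable ig.
have mm : measurable_fun setT (fun x => Num.min (h x) (g x)) by exact: measurable_minr.
have ae : {ae mu, forall x, h x = Num.min (h x) (g x)}.
  by apply: (ae_imp hg) => x hx; rewrite min_l.
rewrite (eq_ae_RI mh mm ae); apply: RI_le => //; first exact: eq_ae_L1 ae ih.
by move=> x; rewrite ge_min lexx orbT.
Qed.

Lemma iterated_L1 (F : R * R -> R) : measurable_fun setT F -> (forall z, 0 <= F z) ->
  (\int[mu]_x \int[mu]_y (F (x, y))%:E < +oo)%E ->
  {ae mu, forall x, L1 (fun y => F (x, y))} /\ L1 (fun x => RI (fun y => F (x, y))).
Proof.
move=> mF F0 Foo.
pose k x : \bar R := (\int[mu]_y (F (x, y))%:E)%E.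
have mk : measurable_fun setT k by exact: measurable_ge0_section_integral.
have k0 x : (0 <= k x)%E by apply: integral_ge0 => y _; rewrite lee_fin.
have ms x : measurable_fun setT (fun y => F (x, y)) by exact: measurable_section.
have ik : mu.-integrable setT k.
  apply/integrableP; split => //; rewrite (_ : (fun x => _) = k)//.
  by apply/funext => x; rewrite gee0_abs.
split.
  have /(ae_imp) := integrable_ae measurableT ik; apply => x /(_ I) kx.
  by apply/(L1_ge0P (ms x) (fun y => F0 (x, y))); rewrite -/(k x) ltey_eq kx.
have mR : measurable_fun setT (fun x => RI (fun y => F (x, y))) by exact: measurable_section_RI.
have R0 x : 0 <= RI (fun y => F (x, y)) by apply: RI_ge0.
apply/(L1_ge0P mR R0); apply: le_lt_trans Foo; apply: ge0_le_integral => //.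
- by move=> x _; rewrite lee_fin.
- exact/measurable_EFinP.
(* Where the section integral is infinite, [fine] returns 0, and the inequality persists. *)
- move=> x _; rewrite -/(k x) /RI /Rintegral -/(k x).
  by move: (k0 x); case: (k x).
Qed.

End Iterated.

Section Segments.
Context {R : realType}.
Local Notation mu := (@lebesgue_measure R).
Variables (p : R) (f g : R -> R).
Hypothesis p1 : 1 <= p.
Hypothesis gp : inLp p g.

Definition seg (a b : R) (h : R -> R) : R := RI (fun x => \1_(`[a, b]) x * h x).

Lemma measurable_indic_itv (i : interval R) : measurable_fun setT (\1_([set` i]) : R -> R).
Proof. exact: measurable_indic. Qed.

Lemma indic_ge0 (A : set R) x : 0 <= \1_A x :> R.
Proof. by rewrite indicE. Qed.

Lemma indic_le1 (A : set R) x : \1_A x <= 1 :> R.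
Proof. by rewrite indicE; case: (x \in A). Qed.

Lemma RI_indic (a b : R) : a <= b -> RI (\1_(`[a, b]) : R -> R) = b - a.
Proof.
move=> ab; have -> : (\1_(`[a, b]) : R -> R) = (fun x => \1_(`[a, b]) x * 1) by apply/funext => x; rewrite mulr1.
rewrite RI_restrict /Rintegral integral_cst//= lebesgue_measure_itv/= lte_fin mul1e.
by move: ab; rewrite le_eqVlt => /predU1P[->|->//]; rewrite ltxx subrr.
Qed.

Lemma le1_powR (t : R) : 0 <= t -> t <= 1 + t `^ p.
Proof.
move=> t0; have [t1|t1] := leP t 1; first by rewrite (le_trans t1)// lerDl powR_ge0.
rewrite -[leLHS]powRr1//; apply: le_trans (_ : t `^ p <= _); last by rewrite lerDr.
by rewrite ler_powR// ltW.
Qed.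

Lemma L1_seg (a b : R) : L1 (fun x => \1_(`[a, b]) x * g x).
Proof.
have mg := inLp_measurable gp; have mi := @measurable_indic_itv `[a, b].
have p0 : 0 < p := lt_le_trans ltr01 p1.
apply: L1_le (L1D (L1_indic_segment a b) (inLp_L1 p0 gp)); first by meas.
move=> x; rewrite indic_itvE; case: (x \in _); rewrite ?mul0r ?mul1r ?normr0 ?add0r ?powR_ge0//.
exact: le1_powR.
Qed.

Lemma seg_cat (a b c : R) : a <= b -> b <= c -> seg a c g = seg a b g + seg b c g.
Proof.
move=> ab bc; rewrite /seg -RI_D; [|exact: L1_seg|exact: L1_seg].
have mg := inLp_measurable gp; have mi i := @measurable_indic_itv i.
have m1 := mi `[a, c]; have m2 := mi `[a, b]; have m3 := mi `[b, c].
apply: eq_ae_RI; [by meas|by meas|].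
exists [set b]; split => //; first exact: lebesgue_measure_set1.
move=> x /=; apply: contra_notP => xb; rewrite !indic_itvE !in_itv/=.
have [xb'|xb'|/xb//] := ltgtP x b.
  have -> : x <= c by lra.
  by rewrite andbT /=; ring.
have -> : a <= x by lra.
by rewrite /= mul0r add0r.
Qed.

Hypothesis fg : forall x, f x = f 0 + oint 0 x g.

Lemma increment_seg (a b : R) : a <= b -> f b - f a = seg a b g.
Proof.
have ointE (x y : R) : oint x y g = if x <= y then seg x y g else - seg y x g.
  by rewrite /oint /seg !RI_restrict.
move=> ab; rewrite (fg b) (fg a) !ointE.
have [a0|a0] := leP 0 a; have [b0|b0] := leP 0 b.
- by rewrite (seg_cat a0 ab); ring.
- by exfalso; lra.
- by rewrite (seg_cat (ltW a0) b0); ring.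
- by rewrite (seg_cat ab (ltW b0)); ring.
Qed.

End Segments.

(** * Oscillation of averages controlled by the Gagliardo seminorm *)

Section Campanato.
Context {R : realType}.
Local Notation mu := (@lebesgue_measure R).
Variables (p s : R) (f g : R -> R).
Hypothesis p12 : 1 < p <= 2.
Hypothesis sp : 1 + p^-1 < s < 2.
Hypothesis Wf : W_sp p s f g.

Definition slope_kernel (p s : R) (g : R -> R) (z : R * R) : R :=
  `|g z.1 - g z.2| `^ p / `|z.1 - z.2| `^ (1 + (s - 1) * p).

Let al := s - 1 - p^-1.

Let p0 : 0 < p. Proof. by case/andP : p12 => h _; exact: lt_trans ltr01 h. Qed.
Let p1 : 1 <= p. Proof. by case/andP : p12 => /ltW. Qed.
Let gp : inLp p g. Proof. by case: Wf. Qed.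
Let mg : measurable_fun setT g. Proof. exact: inLp_measurable gp. Qed.

Lemma hoelder_exponent_gt0 : 0 < al.
Proof. by rewrite /al; case/andP : sp => h _; lra. Qed.

(** In the form 2 + al p the exponent shows its use: two powers of the length are spent on the area
    of a rectangle, and the rest gives the Hoelder gain. *)
Lemma hoelder_exponentE : 1 + (s - 1) * p = 2 + al * p.
Proof. by rewrite /al; have h : p^-1 * p = 1 by [rewrite mulVf// gt_eqF]; rewrite !mulrBl h; ring. Qed.

Lemma measurable_slope_kernel : measurable_fun setT (slope_kernel p s g).
Proof.
by rewrite /slope_kernel; meas.
Qed.

Lemma slope_kernel_ge0 z : 0 <= slope_kernel p s g z.
Proof. by rewrite /slope_kernel divr_ge0// powR_ge0. Qed.

Let sk : {ae mu, forall x, L1 (fun y => slope_kernel p s g (x, y))} /\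
  L1 (fun x => RI (fun y => slope_kernel p s g (x, y))).
Proof.
apply: iterated_L1; [exact: measurable_slope_kernel|exact: slope_kernel_ge0|].
by case: Wf.
Qed.

(* Either the difference is at most de, or it is at most de^(1-p) times its p-th
   power; optimising over de later replaces Hoelder's inequality. *)
Lemma slope_dichotomy (h de x y : R) : 0 < h -> 0 < de -> `|x - y| <= 2 * h ->
  `|g x - g y| <= de + (2 * h) `^ (1 + (s - 1) * p) / de `^ (p - 1) * slope_kernel p s g (x, y).
Proof.
move=> h0 de0 xy; have d1 : 0 < de `^ (p - 1) by exact: powR_gt0.
have h1 : 0 < (2 * h) `^ (1 + (s - 1) * p) by apply: powR_gt0; lra.
have [le|lt] := leP `|g x - g y| de.
  apply: (le_trans le); rewrite lerDl mulr_ge0 ?slope_kernel_ge0//.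
  by rewrite divr_ge0// ltW.
apply: le_trans (_ : (2 * h) `^ (1 + (s - 1) * p) / de `^ (p - 1) * slope_kernel p s g (x, y) <= _); last first.
  by rewrite lerDr ltW.
have xy0 : 0 < `|x - y|.
  by rewrite normr_gt0 subr_eq0; apply/eqP => e; move: lt; rewrite e subrr normr0; lra.
rewrite /slope_kernel /=; set D := `|g x - g y| in lt *.
have D0 : 0 < D by lra.
have e0 : 0 < 1 + (s - 1) * p by rewrite hoelder_exponentE; have := hoelder_exponent_gt0; have := p0; nra.
have q0 : 0 < `|x - y| `^ (1 + (s - 1) * p) by exact: powR_gt0.
have -> : (2 * h) `^ (1 + (s - 1) * p) / de `^ (p - 1) * (D `^ p / `|x - y| `^ (1 + (s - 1) * p))
  = ((2 * h) `^ (1 + (s - 1) * p) / `|x - y| `^ (1 + (s - 1) * p)) * (D `^ p / de `^ (p - 1)).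
  by field; rewrite !gt_eqF.
rewrite -[leLHS]mul1r; apply: ler_pM => //; first exact: ltW.
  rewrite ler_pdivlMr// mul1r ge0_ler_powR ?nnegrE//; [exact: ltW|lra].
rewrite ler_pdivlMr//; have -> : D `^ p = D * D `^ (p - 1).
  have {1}-> : p = 1 + (p - 1) by ring.
  by rewrite (@powRD _ D 1 (p - 1)) ?(gt_eqF D0) ?implybT// powRr1// ltW.
rewrite ler_pM2l// ge0_ler_powR ?nnegrE//; [by rewrite subr_ge0|exact: ltW|exact: ltW|exact: ltW].
Qed.

Lemma avg_dev (b h m : R) : 0 < h ->
  `|seg b (b + h) g / h - m| <= h^-1 * RI (fun y => \1_(`[b, b + h]) y * `|g y - m|).
Proof.
move=> h0; have ii := L1_indic_segment b (b + h); have ig := L1_seg p1 gp b (b + h).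
have h' : b <= b + h by lra.
have -> : seg b (b + h) g / h - m = h^-1 * RI (fun y => \1_(`[b, b + h]) y * g y - m * \1_(`[b, b + h]) y).
  rewrite RI_B//; last exact: L1Z.
  rewrite RI_Z// RI_indic// /seg; field; lra.
rewrite normrM gtr0_norm ?invr_gt0// ler_pM2l ?invr_gt0//.
have mi := measurable_indic_itv `[b, b + h].
have e y : \1_`[b, b + h] y * g y - m * \1_`[b, b + h] y = \1_`[b, b + h] y * (g y - m) by ring.
have iL : L1 (fun y => \1_`[b, b + h] y * g y - m * \1_`[b, b + h] y) by apply: L1B => //; exact: L1Z.
apply: (le_trans (RI_abs iL)); rewrite le_eqVlt; apply/orP; left; apply/eqP; congr RI; apply/funext => y.
by rewrite e normrM ger0_norm// indic_ge0.
Qed.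

(** From [slope_dichotomy] with threshold h^al: the 1 is the threshold itself, the power of 2 comes
    from the maximal distance 2 h, and the 4 from the area h1 h2 >= h^2 / 4. The double integral is
    the p-th power of the Gagliardo seminorm. *)
Definition campanato_const := 1 + 4 * 2 `^ (1 + (s - 1) * p) * RI (fun x => RI (fun y => slope_kernel p s g (x, y))).

Lemma campanato (a b h h1 h2 : R) : 0 < h -> h / 2 <= h1 <= h -> h / 2 <= h2 <= h -> `|a - b| <= h ->
  `|seg a (a + h1) g / h1 - seg b (b + h2) g / h2| <= campanato_const * h `^ al.
Proof.
move=> h0 /andP[hl1 hr1] /andP[hl2 hr2] ab.
have h10 : 0 < h1 by lra.
have h20 : 0 < h2 by lra.
have [aek iK] := sk.
set kk := (fun x => _) in iK.
(* With this threshold c = 2^(1 + (s - 1) p) h^(2 + al), so after division by the area both terms of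
   the dichotomy scale like h^al. *)
pose de := h `^ al; have de0 : 0 < de by exact: powR_gt0.
pose c := (2 * h) `^ (1 + (s - 1) * p) / de `^ (p - 1).
have c0 : 0 <= c by rewrite divr_ge0// powR_ge0.
have iJ := L1_indic_segment b (b + h2); have iI := L1_indic_segment a (a + h1).
have mI := measurable_indic_itv `[a, a + h1]; have mJ := measurable_indic_itv `[b, b + h2].
have near x y : x \in `[a, a + h1] -> y \in `[b, b + h2] -> `|x - y| <= 2 * h.
  rewrite !in_itv/= => /andP[xa xb] /andP[ya yb]; move: ab; rewrite !ler_norml => /andP[? ?]; apply/andP; split; lra.
set m := seg b (b + h2) g / h2.
have dev x : x \in `[a, a + h1] -> L1 (fun y => slope_kernel p s g (x, y)) -> `|g x - m| <= de + c / h2 * kk x.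
  move=> xI ik; rewrite distrC; apply: (le_trans (avg_dev _ _ h20)).
  have -> : de + c / h2 * kk x = h2^-1 * (de * h2 + c * kk x) by field; lra.
  rewrite ler_pM2l ?invr_gt0//.
  have -> : de * h2 + c * kk x = RI (fun y => de * \1_(`[b, b + h2]) y + c * slope_kernel p s g (x, y)).
    rewrite RI_D; [|exact: L1Z|exact: L1Z]; rewrite !RI_Z// RI_indic; last lra.
    by rewrite /kk; congr (_ + _); congr (_ * _); ring.
  have iR : L1 (fun y => de * \1_(`[b, b + h2]) y + c * slope_kernel p s g (x, y)) by apply: L1D; exact: L1Z.
  have bd y : \1_(`[b, b + h2]) y * `|g y - g x| <= de * \1_(`[b, b + h2]) y + c * slope_kernel p s g (x, y).
    rewrite indic_itvE; have [yJ|yJ] := boolP (y \in `[b, b + h2]) => /=.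
      rewrite mul1r mulr1 distrC; apply: slope_dichotomy => //; exact: near.
    by rewrite mul0r mulr0 add0r mulr_ge0// slope_kernel_ge0.
  apply: RI_le => //; apply: L1_le iR; first by meas.
  by move=> y; rewrite ger0_norm// mulr_ge0// indic_ge0.
apply: (le_trans (avg_dev _ _ h10)); rewrite -/m.
have iR : L1 (fun x => de * \1_(`[a, a + h1]) x + c / h2 * kk x) by apply: L1D; exact: L1Z.
have kk0 x : 0 <= kk x by apply: RI_ge0 => y; exact: slope_kernel_ge0.
have mkk := L1_measurable iK.
have iL : L1 (fun x => \1_(`[a, a + h1]) x * `|g x - m|).
  have i1 := L1D (L1abs (L1_seg p1 gp a (a + h1))) (L1Z `|m| iI).
  apply: L1_le i1; first by meas.
  move=> x; rewrite normrM normr_id normrM (ger0_norm (indic_ge0 _ _)).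
  by rewrite (mulrC `|m|) -mulrDr ler_wpM2l ?indic_ge0// ler_normB.
have le1 : RI (fun x => \1_(`[a, a + h1]) x * `|g x - m|) <= de * h1 + c / h2 * RI kk.
  have -> : de * h1 + c / h2 * RI kk = RI (fun x => de * \1_(`[a, a + h1]) x + c / h2 * kk x).
    rewrite RI_D; [|exact: L1Z|exact: L1Z]; rewrite !RI_Z// RI_indic; last lra.
    by congr (_ + _); congr (_ * _); ring.
  apply: RI_le_ae => //; apply: (ae_imp aek) => x ikx.
  rewrite indic_itvE; have [xI|xI] := boolP (x \in `[a, a + h1]) => /=.
    by rewrite mul1r mulr1; exact: dev.
  by rewrite mul0r mulr0 add0r mulr_ge0// divr_ge0// ltW.
have K0 : 0 <= RI kk by exact: RI_ge0.
have hh : (h1 * h2)^-1 <= 4 / h ^+ 2.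
  rewrite -[leLHS]mul1r ler_pdivrMr ?mulr_gt0// mulrAC ler_pdivlMr ?exprn_gt0// mul1r; nra.
apply: (@le_trans _ _ (de + c * (4 / h ^+ 2) * RI kk)).
  have -> : de + c * (4 / h ^+ 2) * RI kk = h1^-1 * (de * h1 + c * h1 * (4 / h ^+ 2) * RI kk).
    by field; rewrite !gt_eqF.
  rewrite ler_pM2l ?invr_gt0//; apply: (le_trans le1); rewrite lerD2l ler_wpM2r//.
  have -> : c / h2 = c * h1 * (h1 * h2)^-1 by field; rewrite !gt_eqF.
  by rewrite ler_wpM2l// mulr_ge0// ltW.
rewrite le_eqVlt; apply/orP; left; apply/eqP; rewrite /campanato_const -/kk -/de.
have -> : c = 2 `^ (1 + (s - 1) * p) * (de * h ^+ 2).
  have e : h `^ (1 + (s - 1) * p) = de * h ^+ 2 * de `^ (p - 1).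
    rewrite /de -powRrM -powR_mulrn ?ltW// -!powRD ?(gt_eqF h0) ?implybT//.
    by rewrite hoelder_exponentE; f_equal; rewrite -/al; ring.
  by rewrite /c powRM ?ltW// e -!mulrA mulfV ?gt_eqF ?powR_gt0// mulr1.
by field; rewrite gt_eqF.
Qed.

End Campanato.

(** * From difference quotients of small oscillation to a Hoelder continuous derivative *)

Section Morrey.
Context {R : realType}.
Local Notation mu := (@lebesgue_measure R).
Variables (f : R -> R) (C al : R).
Hypothesis al0 : 0 < al.
Hypothesis C0 : 0 <= C.
Hypothesis slope_osc : forall a b h h1 h2 : R, 0 < h -> h / 2 <= h1 <= h -> h / 2 <= h2 <= h -> `|a - b| <= h ->
  `|(f (a + h1) - f a) / h1 - (f (b + h2) - f b) / h2| <= C * h `^ al.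

Let rho : R := 2 `^ (- al).

Lemma half_powR_gt0 : 0 < rho.
Proof. by apply: powR_gt0. Qed.

Lemma half_powR_lt1 : rho < 1.
Proof.
rewrite /rho powRN invf_lt1 ?powR_gt0//.
have h : 1 `^ al < (2 : R) `^ al by rewrite gt0_ltr_powR ?nnegrE ?ltr1n.
by rewrite powR1 in h.
Qed.

Lemma half_exp_powR n : ((2^-1 : R) ^+ n) `^ al = rho ^+ n.
Proof.
rewrite -powR_mulrn ?invr_ge0// -powR_inv1// -!powRrM /rho -powR_mulrn ?powR_ge0// -powRrM.
by f_equal; ring.
Qed.

Definition dyadic_slope n x := (f (x + 2^-1 ^+ n) - f x) / 2^-1 ^+ n.

(** Sum of the geometric series of errors: C rho^n = D rho^n - D rho^(n+1), so the estimates
    telescope without writing sums. *)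
Let D := C / (1 - rho).

Let D0 : 0 <= D.
Proof. by rewrite divr_ge0// subr_ge0 ltW// half_powR_lt1. Qed.

Let e_gt0 n : 0 < (2^-1 : R) ^+ n.
Proof. by rewrite exprn_gt0// invr_gt0. Qed.

Lemma dyadic_slope_step n x :
  `|dyadic_slope n x - dyadic_slope n.+1 x| <= D * rho ^+ n - D * rho ^+ n.+1.
Proof.
have r1 := half_powR_lt1.
have -> : D * rho ^+ n - D * rho ^+ n.+1 = C * rho ^+ n.
  by rewrite /D exprS; field; rewrite subr_eq0 gt_eqF.
have he : (2^-1 : R) ^+ n.+1 = 2^-1 ^+ n / 2 by rewrite exprS mulrC.
rewrite -half_exp_powR; apply: slope_osc => //.
- by have := e_gt0 n; move: (_ ^+ n) => e e0; apply/andP; split; lra.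
- by rewrite he lexx /=; have := e_gt0 n; move: (_ ^+ n) => e e0; lra.
- by rewrite subrr normr0 ltW.
Qed.

Definition morrey_derivative x := lim (dyadic_slope n x @[n --> \oo]).
Local Notation G := morrey_derivative.

Lemma dyadic_slope_cvg x : dyadic_slope n x @[n --> \oo] --> G x /\
  forall n, `|dyadic_slope n x - G x| <= D * rho ^+ n.
Proof.
pose d n := dyadic_slope n x.
have step := dyadic_slope_step ^~ x.
have r0 : rho ^+ n @[n --> \oo] --> (0 : R).
  by apply: cvg_expr; rewrite gtr0_norm ?half_powR_gt0// half_powR_lt1.
have tele n k : `|d n - d (n + k)%N| <= D * rho ^+ n - D * rho ^+ (n + k).
  elim: k => [|k IH]; first by rewrite addn0 !subrr normr0.
  have := step (n + k)%N; rewrite -/(d _) -/(d _) addnS => h.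
  have := ler_normD (d n - d (n + k)%N) (d (n + k)%N - d (n + k).+1).
  rewrite subrKA; lra.
have cd : cvgn d.
  (* The step estimate makes d n + D rho^n nonincreasing and bounded below; its convergence and that
     of D rho^n give the convergence of d. *)
  have i : nonincreasing_seq (fun n => d n + D * rho ^+ n).
    apply/nonincreasing_seqP => n; have := step n; rewrite -/(d _) -/(d _) ler_norml => /andP[]; lra.
  have cv : cvgn (fun n => d n + D * rho ^+ n).
    apply: nonincreasing_is_cvgn => //; exists (d 0%N - D); move=> _ [n _ <-].
    have := tele 0%N n; rewrite !add0n expr0 mulr1 ler_norml => /andP[_ h].
    have h' : 0 <= D * rho ^+ n + D * rho ^+ n by rewrite addr_ge0// mulr_ge0// exprn_ge0// ltW// half_powR_gt0.
    by move: h h'; move: (D * rho ^+ n) (d 0%N) (d n) D => a b c e h h'; lra.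
  have c2 : D * rho ^+ n @[n --> \oo] --> D * 0 by apply: cvgM => //; exact: cvg_cst.
  have -> : d = (fun n => (d n + D * rho ^+ n) - D * rho ^+ n) by apply/funext => n; ring.
  by apply: is_cvgB => //; apply/cvg_ex; exists (D * 0).
split => // n.
apply: (@cvgn_le _ (fun k => `|d n - d (n + k)%N|)).
  apply: cvg_norm; apply: cvgB; first exact: cvg_cst.
  rewrite (_ : (fun k => d (n + k)%N) = (fun k => d (k + n)%N)); last by apply/funext => k; rewrite addnC.
  by rewrite cvg_shiftn.
by move=> k; apply: (le_trans (tele n k)); rewrite gerBl mulr_ge0// exprn_ge0// ltW// half_powR_gt0.
Qed.

Lemma dyadic_scale (t : R) : 0 < t <= 1 -> exists n, 2^-1 ^+ n / 2 <= t <= 2^-1 ^+ n.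
Proof.
move=> /andP[t0 t1].
have ex : exists n, (2^-1 : R) ^+ n < t.
  have : (2^-1 : R) ^+ n @[n --> \oo] --> (0 : R) by apply: cvg_expr; rewrite gtr0_norm ?invr_gt0// invf_lt1// ltr1n.
  move=> /cvgr_lt /(_ t t0)[N _ h]; exists N; exact: (h N (leqnn N)).
case: (ex_minnP ex) => n nt min.
case: n nt min => [|n] nt min; first by move: nt; rewrite expr0; lra.
exists n; have hn : t <= 2^-1 ^+ n by rewrite leNgt; apply/negP => /min; rewrite ltnn.
by rewrite hn andbT; move: nt; rewrite exprS mulrC => /ltW.
Qed.

Let K := 2 `^ al * (C + D).
Let K0 : 0 <= K. Proof. by rewrite mulr_ge0 ?powR_ge0// addr_ge0. Qed.

(** The step t is compared with the dyadic step lying between t and 2 t; the factor 2^al in [K] pays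
    for replacing that step by 2 t. *)
Lemma slope_rate x (t : R) : 0 < t <= 1 -> `|(f (x + t) - f x) / t - G x| <= K * t `^ al.
Proof.
move=> t01; have t0 : 0 < t by case/andP: t01.
have [n /andP[n1 n2]] := dyadic_scale t01.
have [_ /(_ n) h] := dyadic_slope_cvg x.
have := @slope_osc x x (2^-1 ^+ n) t (2^-1 ^+ n) (e_gt0 n).
have -> : 2^-1 ^+ n / 2 <= (2^-1 : R) ^+ n by have := e_gt0 n; move: (_ ^+ n) => e e0; lra.
rewrite n1 n2 subrr normr0 lexx (ltW (e_gt0 n)) /= => /(_ isT isT isT) h2.
have le1 : (2^-1 ^+ n) `^ al <= 2 `^ al * t `^ al.
  rewrite -powRM//; last exact: ltW.
  rewrite ge0_ler_powR ?nnegrE//; [exact: ltW|lra|lra].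
have := ler_normD ((f (x + t) - f x) / t - dyadic_slope n x) (dyadic_slope n x - G x).
rewrite subrKA => h3; apply: (le_trans h3); rewrite /K.
have -> : 2 `^ al * (C + D) * t `^ al = C * (2 `^ al * t `^ al) + D * (2 `^ al * t `^ al) by ring.
by rewrite -half_exp_powR in h; apply: lerD; [apply: (le_trans h2)|apply: (le_trans h)]; rewrite ler_wpM2l.
Qed.

Lemma morrey_hoelder_loc x y : `|x - y| <= 1 -> `|G x - G y| <= (2 * K + C) * `|x - y| `^ al.
Proof.
move=> xy1; have [->|xy] := eqVneq x y.
  by rewrite !subrr !normr0 mulr_ge0 ?powR_ge0// addr_ge0// mulr_ge0.
set t := `|x - y|; have t0 : 0 < t by rewrite normr_gt0 subr_eq0.
have t01 : 0 < t <= 1 by rewrite t0.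
have := slope_rate x t01; have := slope_rate y t01.
have tt : t / 2 <= t <= t by lra.
have := slope_osc t0 tt tt (lexx _).
move: ((f (x + t) - f x) / t) ((f (y + t) - f y) / t) => A A' h1 h2 h3.
have -> : (2 * K + C) * t `^ al = K * t `^ al + C * t `^ al + K * t `^ al by ring.
have -> : G x - G y = (G x - A) + (A - A') + (A' - G y) by ring.
apply: (le_trans (ler_normD _ _)); apply: lerD => //; apply: (le_trans (ler_normD _ _)).
by apply: lerD => //; rewrite distrC.
Qed.

(** For t < 0 the quotient is the forward quotient based at x - |t|, which the oscillation bound
    compares with the forward quotient at x. *)
Lemma slope_rate2 x (t : R) : 0 < `|t| <= 1 -> `|(f (x + t) - f x) / t - G x| <= (K + C) * `|t| `^ al.
Proof.
move=> t01; have t0' : t != 0 by rewrite -normr_gt0; case/andP : t01.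
have [t0|t0|e] := ltgtP t 0; last by rewrite e eqxx in t0'.
  pose r := `|t|; rewrite -/r in t01 *; have r0 : 0 < r by case/andP : t01.
  have re : t = - r by rewrite /r ltr0_norm// opprK.
  have := slope_rate x t01.
  have tt : r / 2 <= r <= r by lra.
  have := @slope_osc (x - r) x r r r r0 tt tt.
  have -> : `|x - r - x| = r by rewrite addrAC subrr sub0r normrN gtr0_norm.
  move=> /(_ (lexx _)); rewrite subrK.
  have -> : (f (x + t) - f x) / t = (f x - f (x - r)) / r by rewrite re; field; lra.
  move: ((f (x + r) - f x) / r) ((f x - f (x - r)) / r) => A A' h1 h2.
  have -> : A' - G x = (A' - A) + (A - G x) by ring.
  by apply: (le_trans (ler_normD _ _)); rewrite mulrDl addrC lerD.
rewrite gtr0_norm// in t01 *.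
by apply: (le_trans (slope_rate x t01)); rewrite ler_wpM2r ?powR_ge0// lerDl.
Qed.

Lemma powR_small (c e : R) : 0 < e -> exists2 de, 0 < de & forall t, 0 <= t < de -> c * t `^ al <= e.
Proof.
move=> e0; pose c' := `|c| + 1.
have c'0 : 0 < c' by rewrite ltr_wpDl.
exists ((e / c') `^ al^-1); first by rewrite powR_gt0// divr_gt0.
move=> t /andP[t0 tl]; apply: (@le_trans _ _ (c' * t `^ al)).
  by rewrite ler_wpM2r ?powR_ge0// /c' (le_trans (ler_norm _))// lerDl.
rewrite mulrC -ler_pdivlMr//.
have -> : e / c' = ((e / c') `^ al^-1) `^ al by rewrite -powRrM mulVf ?gt_eqF// powRr1// divr_ge0// ltW.
by rewrite ge0_ler_powR ?nnegrE ?powR_ge0// ltW.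
Qed.

Lemma morrey_is_derive (x : R) : is_derive x 1 f (G x).
Proof.
have cv : (fun h => h^-1 *: ((f \o shift x) (h *: 1) - f x)) @ 0^' --> G x.
  apply/cvgrPdist_le => e e0; have [de de0 hde] := powR_small (K + C) e0.
  near=> t.
  have t0 : t != 0 by near: t; exact: nbhs_dnbhs_neq.
  have tde : `|t| < Num.min de 1.
    near: t; apply: dnbhs0_lt; by rewrite lt_min de0 ltr01.
  move: tde; rewrite lt_min => /andP[td t1].
  rewrite distrC [_ *: 1]mulr1 /= [_ *: (_ - _)]mulrC (addrC t x).
  apply: (le_trans (slope_rate2 _ _)); first by rewrite normr_gt0 t0 ltW.
  by apply: hde; rewrite normr_ge0.
apply: DeriveDef; first by apply/cvg_ex; exists (G x).
exact/cvg_lim.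
Unshelve. all: by end_near. Qed.

Lemma morrey_continuous : continuous G.
Proof.
move=> x; apply/cvgrPdist_le => e e0.
have [de de0 hde] := powR_small (2 * K + C) e0.
near=> y.
have yx : `|x - y| < Num.min de 1.
  near: y; apply: cvgr_dist_lt; [exact: cvg_id|by rewrite lt_min de0 ltr01].
move: yx; rewrite lt_min => /andP[yd y1].
apply: (le_trans (morrey_hoelder_loc (ltW y1))).
by apply: hde; rewrite normr_ge0.
Unshelve. all: by end_near. Qed.

Lemma morrey_slope1 x : `|G x - (f (x + 1) - f x)| <= D.
Proof.
have [_ /(_ 0%N)] := dyadic_slope_cvg x.
by rewrite /dyadic_slope !expr0 mulr1 divr1 distrC.
Qed.

Lemma morrey_hoelder (B : R) : (forall x, `|G x| <= B) ->
  forall x y, `|G x - G y| <= (2 * K + C + 2 * B) * `|x - y| `^ al.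
Proof.
move=> GB x y; have B0 : 0 <= B := le_trans (normr_ge0 _) (GB 0).
have [xy|xy] := leP `|x - y| 1.
  apply: (le_trans (morrey_hoelder_loc xy)); rewrite ler_wpM2r ?powR_ge0// lerDl; lra.
apply: (@le_trans _ _ (2 * B)).
  by apply: (le_trans (ler_normB _ _)); have := GB x; have := GB y; lra.
rewrite -[leLHS]mulr1; apply: ler_pM => //; first lra.
  by rewrite lerDr addr_ge0// mulr_ge0.
have h : 1 `^ al <= `|x - y| `^ al by rewrite ge0_ler_powR ?nnegrE//; exact: ltW.
by rewrite powR1 in h.
Qed.

End Morrey.

(** * The continuous representative of the derivative *)

Section Representative.
Context {R : realType}.
Local Notation mu := (@lebesgue_measure R).

Lemma RI_segment_bound (p : R) (h : R -> R) (a : R) : 1 <= p -> inLp p h ->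
  RI (fun x => \1_(`[a, a + 1]) x * `|h x|) <= 1 + RI (fun x => `|h x| `^ p).
Proof.
move=> p1 hp; have p0 : 0 < p := lt_le_trans ltr01 p1.
have mh := inLp_measurable hp; have ii := L1_indic_segment a (a + 1); have mi := measurable_indic_itv `[a, a + 1].
have e1 : RI (\1_(`[a, a + 1]) : R -> R) = 1 by rewrite RI_indic; [ring|lra].
have ip := inLp_L1 p0 hp.
have iR := L1D ii ip.
have le x : \1_(`[a, a + 1]) x * `|h x| <= \1_`[a, (a + 1)] x + `|h x| `^ p.
  rewrite indic_itvE; have [_|_] := boolP (x \in `[a, a + 1]) => /=; last by rewrite mul0r add0r powR_ge0.
  by rewrite mul1r; exact: le1_powR.
have := RI_D ii ip; rewrite e1 => <-.
apply: RI_le => //; apply: L1_le iR; first by meas.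
by move=> x; rewrite ger0_norm// mulr_ge0// indic_ge0.
Qed.

Lemma inLp_locally_integrable (p : R) (h : R -> R) : 1 <= p -> inLp p h -> locally_integrable setT h.
Proof.
move=> p1 hp; have p0 : 0 < p := lt_le_trans ltr01 p1.
have mh := inLp_measurable hp; split => //; first exact: openT.
move=> K _ cK; have mK : measurable K by exact: compact_measurable.
have ip := inLp_L1 p0 hp.
apply: (@le_lt_trans _ _ (\int[mu]_(x in K) (1%:E + (`|h x| `^ p)%:E))%E).
  apply: ge0_le_integral => //.
  - by apply/measurable_funTS/measurable_EFinP; meas.
  - by apply/measurable_funTS/measurable_EFinP; meas.
  - by move=> x _; rewrite -EFinD lee_fin; exact: le1_powR.
rewrite ge0_integralD//; last first.
  by apply/measurable_funTS/measurable_EFinP; meas.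
rewrite integral_cst// mul1e lte_add_pinfty//; first exact: compact_finite_measure.
have h0 : (\int[mu]_x (`|h x| `^ p)%:E < +oo)%E.
  by move/L1_ge0P : ip; apply; [by meas|by move=> x; exact: powR_ge0].
apply: le_lt_trans h0; apply: ge0_subset_integral => //.
by apply/measurable_EFinP; meas.
Qed.

Lemma gagliardo_ae (p r : R) (u v : R -> R) : measurable_fun setT u -> measurable_fun setT v ->
  {ae mu, forall x, u x = v x} -> gagliardo_finite p r u -> gagliardo_finite p r v.
Proof.
move=> mu_ mv uv; rewrite /gagliardo_finite.
set I := (X in (X < _)%E -> _); set J := (X in _ -> (X < _)%E); suff -> : J = I by [].
rewrite {}/I {}/J; apply/esym.
have mF (w : R -> R) : measurable_fun setT w ->
    measurable_fun setT (fun z : R * R => `|w z.1 - w z.2| `^ p / `|z.1 - z.2| `^ (1 + r * p)).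
  move=> mw;   by meas.
have F0 (w : R -> R) (z : R * R) : 0 <= `|w z.1 - w z.2| `^ p / `|z.1 - z.2| `^ (1 + r * p).
  by rewrite divr_ge0// powR_ge0.
apply: ae_eq_integral => //.
- exact: (measurable_ge0_section_integral (mF u mu_) (F0 u)).
- exact: (measurable_ge0_section_integral (mF v mv) (F0 v)).
- apply: (ae_imp uv) => x ux _; apply: ae_eq_integral => //.
  + by apply/measurable_EFinP; exact: (measurable_section x (mF u mu_)).
  + by apply/measurable_EFinP; exact: (measurable_section x (mF v mv)).
  + by apply: (ae_imp uv) => y uy _; rewrite ux uy.
Qed.

(** Almost every x is a Lebesgue point of g. There the primitive based at x - 1 has derivative g x,
    and f differs from it by a constant near x. *)
Lemma primitive_is_derive_ae (p : R) (f g : R -> R) : 1 <= p -> inLp p g ->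
  (forall x, f x = f 0 + oint 0 x g) -> {ae mu, forall x : R, is_derive x 1 f (g x)}.
Proof.
move=> p1 gp fg; have /lebesgue_differentiation ld := inLp_locally_integrable p1 gp.
apply: (ae_imp ld) => x lx.
have xu : x < x + 1 by lra.
have ig : mu.-integrable `[x - 1, x + 1] (EFin \o g).
  apply: (@integrable_mkcond _ (measurableTypeR R) R mu _ (EFin \o g) _).2 => //.
  have := L1_seg p1 gp (x - 1) (x + 1); apply: eq_integrable => // y _.
  by rewrite /= patchE indicE; case: ifP => _; rewrite ?mul1r ?mul0r.
have ax : x - 1 < x by lra.
have [dF eF] := FTC1_lebesgue_pt xu ig ax lx.
pose F y := (\int[mu]_(t in [set` Interval (BLeft (x - 1)) (BRight y)]) (g t))%R.
have hF : is_derive x 1 F (g x) by rewrite derive1E in eF; exact: DeriveDef dF eF.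
have h2 : is_derive x 1 (fun y => F y + f (x - 1)) (g x).
  by rewrite -[g x]addr0; apply: is_deriveD.
apply: near_eq_is_derive h2.
near=> y.
have xy1 : `|x - y| < 1 by near: y; apply: cvgr_dist_lt; [exact: cvg_id|].
have xy : x - 1 <= y by move: xy1; rewrite ltr_norml => /andP[]; lra.
by rewrite -(subrK (f (x - 1)) (f y)) (increment_seg p1 gp fg xy) /seg RI_restrict.
Unshelve. all: by end_near. Qed.

Variables (p s : R) (f g : R -> R).
Hypothesis p12 : 1 < p <= 2.
Hypothesis sp : 1 + p^-1 < s < 2.
Hypothesis Wf : W_sp p s f g.

Let p0 : 0 < p. Proof. by case/andP : p12 => h _; exact: lt_trans ltr01 h. Qed.
Let p1 : 1 <= p. Proof. by case/andP : p12 => /ltW. Qed.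
Let gp : inLp p g. Proof. by case: Wf. Qed.
Let mg : measurable_fun setT g. Proof. exact: inLp_measurable gp. Qed.
Let fg : forall x, f x = f 0 + oint 0 x g. Proof. by case: Wf. Qed.

Lemma derivative_ae (G : R -> R) : (forall x : R, is_derive x 1 f (G x)) ->
  {ae mu, forall x, G x = g x}.
Proof.
move=> df; apply: (ae_imp (primitive_is_derive_ae p1 gp fg)) => x dg.
by rewrite -(@derive_val _ _ _ _ _ _ _ (df x)) (@derive_val _ _ _ _ _ _ _ dg).
Qed.

(** [campanato] applied to the increments of f yields the Morrey derivative G. It agrees almost
    everywhere with g, so f keeps its [W_sp] membership with G in place of g. *)
Lemma regular_representative : let al := s - 1 - p^-1 in exists G : R -> R, exists B, exists F0, exists H : R,
  [/\ forall x : R, is_derive x 1 f (G x), continuous G, forall x, `|G x| <= B,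
      forall x, `|f x| <= F0 & forall x y, `|G x - G y| <= H * `|x - y| `^ al] /\
  W_sp p s f G /\ {ae mu, forall x, G x = g x}.
Proof.
move=> al; have al0 : 0 < al := hoelder_exponent_gt0 sp.
pose C := campanato_const p s g.
have C0 : 0 <= C.
  rewrite /C /campanato_const addr_ge0// mulr_ge0// ?mulr_ge0 ?powR_ge0//.
  by apply: RI_ge0 => x; apply: RI_ge0 => y; exact: slope_kernel_ge0.
have osc (a b h h1 h2 : R) : 0 < h -> h / 2 <= h1 <= h -> h / 2 <= h2 <= h -> `|a - b| <= h ->
  `|(f (a + h1) - f a) / h1 - (f (b + h2) - f b) / h2| <= C * h `^ al.
  move=> h0 hh1 hh2 ab; have hp1 : 0 < h1 by case/andP: hh1; lra.
  have hp2 : 0 < h2 by case/andP: hh2; lra.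
  rewrite (increment_seg p1 gp fg (_ : a <= a + h1)) ?lerDl ?(ltW hp1)//.
  rewrite (increment_seg p1 gp fg (_ : b <= b + h2)) ?lerDl ?(ltW hp2)//.
  exact: (campanato p12 sp Wf).
pose G := morrey_derivative f; have df := morrey_is_derive al0 C0 osc.
have slope1 := morrey_slope1 al0 C0 osc.
set D := C / _ in slope1.
pose B := D + (1 + RI (fun x => `|g x| `^ p)).
have GB x : `|G x| <= B.
  have := slope1 x; rewrite -/G => h.
  have xx : x <= x + 1 by lra.
  have h2 : `|f (x + 1) - f x| <= 1 + RI (fun x => `|g x| `^ p).
    rewrite (increment_seg p1 gp fg xx); apply: le_trans (RI_segment_bound x p1 gp).
    apply: (le_trans (RI_abs (L1_seg p1 gp _ _))); rewrite le_eqVlt; apply/orP; left; apply/eqP.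
    by congr RI; apply/funext => y; rewrite normrM ger0_norm// indic_ge0.
  have := ler_normD (G x - (f (x + 1) - f x)) (f (x + 1) - f x).
  by rewrite subrK => h3; apply: (le_trans h3); exact: lerD.
have fp : inLp p f by case: Wf.
have lip := lipschitz_of_derive df GB.
(* f is Lipschitz with constant B, so |f x| exceeds the mean of |f| over [x, x + 1] by at most B. *)
have fB x : `|f x| <= 1 + RI (fun x => `|f x| `^ p) + B.
  have B0 : 0 <= B := le_trans (normr_ge0 _) (GB 0).
  have ii := L1_indic_segment x (x + 1); have mi := measurable_indic_itv `[x, x + 1].
  have mf := inLp_measurable fp.
  have i1 : L1 (fun y => \1_(`[x, x + 1]) y * `|f y|).
    have := L1abs (L1_seg p1 fp x (x + 1)); congr L1; apply/funext => y.
    by rewrite normrM ger0_norm// indic_ge0.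
  have e1 a : a = RI (fun y => a * \1_(`[x, x + 1]) y).
    by rewrite RI_Z// RI_indic; [ring|lra].
  have h := RI_segment_bound x p1 fp.
  apply: (@le_trans _ _ (RI (fun y => \1_(`[x, x + 1]) y * `|f y|) + B)); last by rewrite lerD2r.
  rewrite [X in _ <= _ + X]e1 [leLHS]e1 -RI_D//; last exact: L1Z.
  apply: RI_le; [exact: L1Z|by apply: L1D => //; exact: L1Z|move=> y].
  rewrite indic_itvE; have [|_] := boolP (y \in `[x, x + 1]) => /=; last by rewrite !mulr0 mul0r addr0.
  rewrite in_itv/= => /andP[y1 y2]; rewrite !mulr1 mul1r.
  have := lip x y; have := ler_normD (f x - f y) (f y); rewrite subrK => h1 h2.
  have h3 : `|x - y| <= 1 by rewrite ler_norml; apply/andP; split; lra.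
  nra.
exists G, B, (1 + RI (fun x => `|f x| `^ p) + B); eexists.
have ae := derivative_ae df.
have cG := morrey_continuous al0 C0 osc.
split; first by split => //; exact: (morrey_hoelder al0 C0 osc GB).
have mG : measurable_fun setT G by exact: continuous_measurable_fun.
have ae' : {ae mu, forall x, g x = G x} by apply: (ae_imp ae).
split=> //; split => //.
- exact: inLp_ae ae'.
- by apply: (gagliardo_ae mg mG ae'); case: Wf.
- move=> x; rewrite [LHS]fg; congr (_ + _); rewrite /oint -!RI_restrict.
  have m1 (i : interval R) := @measurable_indic_itv R i.
  have e a b : RI (fun x => \1_(`[a, b]) x * g x) = RI (fun x => \1_(`[a, b]) x * G x).
    have mi := m1 `[a, b]; apply: eq_ae_RI; [by meas|by meas|].
    by apply: (ae_imp ae') => y ->.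
  by rewrite !e.
Qed.

End Representative.

(** * Mapping properties of the singular integral *)

Section Kernel.
Context {R : realType}.
Local Notation mu := (@lebesgue_measure R).
Variables (p s : R) (f G : R -> R).
Hypothesis p12 : 1 < p <= 2.
Hypothesis sp : 1 + p^-1 < s < 2.
Hypothesis Wf : W_sp p s f G.

Let al := s - 1 - p^-1.

Let p0 : 0 < p. Proof. by case/andP : p12 => h _; exact: lt_trans ltr01 h. Qed.
Let p1 : 1 <= p. Proof. by case/andP : p12 => /ltW. Qed.
Let Gp : inLp p G. Proof. by case: Wf. Qed.
Let mG : measurable_fun setT G. Proof. exact: inLp_measurable Gp. Qed.
Let fG : forall x, f x = f 0 + oint 0 x G. Proof. by case: Wf. Qed.

(* al is independent of q: the Gagliardo exponent is 2 + al q. *)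
Lemma W_sp_interp (B F0 H q : R) : (forall x, `|G x| <= B) -> (forall x, `|f x| <= F0) ->
  (forall x y, `|G x - G y| <= H * `|x - y| `^ al) -> p <= q -> W_sp q (1 + al + q^-1) f G.
Proof.
move=> GB fB GH pq; have q0 : 0 < q := lt_le_trans p0 pq.
have H0 : 0 <= H.
  have := le_trans (normr_ge0 _) (GH 1 0); by rewrite subr0 normr1 powR1 mulr1.
have [fp _ gag _] := Wf.
split; [exact: inLp_bounded p0 pq fp fB|exact: inLp_bounded p0 pq Gp GB| |by []].
pose Kp (z : R * R) := slope_kernel p s G z.
pose Kq (z : R * R) := slope_kernel q (1 + al + q^-1) G z.
have mKp : measurable_fun setT Kp := measurable_slope_kernel Wf.
have mKq : measurable_fun setT Kq.
  by rewrite /Kq /slope_kernel; meas.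
have Kp0 z : 0 <= Kp z by exact: slope_kernel_ge0.
have Kq0 z : 0 <= Kq z by exact: slope_kernel_ge0.
pose c := H `^ (q - p).
have c0 : 0 <= c by exact: powR_ge0.
have le z : Kq z <= c * Kp z.
  rewrite /Kq /Kp /slope_kernel; case: z => x y /=.
  have [->|xy] := eqVneq x y.
    have q0' : q != 0 by rewrite gt_eqF.
    have p0' : p != 0 by rewrite gt_eqF.
    by rewrite (subrr (G y)) normr0 (powR0 q0') (powR0 p0') !mul0r mulr0.
  set D := `|G x - G y|; set t := `|x - y|.
  have t0 : 0 < t by rewrite normr_gt0 subr_eq0.
  have D0 : 0 <= D by exact: normr_ge0.
  (* The exponents of |x - y| for q and for p differ by al (q - p), which the Hoelder bound on |G x
     - G y|^(q - p) compensates. *)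
  have -> : 1 + (1 + al + q^-1 - 1) * q = (1 + (s - 1) * p) + al * (q - p).
    have hq : q^-1 * q = 1 by rewrite mulVf// gt_eqF.
    have hp : p^-1 * p = 1 by rewrite mulVf// gt_eqF.
    by rewrite (hoelder_exponentE s p12) -/al mulrBl !mulrDl hq; ring.
  rewrite (powRD (x := t)) ?(gt_eqF t0) ?implybT//.
  have -> : D `^ q = D `^ p * D `^ (q - p).
    rewrite -powRD; first by f_equal; ring.
    by rewrite addrCA subrr addr0 (gt_eqF q0).
  rewrite invfM mulrACA (mulrC c) ler_wpM2l// ?divr_ge0 ?powR_ge0//.
  rewrite ler_pdivrMr ?powR_gt0// /c powRrM -powRM ?powR_ge0//.
  by rewrite ge0_ler_powR ?nnegrE ?mulr_ge0 ?powR_ge0// ?subr_ge0//; exact: GH.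
have mle (x : R) : (\int[mu]_y (Kq (x, y))%:E <= c%:E * \int[mu]_y (Kp (x, y))%:E)%E.
  rewrite -ge0_integralZl_EFin//; last by apply/measurable_EFinP; exact: (measurable_section x mKp).
  - apply: ge0_le_integral => //.
    + by move=> y _; rewrite lee_fin.
    + by apply/measurable_EFinP; exact: (measurable_section x mKq).
    + by apply/measurable_EFinP; have := measurable_section x mKp => ?; meas.
    + by move=> y _; rewrite -EFinM lee_fin.
  - by move=> y _; rewrite lee_fin.
have msp := measurable_ge0_section_integral mKp Kp0.
have msq := measurable_ge0_section_integral mKq Kq0.
have sp0 x : (0 <= \int[mu]_y (Kp (x, y))%:E)%E by apply: integral_ge0 => y _; rewrite lee_fin.
have sq0 x : (0 <= \int[mu]_y (Kq (x, y))%:E)%E by apply: integral_ge0 => y _; rewrite lee_fin.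
rewrite /gagliardo_finite.
apply: (@le_lt_trans _ _ (\int[mu]_x (c%:E * \int[mu]_y (Kp (x, y))%:E))%E).
  apply: ge0_le_integral => //.
  - by move=> x _; exact: sq0.
  - by apply: measurable_funeM; exact: msp.
  - by move=> x _; exact: mle.
rewrite ge0_integralZl_EFin; first by apply: lte_mul_pinfty; [rewrite lee_fin|exact: fin_numE|exact: gag].
- exact: measurableT.
- by move=> x _; exact: sp0.
- exact: msp.
- exact: c0.
Qed.

Lemma slope_kernel_L1 : {ae mu, forall x, L1 (fun y => slope_kernel p s G (x, y))} /\
  L1 (fun x => RI (fun y => slope_kernel p s G (x, y))).
Proof.
apply: iterated_L1; [exact: (measurable_slope_kernel Wf)|exact: slope_kernel_ge0|].
by case: Wf.
Qed.

(** Density of the Gagliardo seminorm at x. It is integrable, so its p-th root, the coefficient in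
    [kerS_bound], lies in L_p. *)
Definition slope_energy x := RI (fun y => slope_kernel p s G (x, y)).

Lemma slope_energy_ge0 x : 0 <= slope_energy x.
Proof. by apply: RI_ge0 => y; exact: slope_kernel_ge0. Qed.

(** The dichotomy is integrated over the interval with a free threshold, and the threshold that
    equalises its two terms gives the factor 2. *)
Lemma tangent_avg (x b h : R) : L1 (fun y => slope_kernel p s G (x, y)) ->
  0 < h -> b <= x <= b + h ->
  `|seg b (b + h) G / h - G x| <= 2 * (slope_energy x `^ p^-1 * h `^ (s - 1)).
Proof.
move=> ik h0 /andP[bx xb].
have iJ := L1_indic_segment b (b + h); have mJ := measurable_indic_itv `[b, b + h].
have E0 := slope_energy_ge0 x.
have key (de : R) : 0 < de -> `|seg b (b + h) G / h - G x| <=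
    de + h `^ (1 + (s - 1) * p) / de `^ (p - 1) * slope_energy x / h.
  move=> de0; pose c := h `^ (1 + (s - 1) * p) / de `^ (p - 1).
  have c0 : 0 <= c by rewrite divr_ge0// powR_ge0.
  apply: (le_trans (avg_dev p12 Wf _ _ h0)); rewrite -/c.
  have -> : de + c * slope_energy x / h = h^-1 * (de * h + c * slope_energy x) by field; lra.
  rewrite ler_pM2l ?invr_gt0//.
  have -> : de * h + c * slope_energy x = RI (fun y => de * \1_(`[b, b + h]) y + c * slope_kernel p s G (x, y)).
    rewrite RI_D; [|exact: L1Z|exact: L1Z]; rewrite !RI_Z// RI_indic; last lra.
    by rewrite /slope_energy; congr (_ + _); congr (_ * _); ring.
  have iR : L1 (fun y => de * \1_(`[b, b + h]) y + c * slope_kernel p s G (x, y)) by apply: L1D; exact: L1Z.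
  have bd y : \1_(`[b, b + h]) y * `|G y - G x| <= de * \1_(`[b, b + h]) y + c * slope_kernel p s G (x, y).
    rewrite indic_itvE; have [|yJ] := boolP (y \in `[b, b + h]) => /=.
      rewrite in_itv/= => /andP[y1 y2]; rewrite mul1r mulr1 distrC.
      (* Both points lie in one interval of length h, so the dichotomy is applied with 2 (h / 2) as
         maximal distance. *)
      have h20 : 0 < h / 2 by lra.
      have := @slope_dichotomy _ p s G p12 sp (h / 2) de x y h20 de0.
      have -> : 2 * (h / 2) = h by field.
      apply; rewrite ler_norml; apply/andP; split; lra.
    by rewrite mul0r mulr0 add0r mulr_ge0// slope_kernel_ge0.
  apply: RI_le => //; apply: L1_le iR; first by meas.
  by move=> y; rewrite ger0_norm// mulr_ge0// indic_ge0.
(* With zero energy the optimal threshold would be 0, which is not admissible; arbitrarily small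
   thresholds are used instead. *)
move: E0; rewrite le_eqVlt => /predU1P[E0|E0].
  rewrite -E0 powR0 ?invr_eq0 ?gt_eqF// mul0r mulr0.
  apply/ler_addgt0Pr => e e0; rewrite add0r; have := key e e0.
  by rewrite -E0 mulr0 mul0r addr0.
set E := slope_energy x in E0 key *.
have d0 : 0 < E `^ p^-1 * h `^ (s - 1) by rewrite mulr_gt0// powR_gt0.
apply: (le_trans (key _ d0)); rewrite [leRHS]mulr_natl mulr2n lerD2l.
rewrite powRM ?powR_ge0// -!powRrM.
have e1 : h `^ (1 + (s - 1) * p) = h `^ ((s - 1) * (p - 1)) * h * h `^ (s - 1).
  rewrite -[X in _ * X * _](powRr1 (ltW h0)) -!powRD ?(gt_eqF h0) ?implybT//.
  by f_equal; ring.
have e2 : E `^ (p^-1 * (p - 1)) * E `^ p^-1 = E.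
  rewrite -powRD ?(gt_eqF E0) ?implybT//; have -> : p^-1 * (p - 1) + p^-1 = 1 by field; rewrite gt_eqF.
  by rewrite powRr1// ltW.
rewrite e1 -{2}e2 le_eqVlt; apply/orP; left; apply/eqP; field.
by rewrite !gt_eqF ?powR_gt0.
Qed.

(** Up to sign the numerator is (x - y) times the gap between G x and the mean of G between x and y.
    The coefficient depending on x buys the exponent s - 2, better by 1/p than the exponent al - 1
    given by Hoelder continuity. *)
Lemma kerS_bound (x y : R) : L1 (fun y => slope_kernel p s G (x, y)) ->
  `|kerS f G x y| <= 2 * slope_energy x `^ p^-1 * `|x - y| `^ (s - 2).
Proof.
move=> ik; have [->|xy] := eqVneq x y.
  by rewrite /kerS !subrr mul0r subrr mul0r normr0 !mulr_ge0 ?powR_ge0.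
set t := `|x - y|; have t0 : 0 < t by rewrite normr_gt0 subr_eq0.
have E0 := slope_energy_ge0 x.
have num : `|(x - y) * G x - (f x - f y)| <= 2 * (slope_energy x `^ p^-1 * t `^ (s - 1)) * t.
  have [lt|lt|e] := ltgtP y x; last by rewrite e eqxx in xy.
  - have te : t = x - y by rewrite /t gtr0_norm// subr_gt0.
    have := @tangent_avg x y t ik t0; rewrite te (addrC y) subrK lexx (ltW lt) => /(_ isT).
    rewrite -(increment_seg p1 Gp fG (ltW lt)) -te => h.
    have -> : t * G x - (f x - f y) = - ((f x - f y) / t - G x) * t by field; rewrite gt_eqF.
    by rewrite normrM normrN (gtr0_norm t0) ler_pM2r.
  - have te : t = y - x by rewrite /t distrC gtr0_norm// subr_gt0.
    have := @tangent_avg x x t ik t0; rewrite te (addrC x) subrK lexx (ltW lt) => /(_ isT).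
    rewrite -(increment_seg p1 Gp fG (ltW lt)) -te => h.
    have -> : (x - y) * G x - (f x - f y) = ((f y - f x) / t - G x) * t.
      have -> : x - y = - t by rewrite te opprB.
      by field; rewrite gt_eqF.
    by rewrite normrM (gtr0_norm t0) ler_pM2r.
rewrite /kerS normrM normfV.
have den : t ^+ 2 <= `|(x - y) ^+ 2 + (f x - f y) ^+ 2|.
  by rewrite ger0_norm ?addr_ge0 ?sqr_ge0// /t real_normK ?num_real// lerDl sqr_ge0.
have den0 : 0 < `|(x - y) ^+ 2 + (f x - f y) ^+ 2| by apply: lt_le_trans den; rewrite exprn_gt0.
rewrite ler_pdivrMr//; apply: (le_trans num).
apply: (@le_trans _ _ (2 * slope_energy x `^ p^-1 * t `^ (s - 2) * t ^+ 2)); last first.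
  by rewrite ler_wpM2l// !mulr_ge0 ?powR_ge0.
have -> : t `^ (s - 1) = t `^ (s - 2) * t.
  rewrite -[X in _ * X](powRr1 (ltW t0)) -powRD ?(gt_eqF t0) ?implybT//; by f_equal; ring.
by rewrite le_eqVlt; apply/orP; left; apply/eqP; ring.
Qed.

Lemma kerS_far (x y : R) : `|kerS f G x y| <= `|G x| * `|x - y|^-1 + (`|f x| + `|f y|) * ((x - y) ^+ 2)^-1.
Proof.
have [->|xy] := eqVneq x y.
  by rewrite /kerS !subrr mul0r subrr mul0r !normr0 invr0 expr0n invr0 !mulr0 addr0.
have h0 : 0 < (x - y) ^+ 2 by rewrite exprn_even_gt0// subr_eq0.
have den : (x - y) ^+ 2 <= `|(x - y) ^+ 2 + (f x - f y) ^+ 2|.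
  by rewrite ger0_norm ?addr_ge0 ?sqr_ge0// lerDl sqr_ge0.
have t0 : 0 < `|x - y| by rewrite normr_gt0 subr_eq0.
rewrite /kerS normrM normfV.
apply: (@le_trans _ _ (`|(x - y) * G x - (f x - f y)| / (x - y) ^+ 2)).
  by rewrite ler_wpM2l// lef_pV2 ?posrE//; exact: lt_le_trans den.
have -> : `|G x| * `|x - y|^-1 = `|x - y| * `|G x| / (x - y) ^+ 2.
  rewrite -[(x - y) ^+ 2]real_normK ?num_real//; field; by rewrite gt_eqF.
rewrite -mulrDl ler_pM2r ?invr_gt0//; apply: (le_trans (ler_normB _ _)).
by rewrite normrM lerD2l ler_normB.
Qed.

End Kernel.

(** * Near and far parts of the kernel as convolution profiles *)

Section Convolution.
Context {R : realType}.
Local Notation mu := (@lebesgue_measure R).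
Implicit Types (u v w h k : R -> R) (q : R).

Lemma inLp_dom_ae q h w : 0 < q -> measurable_fun setT h -> inLp q w ->
  {ae mu, forall x, `|h x| <= w x} -> inLp q h /\ nrm q h <= nrm q w.
Proof.
move=> q0 mh hw hle; have mw := inLp_measurable hw.
pose w' x := Num.max `|h x| `|w x|.
have mw' : measurable_fun setT w' by apply: measurable_maxr; meas.
have ww' : {ae mu, forall x, `|w x| = w' x}.
  by apply: (ae_imp hle) => x hx; rewrite /w' max_r// (le_trans hx)// ler_norm.
have hw1 := inLpabs q0 hw; have hw' := inLp_ae q0 mw' hw1 ww'.
have hh x : `|h x| <= `|w' x| by rewrite (le_trans _ (ler_norm _))// /w' le_max lexx.
have ih := inLp_le q0 mh hw' hh.
split => //; apply: (le_trans (nrm_le q0 ih hw' hh)).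
by rewrite -(nrm_ae q0 hw1 hw' ww') nrmabs.
Qed.

Lemma inLp_reflect q k (x : R) : 0 < q -> inLp q k -> inLp q (fun y => k (x - y)) /\
  nrm q (fun y => k (x - y)) = nrm q k.
Proof.
move=> q0 hk; have mk := inLp_measurable hk; have ik := inLp_L1 q0 hk.
have h : inLp q (fun y => k (x - y)).
  by apply/inLpP => //; split; [meas|exact: (L1_reflect x ik)].
split=> //; rewrite (nrmE q0 h) (nrmE q0 hk).
by rewrite (RI_reflect x (L1_measurable ik)).
Qed.

Lemma RI_shift (y : R) k : L1 k -> L1 (fun x => k (x - y)) /\ RI (fun x => k (x - y)) = RI k.
Proof.
move=> ik; have ik' := L1_reflect 0 ik; have ik2 := L1_reflect y ik'.
have e : (fun x => k (0 - (y - x))) = (fun x => k (x - y)) by apply/funext => x; f_equal; ring.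
rewrite e in ik2; split => //; rewrite -e (RI_reflect y (L1_measurable ik')).
exact: (RI_reflect 0 (L1_measurable ik)).
Qed.

Lemma measurable_conv k w : measurable_fun setT k -> measurable_fun setT w ->
  measurable_fun setT (fun z : R * R => k (z.1 - z.2) * w z.2).
Proof.
move=> mk mw; by meas.
Qed.

(* Interpolation between the L_oo and the L_1 bound of the convolution. *)
Lemma conv_L1 q k w : 1 <= q -> L1 k -> (forall t, 0 <= k t <= 1) -> L1 w -> (forall t, 0 <= w t) ->
  let v := fun x => RI (fun y => k (x - y) * w y) in
  [/\ forall x, L1 (fun y => k (x - y) * w y), inLp q v & nrm q v <= RI k `^ q^-1 * RI w].
Proof.
move=> q1 ik k01 iw w0 v; have q0 : 0 < q := lt_le_trans ltr01 q1.
have mk := L1_measurable ik; have mw := L1_measurable iw.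
have mF := measurable_conv mk mw.
have sec x : L1 (fun y => k (x - y) * w y).
  apply: L1_le iw; first by meas.
  move=> y; have /andP[k0 k1] := k01 (x - y).
  by rewrite ger0_norm ?mulr_ge0// ler_piMl.
have mv : measurable_fun setT v by exact: (measurable_section_RI mF).
have v0 x : 0 <= v x by apply: RI_ge0 => y; rewrite mulr_ge0//; case/andP: (k01 (x - y)).
have vle x : v x <= RI w.
  apply: RI_le => // y; have /andP[k0 k1] := k01 (x - y).
  by rewrite ler_piMl.
have N0 : 0 <= RI w by exact: RI_ge0.
have K0 : 0 <= RI k by apply: RI_ge0 => t; case/andP: (k01 t).
have ev : (\int[mu]_x (v x)%:E = (RI k * RI w)%:E)%E.
  transitivity (\int[mu]_x \int[mu]_y (k (x - y) * w y)%:E)%E.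
    by apply: eq_integral => x _; rewrite RI_EFin.
  rewrite (tonelli mF) /=; last first.
    by move=> [x y] /=; rewrite mulr_ge0//; case/andP: (k01 (x - y)).
  transitivity (\int[mu]_y (RI k * w y)%:E)%E; last first.
    by rewrite RI_EFin; [rewrite RI_Z|exact: L1Z].
  apply: eq_integral => y _; have [i1 e1] := RI_shift y ik.
  have i2 : L1 (fun x => k (x - y) * w y).
    by have := L1Z (w y) i1; congr L1; apply/funext => x; rewrite mulrC.
  rewrite RI_EFin//; congr EFin; rewrite -e1 mulrC -RI_Z//; congr RI.
  by apply/funext => x; rewrite mulrC.
have iv : L1 v by apply/(L1_ge0P mv v0); rewrite ev ltry.
have eV : RI v = RI k * RI w by have := RI_EFin iv; rewrite ev => -[].
have vq x : `|v x| `^ q <= RI w `^ (q - 1) * v x.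
  rewrite ger0_norm//; have -> : v x `^ q = v x `^ (q - 1) * v x.
    have [->|nz] := eqVneq (v x) 0; first by rewrite powR0 ?gt_eqF// mulr0.
    rewrite -[X in _ * X](powRr1 (v0 x)) -powRD ?nz ?implybT//; by f_equal; ring.
  have qm : 0 <= q - 1 by lra.
  exact: ler_wpM2r (ge0_ler_powR qm (v0 x) N0 (vle x)).
have ib : L1 (fun x => RI w `^ (q - 1) * v x) by exact: L1Z.
have iq : L1 (fun x => `|v x| `^ q).
  by apply: L1_le ib => [|x]; [exact: measurable_fun_powR (measurable_fun_abs mv)|rewrite (ger0_norm (powR_ge0 _ _))].
have hv : inLp q v by apply/inLpP.
split => //; rewrite nrmE//.
apply: (@le_trans _ _ ((RI k * RI w `^ q) `^ q^-1)).
  rewrite ge0_ler_powR ?nnegrE ?invr_ge0 ?(ltW q0)//.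
  - by apply: RI_ge0 => x; exact: powR_ge0.
  - by rewrite mulr_ge0// powR_ge0.
  apply: (le_trans (RI_le iq ib vq)); rewrite RI_Z// eV mulrCA ler_wpM2l//.
  have [->|nz] := eqVneq (RI w) 0; first by rewrite mulr0 powR_ge0.
  rewrite -[X in _ * X](powRr1 N0) -powRD ?nz ?implybT//.
  by rewrite subrK.
by rewrite powRM ?powR_ge0// -powRrM mulfV ?gt_eqF// powRr1.
Qed.

(** The three profiles in the majorant of [kerS]: a power on the unit window, and outside it 1/|t|
    with a coefficient depending on x only, and 1/t^2 for the term containing f at the integration
    variable. *)
Definition near_kernel (a t : R) : R := unit_cut t * `|t| `^ a.
Definition far_kernel (t : R) : R := (1 - unit_cut t) * `|t|^-1.
Definition far_kernel2 (t : R) : R := (1 - unit_cut t) * (t ^+ 2)^-1.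

Lemma unit_cut_cases (t : R) : (unit_cut t = 1 /\ `|t| < 1) \/ (unit_cut t = 0 /\ 1 <= `|t|).
Proof. by rewrite /unit_cut; case: ltP => h; [left|right]. Qed.

Lemma near_kernel_inLp q (a : R) : 0 < q -> -1 < a * q -> inLp q (near_kernel a).
Proof.
move=> q0 aq; have mc := @measurable_unit_cut R; apply/inLpP => //; split; first by rewrite /near_kernel; meas.
have b0 : 0 < a * q + 1 by lra.
have := L1_near b0; congr L1; apply/funext => t; rewrite addrK /near_kernel.
have [[-> _]|[-> _]] := unit_cut_cases t; last by rewrite !mul0r normr0 powR0// gt_eqF.
by rewrite mul1r [1 * _]mul1r powRrM (ger0_norm (powR_ge0 _ _)).
Qed.

(** For |t| >= 1 and q >= 2 one has |t|^(-q) <= t^(-2). It is applied to conjugate exponents, which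
    are at least 2 when the original exponents are at most 2. *)
Lemma far_kernel_inLp q : 2 <= q -> inLp q far_kernel.
Proof.
move=> q2; have q0 : 0 < q by lra.
have mc := @measurable_unit_cut R; have mid : measurable_fun setT (fun t : R => t) by [].
have mk : measurable_fun setT far_kernel by rewrite /far_kernel; meas.
apply/inLpP => //; split => //.
apply: L1_le L1_far; first by meas.
move=> t; rewrite ger0_norm ?powR_ge0// /far_kernel.
have [[-> _]|[-> t1]] := unit_cut_cases t.
  by rewrite subrr !mul0r normr0 powR0// gt_eqF.
rewrite subr0 !mul1r; have t0 : 0 < `|t| by lra.
have e : `|t|^-1 = `|t| `^ (- 1) by rewrite powR_inv1.
rewrite e (ger0_norm (powR_ge0 _ _)) -powRrM mulN1r powRN.
rewrite lef_pV2 ?posrE ?powR_gt0//; last by rewrite exprn_even_gt0//= -normr_gt0.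
rewrite -[t ^+ 2]real_normK ?num_real// -powR_mulrn//.
by rewrite ler_powR.
Qed.

Lemma far_kernel2_L1 : L1 far_kernel2.
Proof. exact: L1_far. Qed.

Lemma far_kernel2_bounds (t : R) : 0 <= far_kernel2 t <= 1 /\ far_kernel2 t <= far_kernel t.
Proof.
rewrite /far_kernel2 /far_kernel; have [[-> _]|[-> t1]] := unit_cut_cases t.
  by rewrite subrr !mul0r !lexx ler01.
rewrite subr0 !mul1r; have t0 : 0 < `|t| by lra.
have h : (t ^+ 2)^-1 <= `|t|^-1.
  rewrite lef_pV2 ?posrE//; last by rewrite exprn_even_gt0//= -normr_gt0.
  by rewrite -[t ^+ 2]real_normK ?num_real// expr2 ler_peMr// ltW.
split => //; apply/andP; split; first by rewrite invr_ge0 sqr_ge0.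
by apply: (le_trans h); rewrite invf_le1.
Qed.

End Convolution.

(** * Boundedness of A(f) from L_q1 to L_q2 *)

Section Bounded.
Context {R : realType}.
Local Notation mu := (@lebesgue_measure R).
Variables (q1 q1' q2 s : R) (f G : R -> R).
Hypothesis q212 : 1 < q2 <= 2.
Hypothesis sq2 : 1 + q2^-1 < s < 2.
Hypothesis Wf : W_sp q2 s f G.
Hypothesis q10 : 0 < q1.
Hypothesis q1'2 : 2 <= q1'.
Hypothesis conj : q1^-1 + q1'^-1 = 1.
Hypothesis fq1' : inLp q1' f.
Hypothesis near_exp : -1 < (s - 2) * q1'.

Let q20 : 0 < q2. Proof. by case/andP : q212 => h _; exact: lt_trans ltr01 h. Qed.
Let q21 : 1 <= q2. Proof. by case/andP : q212 => /ltW. Qed.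
Let q1'0 : 0 < q1'. Proof. by exact: lt_le_trans q1'2. Qed.
Let mG : measurable_fun setT G. Proof. by case: Wf => _ [] + _ _ _; apply. Qed.
Let mf : measurable_fun setT f. Proof. by case: Wf => -[] + _ _ _ _; apply. Qed.

Lemma measurable_kerS : measurable_fun setT (fun z : R * R => kerS f G z.1 z.2).
Proof.
by rewrite /kerS; meas.
Qed.

Lemma measurable_opA u : measurable_fun setT u -> measurable_fun setT (opA f G u).
Proof.
move=> mu_; have mF : measurable_fun setT (fun z : R * R => kerS f G z.1 z.2 * u z.2).
  by have := measurable_kerS => ?; meas.
have := measurable_section_RI mF => /= h.
by rewrite /opA; apply: measurable_funM.
Qed.

Let E x := slope_energy q2 s G x `^ q2^-1.
Let c1 := nrm q1' (near_kernel (s - 2)).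
Let c2 : R := nrm q1' far_kernel.

Let E_inLp : inLp q2 E.
Proof.
have [_ iE] := slope_kernel_L1 Wf.
have mE := L1_measurable iE.
apply/inLpP => //; split; first by rewrite /E /slope_energy; meas.
move: iE; congr L1; apply/funext => x.
rewrite /E ger0_norm ?powR_ge0// -powRrM mulVf ?gt_eqF// powRr1//.
exact: slope_energy_ge0.
Qed.

(** Hoelder's inequality pairs u with the near profile (in L_q1' by [near_exp]) and with 1/|t| at
    infinity; the term with f y is a convolution of the integrable f u. All other dependence on x
    sits in E, G and f, which are in L_q2. *)
Lemma opA_pointwise u x : inLp q1 u -> L1 (fun y => slope_kernel q2 s G (x, y)) ->
  L1 (fun y => kerS f G x y * u y) /\
  `|RI (fun y => kerS f G x y * u y)| <=
     (2 * c1 * E x + c2 * (`|G x| + `|f x|)) * nrm q1 u +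
     RI (fun y => far_kernel2 (x - y) * `|f y * u y|).
Proof.
move=> hu ik; have mu_ := inLp_measurable hu.
have hau := inLpabs q10 hu.
have [hk1 ek1] := inLp_reflect x q1'0 (near_kernel_inLp q1'0 near_exp).
have [hk2 ek2] := inLp_reflect x q1'0 (far_kernel_inLp q1'2).
have conj' : q1'^-1 + q1^-1 = 1 by rewrite addrC.
have [i1 n1] := hoelder_inLp q1'0 q10 conj' hk1 hau.
have [i2 n2] := hoelder_inLp q1'0 q10 conj' hk2 hau.
have [ifu _] := hoelder_inLp q1'0 q10 conj' fq1' hu.
have [i3 _ _] := conv_L1 q21 far_kernel2_L1 (fun t => (far_kernel2_bounds t).1) (L1abs ifu) (fun t => normr_ge0 _).
pose g y := 2 * E x * (near_kernel (s - 2) (x - y) * `|u y|) +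
   (`|G x| + `|f x|) * (far_kernel (x - y) * `|u y|) + far_kernel2 (x - y) * `|f y * u y|.
have nk0 t : 0 <= near_kernel (s - 2) t by rewrite /near_kernel mulr_ge0 ?unit_cut_ge0// powR_ge0.
have fk0 t : 0 <= far_kernel t :> R.
  by rewrite /far_kernel mulr_ge0 ?invr_ge0// subr_ge0 unit_cut_le1.
have E0 : 0 <= E x by exact: powR_ge0.
have ig : L1 g by apply: L1D => //; apply: L1D; exact: L1Z.
have mk : measurable_fun setT (fun y => kerS f G x y).
  have := measurable_kerS; exact: (measurable_section x).
have dom y : `|kerS f G x y * u y| <= g y.
  have -> : g y = (2 * E x * near_kernel (s - 2) (x - y) +
      (`|G x| + `|f x|) * far_kernel (x - y) + far_kernel2 (x - y) * `|f y|) * `|u y|.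
    by rewrite /g (normrM (f y)); ring.
  rewrite normrM ler_wpM2r//.
  have [[e t1]|[e t1]] := unit_cut_cases (x - y).
    apply: (le_trans (kerS_bound q212 sq2 Wf y ik)).
    by rewrite /near_kernel /far_kernel /far_kernel2 e subrr !mul0r mulr0 !addr0 mul1r.
  apply: (le_trans (kerS_far f G x y)).
  have [_ h] := far_kernel2_bounds (x - y).
  rewrite /near_kernel e mul0r mulr0 add0r.
  move: h; rewrite /far_kernel2 /far_kernel e subr0 !mul1r => h.
  rewrite [in leRHS]mulrDl mulrDl -addrA lerD2l mulrC [X in _ <= _ + X]mulrC lerD2r.
  by rewrite mulrC ler_wpM2l.
have iL : L1 (fun y => kerS f G x y * u y) by apply: L1_le ig => //; meas.
split => //; apply: (le_trans (RI_abs iL)).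
apply: (@le_trans _ _ (RI g)); first by apply: RI_le => //; exact: L1abs.
rewrite /g RI_D//; last by apply: L1D; exact: L1Z.
rewrite lerD2r RI_D; [|exact: L1Z|exact: L1Z]; rewrite !RI_Z//.
have e1 : RI (fun y => near_kernel (s - 2) (x - y) * `|u y|) <= c1 * nrm q1 u.
  rewrite -(nrmabs q10 hu) /c1 -ek1; apply: le_trans n1; rewrite le_eqVlt; apply/orP; left; apply/eqP.
  by congr RI; apply/funext => y; rewrite [RHS]ger0_norm// mulr_ge0.
have e2 : RI (fun y => far_kernel (x - y) * `|u y|) <= c2 * nrm q1 u.
  rewrite -(nrmabs q10 hu) /c2 -ek2; apply: le_trans n2; rewrite le_eqVlt; apply/orP; left; apply/eqP.
  by congr RI; apply/funext => y; rewrite [RHS]ger0_norm// mulr_ge0.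
rewrite [leRHS]mulrDl; apply: lerD.
  have -> : 2 * c1 * E x * nrm q1 u = 2 * E x * (c1 * nrm q1 u) by ring.
  by rewrite ler_wpM2l// mulr_ge0.
have -> : c2 * (`|G x| + `|f x|) * nrm q1 u = (`|G x| + `|f x|) * (c2 * nrm q1 u) by ring.
by rewrite ler_wpM2l// addr_ge0.
Qed.

Lemma opA_bounded_core : exists2 C, 0 <= C & forall u, inLp q1 u ->
  [/\ {ae mu, forall x, L1 (fun y => kerS f G x y * u y)}, inLp q2 (opA f G u) &
      nrm q2 (opA f G u) <= C * nrm q1 u].
Proof.
have [ik _] := slope_kernel_L1 Wf.
have [fq2 Gq2 _ _] := Wf.
pose Phi x := 2 * c1 * E x + c2 * (`|G x| + `|f x|).
have hGf : inLp q2 (fun x => `|G x| + `|f x|) by apply: inLpD => //; exact: inLpabs.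
have hPhi : inLp q2 Phi by apply: inLpD => //; exact: inLpZ.
have K0 : 0 <= RI far_kernel2 :> R by apply: RI_ge0 => t; have [/andP[]] := far_kernel2_bounds t.
exists (pi^-1 * (nrm q2 Phi + RI far_kernel2 `^ q2^-1 * nrm q1' f)).
  by rewrite mulr_ge0 ?invr_ge0 ?pi_ge0// addr_ge0 ?nrm_ge0// mulr_ge0 ?powR_ge0 ?nrm_ge0.
move=> u hu; have mu_ := inLp_measurable hu.
have conj' : q1'^-1 + q1^-1 = 1 by rewrite addrC.
have [ifu nfu] := hoelder_inLp q1'0 q10 conj' fq1' hu.
have [i3 hv nv] := conv_L1 q21 far_kernel2_L1 (fun t => (far_kernel2_bounds t).1) (L1abs ifu) (fun t => normr_ge0 _).
set v := (fun x => RI (fun y => far_kernel2 (x - y) * `|f y * u y|)) in hv nv.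
pose W x := pi^-1 * (nrm q1 u * Phi x + v x).
have hZ : inLp q2 (fun x => nrm q1 u * Phi x) by exact: inLpZ.
have hW1 : inLp q2 (fun x => nrm q1 u * Phi x + v x) by exact: inLpD.
have hW : inLp q2 W by exact: inLpZ.
have pi0 : 0 < pi^-1 :> R by rewrite invr_gt0 pi_gt0.
have dom : {ae mu, forall x, `|opA f G u x| <= W x}.
  apply: (ae_imp ik) => x ikx; have [_ h] := opA_pointwise hu ikx.
  rewrite /opA normrM (gtr0_norm pi0) /W ler_pM2l//.
  by apply: (le_trans h); rewrite lerD2r mulrC.
have [h1 h2] := inLp_dom_ae q20 (measurable_opA mu_) hW dom.
split=> //; first by apply: (ae_imp ik) => x ikx; have [] := opA_pointwise hu ikx.
apply: (le_trans h2); rewrite nrmZ// (gtr0_norm pi0) -mulrA ler_pM2l// mulrDl.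
apply: (le_trans (nrmD q21 hZ hv)); apply: lerD.
  by rewrite nrmZ// ger0_norm ?nrm_ge0// mulrC.
apply: (le_trans nv); rewrite -mulrA ler_wpM2l ?powR_ge0//.
Qed.

End Bounded.

Section BoundedInterp.
Context {R : realType}.
Local Notation mu := (@lebesgue_measure R).
Variables (p s : R) (f G : R -> R) (B F0 H : R).
Hypothesis p12 : 1 < p <= 2.
Hypothesis sp : 1 + p^-1 < s < 2.
Hypothesis Wf : W_sp p s f G.
Local Notation al := (s - 1 - p^-1).
Hypothesis GB : forall x, `|G x| <= B.
Hypothesis fB : forall x, `|f x| <= F0.
Hypothesis GH : forall x y, `|G x - G y| <= H * `|x - y| `^ al.

(** [W_sp_interp] trades p for q2 with smoothness 1 + al + 1/q2. Local integrability of the near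
    profile, (al + 1/q2 - 1) q1' > -1, is then exactly 1/q1 - 1/q2 < al. *)
Theorem opA_bounded (q1 q2 : R) : p <= q1 <= 2 -> p <= q2 <= 2 -> q1^-1 - q2^-1 < al ->
  exists2 C, 0 <= C & forall u, inLp q1 u ->
  [/\ {ae mu, forall x, L1 (fun y => kerS f G x y * u y)}, inLp q2 (opA f G u) &
      nrm q2 (opA f G u) <= C * nrm q1 u].
Proof.
move=> /andP[pq1 q12] /andP[pq2 q22] h.
have /andP[p1 p2] := p12; have /andP[sp1 sp2] := sp.
have p0 : 0 < p by lra.
have q10 : 0 < q1 by lra.
have q20 : 0 < q2 by lra.
have al0 : 0 < al by lra.
have inv2 (a b : R) : 0 < a -> a <= b -> b^-1 <= a^-1.
  by move=> a0 ab; rewrite lef_pV2 ?posrE//; exact: lt_le_trans ab.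
have i1 := inv2 _ _ q10 q12; have i2 := inv2 _ _ p0 pq2.
have i3 : q1^-1 < 1 by rewrite invf_lt1//; lra.
pose q1' := (1 - q1^-1)^-1.
have d0 : 0 < 1 - q1^-1 by lra.
have q1'2 : 2 <= q1'.
  have e : (2 : R) = (2^-1)^-1 by rewrite invrK.
  by rewrite {1}e; apply: inv2 => //; lra.
have q1'0 : 0 < q1' by lra.
have i0 : 0 < q2^-1 by rewrite invr_gt0.
apply: (@opA_bounded_core R q1 q1' q2 (1 + al + q2^-1) f G).
- by apply/andP; split; lra.
- by apply/andP; split; lra.
- exact: W_sp_interp GB fB GH pq2.
- exact: q10.
- exact: q1'2.
- by rewrite /q1' invrK; ring.
- apply: (inLp_bounded p0 _ _ fB); [lra|by case: Wf].
- rewrite /q1' ltr_pdivlMr//; lra.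
Qed.

End BoundedInterp.

(** * Density of Lipschitz functions *)

Section Density.
Context {R : realType}.
Local Notation mu := (@lebesgue_measure R).
Implicit Types (u v w : R -> R) (q : R).

(** Regular enough for the jump relations, and contained in the continuous functions of compact
    support, on which the principal value prescribes the operator. *)
Definition lipschitz_cpt u := [/\ measurable_fun setT u,
  exists2 M : R, 0 <= M & forall x, M < `|x| -> u x = 0,
  exists L : R, forall x y, `|u y - u x| <= L * `|x - y| &
  exists U : R, forall x, `|u x| <= U].

Lemma cvg_norm_powR (a : nat -> R) (l r : R) : 0 < r -> a n @[n --> \oo] --> l ->
  `|a n| `^ r @[n --> \oo] --> `|l| `^ r.
Proof.
move=> r0 al; have [l0|l0] := eqVneq l 0; last first.
  have dl : 0 < `|l| by rewrite normr_gt0.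
  have [dr _] := is_derive1_powR r dl.
  exact: (continuous_cvg _ (derivable_continuous1 dr) (cvg_norm al)).
rewrite l0 normr0 powR0 ?gt_eqF// in al *.
apply/cvgrPdist_le => e e0; have [de de0 hde] := powR_small r0 1 e0.
near=> n; rewrite sub0r normrN ger0_norm ?powR_ge0// -[leLHS]mul1r; apply: hde.
rewrite normr_ge0 /=; near: n; have /cvgrPdist_lt/(_ de de0) := al.
by apply: filterS => n; rewrite sub0r normrN.
Unshelve. all: by end_near. Qed.

Lemma nrm_dct q (F : nat -> R -> R) w : 1 <= q -> (forall n, measurable_fun setT (F n)) ->
  {ae mu, forall x, F n x @[n --> \oo] --> (0 : R)} -> (forall n x, `|F n x| <= w x) -> inLp q w ->
  (forall n, inLp q (F n)) /\ nrm q (F n) @[n --> \oo] --> (0 : R).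
Proof.
move=> q1 mF F0 Fw hw; have q0 : 0 < q := lt_le_trans ltr01 q1.
have hF n : inLp q (F n).
  by apply: (inLp_le q0 (mF n) hw) => x; rewrite (le_trans (Fw n x))// ler_norm.
split => //.
have powq0 (a : nat -> R) (r : R) : 0 < r -> a n @[n --> \oo] --> (0 : R) -> `|a n| `^ r @[n --> \oo] --> (0 : R).
  move=> r0 /(cvg_norm_powR r0); by rewrite normr0 powR0 ?gt_eqF.
have [_ cv] : L1 (fun _ : R => 0 : R) /\ RI (fun x => `|F n x| `^ q) @[n --> \oo] --> RI (fun _ : R => 0 : R).
  apply: (RI_dct (g := fun x => `|w x| `^ q)).
  - by move=> n; have := mF n => ?; meas.
  - exact: measurable_cst.
  - by apply: (ae_imp F0) => x; exact: powq0.
  - move=> n x; rewrite (ger0_norm (powR_ge0 _ _)) ge0_ler_powR ?nnegrE// ?(ltW q0)//.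
    by rewrite (le_trans (Fw n x))// ler_norm.
  - exact: inLp_L1.
rewrite RI_0 in cv.
have qi0 : 0 < q^-1 by rewrite invr_gt0.
rewrite (_ : (fun n => nrm q (F n)) = (fun n => `|RI (fun x => `|F n x| `^ q)| `^ q^-1)).
  exact: powq0.
apply/funext => n; by rewrite nrmE// ger0_norm//; apply: RI_ge0 => x; exact: powR_ge0.
Qed.

Lemma seg_bound (U a b : R) v : measurable_fun setT v -> (forall x, `|v x| <= U) -> a <= b ->
  `|seg a b v| <= U * (b - a).
Proof.
move=> mv vU ab; have ii := L1_indic_segment a b; have mi := measurable_indic_itv `[a, b].
rewrite -(RI_indic ab) -RI_Z//; apply: RI_abs_le; [by meas| |exact: L1Z].
move=> x; rewrite normrM (ger0_norm (indic_ge0 _ _)) mulrC ler_wpM2r//.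
Qed.

Section Mollify.
Variables (q U M : R) (v : R -> R).
Hypothesis q1 : 1 <= q.
Hypothesis mv : measurable_fun setT v.
Hypothesis vU : forall x, `|v x| <= U.
Hypothesis M0 : 0 <= M.
Hypothesis vM : forall x, M < `|x| -> v x = 0.

(** Mean of v over [x, x + 1/(n+1)]: Lipschitz because v is bounded, and convergent to v almost
    everywhere by Lebesgue differentiation. *)
Definition steklov n x := n.+1%:R * (oint 0 (x + n.+1%:R^-1) v - oint 0 x v).

Let q0 : 0 < q. Proof. exact: lt_le_trans ltr01 q1. Qed.

Lemma box_inLp (a c : R) : inLp q (fun x => c * \1_(`[- a, a]) x).
Proof.
apply: inLpZ => //; have mi := measurable_indic_itv `[- a, a]; have ii := L1_indic_segment (- a) a.
apply/inLpP => //; split => //; move: ii; congr L1; apply/funext => x.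
by rewrite indic_itvE; case: (x \in _); rewrite ?normr1 ?powR1// normr0 powR0// gt_eqF.
Qed.

Lemma bounded_cpt_inLp : inLp q v.
Proof.
apply: (inLp_le q0 mv (box_inLp M U)) => x.
have [xM|xM] := leP `|x| M; last by rewrite vM// normr0.
have -> : \1_(`[- M, M]) x = 1 :> R by rewrite indic_itvE in_itv/= -ler_norml xM.
by rewrite mulr1 (le_trans (vU x))// ler_norm.
Qed.

Let n0 n : 0 < n.+1%:R^-1 :> R. Proof. by rewrite invr_gt0. Qed.

(** The primitive, whose value at 0 is 0, put in the shape that [increment_seg] and
    [primitive_is_derive_ae] expect. *)
Let fv x : (fun z => oint 0 z v) x = (fun z => oint 0 z v) 0 + oint 0 x v.
Proof. by rewrite /= [X in _ = X + _]/oint lexx set_itv1 Rintegral_set1 add0r. Qed.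

Let incr (a b : R) : a <= b -> oint 0 b v - oint 0 a v = seg a b v.
Proof. by move=> ab; rewrite -(increment_seg q1 bounded_cpt_inLp fv ab). Qed.

Let U0 : 0 <= U. Proof. exact: le_trans (normr_ge0 _) (vU 0). Qed.

Lemma primitive_lipschitz (a b : R) : `|oint 0 b v - oint 0 a v| <= U * `|a - b|.
Proof.
have [ab|ab] := leP a b.
  by rewrite incr// distrC (ger0_norm (_ : 0 <= b - a)) ?subr_ge0//; exact: seg_bound.
rewrite distrC incr ?(ltW ab)// (gtr0_norm (_ : 0 < a - b)) ?subr_gt0//.
by apply: seg_bound => //; exact: ltW.
Qed.

Lemma steklov_bound n x : `|steklov n x| <= U.
Proof.
rewrite /steklov normrM normr_nat.
apply: (@le_trans _ _ (n.+1%:R * (U * `|x - (x + n.+1%:R^-1)|))).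
  by rewrite ler_wpM2l//; exact: primitive_lipschitz.
have -> : x - (x + n.+1%:R^-1) = - n.+1%:R^-1 by ring.
by rewrite normrN (gtr0_norm (n0 n)) mulrCA mulfV ?mulr1.
Qed.

Lemma steklov_support n x : M + 1 < `|x| -> steklov n x = 0.
Proof.
move=> xM; have ni : n.+1%:R^-1 <= 1 :> R by rewrite invf_le1 ?ler1n.
have le : x <= x + n.+1%:R^-1 by rewrite lerDl ltW.
rewrite /steklov incr// /seg (_ : (fun y => _) = fun=> 0) ?RI_0 ?mulr0//.
apply/funext => y; rewrite indic_itvE; have [|yJ] := boolP (y \in `[x, x + n.+1%:R^-1]) => /=; last by rewrite mul0r.
rewrite in_itv/= => /andP[y1 y2]; rewrite vM ?mulr0//.
have h : `|x| <= `|y| + `|x - y| by rewrite addrC -{1}(subrK y x) ler_normD.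
have h2 : `|x - y| <= 1.
  by move: ni y2; move: (n.+1%:R^-1) => d ni y2; rewrite ler_norml; apply/andP; split; lra.
lra.
Qed.

Lemma steklov_lipschitz n x y : `|steklov n y - steklov n x| <= (n.+1%:R * (2 * U)) * `|x - y|.
Proof.
rewrite /steklov -mulrBr normrM normr_nat -mulrA ler_wpM2l//.
set a := oint 0 _ v; set b := oint 0 y v; set c := oint 0 _ v; set d := oint 0 x v.
have -> : a - b - (c - d) = (a - c) - (b - d) by ring.
apply: (le_trans (ler_normB _ _)).
have h1 := primitive_lipschitz (x + n.+1%:R^-1) (y + n.+1%:R^-1); have h2 := primitive_lipschitz x y.
have e : x + n.+1%:R^-1 - (y + n.+1%:R^-1) = x - y by ring.
rewrite e -/a -/c in h1; rewrite -/b -/d in h2; lra.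
Qed.

Lemma steklov_lipschitz_cpt n : lipschitz_cpt (steklov n).
Proof.
split.
- apply: continuous_measurable_fun => x; apply/cvgrPdist_le => e e0.
  have K0 : 0 < n.+1%:R * (2 * U) + 1 by rewrite ltr_wpDl// !mulr_ge0.
  have d0 := divr_gt0 e0 K0.
  near=> y; rewrite distrC; apply: (le_trans (steklov_lipschitz n x y)).
  apply: (@le_trans _ _ ((n.+1%:R * (2 * U) + 1) * `|x - y|)); first by rewrite ler_wpM2r// lerDl.
  rewrite mulrC -ler_pdivlMr//.
- by exists (M + 1); [exact: addr_ge0|exact: steklov_support].
- by exists (n.+1%:R * (2 * U)); exact: steklov_lipschitz.
- by exists U; exact: steklov_bound.
Unshelve. all: by end_near. Qed.

Lemma steklov_cvg : {ae mu, forall x, v x - steklov n x @[n --> \oo] --> (0 : R)}.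
Proof.
apply: (ae_imp (primitive_is_derive_ae q1 bounded_cpt_inLp fv)) => x [dv ev].
have /cvgr_dnbhsP/(_ (fun n => n.+1%:R^-1)) : (fun h => h^-1 *: (((fun z => oint 0 z v) \o shift x) (h *: 1) - oint 0 x v)) @ 0^' --> v x.
  by rewrite -ev; exact: dv.
have cn : (n.+1%:R^-1 : R) @[n --> \oo] --> (0 : R) by exact: cvg_harmonic.
have nz (n : nat) : (n.+1%:R^-1 : R) != 0 by rewrite gt_eqF.
move=> /(_ (conj nz cn)) c; have -> : (0 : R) = v x - v x by rewrite subrr.
apply: cvgB; first exact: cvg_cst.
move: c; rewrite (_ : (fun n : nat => _) = (fun n => steklov n x)) //; apply/funext => n.
by rewrite invrK /steklov /= [_%:A]mulr1 (addrC _ x).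
Qed.

Lemma steklov_dense : (forall n, inLp q (fun x => v x - steklov n x)) /\
  nrm q (fun x => v x - steklov n x) @[n --> \oo] --> (0 : R).
Proof.
have hv := bounded_cpt_inLp.
apply: (@nrm_dct q _ (fun x => 2 * U * \1_(`[- (M + 1), M + 1]) x)) => //.
- by move=> n; have [+ _ _ _] := steklov_lipschitz_cpt n => ?; meas.
- exact: steklov_cvg.
- move=> n x; have [xM|xM] := leP `|x| (M + 1).
    have -> : \1_(`[- (M + 1), M + 1]) x = 1 :> R by rewrite indic_itvE in_itv/= -ler_norml xM.
    by rewrite mulr1 (le_trans (ler_normB _ _))//; have := vU x; have := steklov_bound n x; lra.
  rewrite steklov_support// vM; last by lra.
  by rewrite subrr normr0 !mulr_ge0// indic_ge0.
- exact: box_inLp.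
Qed.

End Mollify.

Definition truncate (n : nat) u x := (`|u x| <= n%:R)%R%:R * ((`|x| <= n%:R)%R%:R * u x).

Lemma truncate_dense q u : 1 <= q -> inLp q u -> 
  (forall n, inLp q (fun x => u x - truncate n u x)) /\
  nrm q (fun x => u x - truncate n u x) @[n --> \oo] --> (0 : R).
Proof.
move=> q1 hu; have mu_ := inLp_measurable hu; have q0 : 0 < q := lt_le_trans ltr01 q1; pose v n x := truncate n u x.
have vE n x : v n x = u x \/ v n x = 0.
  rewrite /v /truncate; case: (`|u x| <= n%:R); case: (`|x| <= n%:R); rewrite /= ?mul0r ?mul1r ?mul0r; by [left|right].
apply: (@nrm_dct q _ (fun x => `|u x|)) => //.
- by move=> n; rewrite /v /truncate; meas.
- apply: aeW => x; apply: cvg_near_cst; near=> n.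
  rewrite /v /truncate; have -> : `|u x| <= n%:R by near: n; exact: nbhs_infty_ger.
  have -> : `|x| <= n%:R by near: n; exact: nbhs_infty_ger.
  by rewrite !mul1r subrr.
- by move=> n x; rewrite -/(v n x); have [->|->] := vE n x; rewrite ?subrr ?normr0 ?subr0.
- exact: inLpabs.
Unshelve. all: by end_near. Qed.

(** Truncation in height and support, then Steklov averaging, with an error e/2 for each. *)
Theorem lipschitz_cpt_dense q u (e : R) : 1 <= q -> inLp q u -> 0 < e ->
  exists w, [/\ lipschitz_cpt w, inLp q (fun x => u x - w x) & nrm q (fun x => u x - w x) <= e].
Proof.
move=> q1 hu e0; have mu_ := inLp_measurable hu.
have e20 : 0 < e / 2 by lra.
pose v n x := truncate n u x.
have [h1] := truncate_dense q1 hu; move=> /cvgrPdist_le /(_ _ e20) [N _ hN].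
have := hN N (leqnn N) => /=; rewrite sub0r normrN ger0_norm ?nrm_ge0// => hvN.
have mv : measurable_fun setT (v N) by rewrite /v /truncate; meas.
have N0 : 0 <= N%:R :> R by [].
have vb x : `|v N x| <= N%:R.
  rewrite /v /truncate; have [h|h] := leP `|u x| N%:R; last by rewrite mul0r normr0.
  by case: (`|x| <= N%:R); rewrite /= ?mul0r !mul1r ?normr0.
have vs x : N%:R < `|x| -> v N x = 0 by move=> h; rewrite /v /truncate (leNgt `|x|) h mul0r mulr0.
have [h2 /cvgrPdist_le /(_ _ e20) [K _ hK]] := steklov_dense q1 mv vb N0 vs.
have := hK K (leqnn K) => /=; rewrite sub0r normrN ger0_norm ?nrm_ge0// => hvK.
exists (steklov (v N) K).
have eq : (fun x => u x - steklov (v N) K x) = (fun x => (u x - v N x) + (v N x - steklov (v N) K x)).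
  by apply/funext => x; ring.
have hD := inLpD q1 (h1 N) (h2 K).
split; [exact: (steklov_lipschitz_cpt q1 mv vb N0 vs)|by rewrite eq|].
by rewrite eq (le_trans (nrmD q1 (h1 N) (h2 K)))//; lra.
Qed.

End Density.

(** * Resolvent estimates in L_q *)

Section Estimates.
Context {R : realType}.
Local Notation mu := (@lebesgue_measure R).
Variables (p s : R) (f G : R -> R) (B F0 H : R).
Hypothesis p12 : 1 < p <= 2.
Hypothesis sp : 1 + p^-1 < s < 2.
Hypothesis Wf : W_sp p s f G.
Local Notation al := (s - 1 - p^-1).
Hypothesis df : forall x : R, is_derive x 1 f (G x).
Hypothesis cG : continuous G.
Hypothesis GB : forall x, `|G x| <= B.
Hypothesis fB : forall x, `|f x| <= F0.
Hypothesis GH : forall x y, `|G x - G y| <= H * `|x - y| `^ al.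

Local Notation T := (opA f G).

Definition resolventA (lambda : R) (u : R -> R) x := lambda * u x - opA f G u x.

Let al0 : 0 < al. Proof. exact: hoelder_exponent_gt0 sp. Qed.
Let p0 : 0 < p. Proof. by case/andP : p12 => h _; exact: lt_trans ltr01 h. Qed.

Let bnd := opA_bounded p12 sp Wf GB fB GH.

Let bnd1 q : p <= q <= 2 -> exists2 C, 0 <= C & forall u, inLp q u ->
  [/\ {ae mu, forall x, L1 (fun y => kerS f G x y * u y)}, inLp q (T u) & nrm q (T u) <= C * nrm q u].
Proof. by move=> pq; apply: bnd; rewrite // subrr. Qed.

Lemma opA_inLp q u : p <= q <= 2 -> inLp q u -> inLp q (T u).
Proof. by move=> pq hu; have [C _ /(_ u hu)[]] := bnd1 pq. Qed.

Lemma opA_linear q (a : R) u v : p <= q <= 2 -> inLp q u -> inLp q v ->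
  {ae mu, forall x, T (fun z => a * u z + v z) x = a * T u x + T v x}.
Proof.
move=> pq hu hv; have [C _ h] := bnd1 pq.
have [iu _ _] := h u hu; have [iv _ _] := h v hv.
apply: (ae_imp2 iu iv) => x iux ivx; rewrite /opA.
have e : (fun y => kerS f G x y * (a * u y + v y)) = (fun y => a * (kerS f G x y * u y) + kerS f G x y * v y).
  by apply/funext => y; ring.
by rewrite e RI_D//; [rewrite RI_Z//; ring|exact: L1Z].
Qed.

Lemma opA_congr u v x : measurable_fun setT u -> measurable_fun setT v ->
  {ae mu, forall x, u x = v x} -> T u x = T v x.
Proof.
move=> mu_ mv uv; rewrite /opA; congr (_ * _).
have mk : measurable_fun setT (fun y => kerS f G x y) := measurable_section x (measurable_kerS Wf).
apply: eq_ae_RI; [by meas|by meas|].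
by apply: (ae_imp uv) => y ->.
Qed.

Lemma resolventA_inLp q lambda u : p <= q <= 2 -> inLp q u -> inLp q (resolventA lambda u).
Proof.
move=> pq hu; have /andP[pq' _] := pq; have /andP[p1 _] := p12; have q1 : 1 <= q by lra.
by apply: inLpB => //; [apply: inLpZ => //; lra|exact: opA_inLp].
Qed.

Lemma resolventA_linear q lambda (a : R) u v : p <= q <= 2 -> inLp q u -> inLp q v ->
  {ae mu, forall x, resolventA lambda (fun z => a * u z + v z) x = a * resolventA lambda u x + resolventA lambda v x}.
Proof.
move=> pq hu hv; apply: (ae_imp (opA_linear a pq hu hv)) => x h.
by rewrite /resolventA h; ring.
Qed.

(** The constant is chosen before lambda; the continuation in lambda relies on this uniformity. *)
Definition resolvent_estimate q := exists2 C, 0 <= C & forall lambda, 1 <= `|lambda| ->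
  forall u, inLp q u -> nrm q u <= C * nrm q (resolventA lambda u).

Lemma resolvent_estimate2 : resolvent_estimate 2.
Proof.
have p2 : p <= (2 : R) <= 2 by case/andP : p12 => _ h; rewrite h /=.
pose K := 2 * (1 + B ^+ 2) ^+ 2 * (1 + 2 * B ^+ 2).
have K0 : 0 <= K.
  have b2 := sqr_ge0 B; apply: mulr_ge0; last by lra.
  by apply: mulr_ge0 => //; exact: sqr_ge0.
have two0 : 0 < 2 :> R by [].
have q21 : 1 <= 2 :> R by lra.
pose C := Num.sqrt K.
have C0 : 0 <= C := sqrtr_ge0 K.
have nrm2 u : inLp 2 u -> nrm 2 u ^+ 2 = RI (fun x => u x ^+ 2).
  move=> hu; rewrite -powR_mulrn ?nrm_ge0// nrm_powR//; congr RI; apply/funext => x.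
  by rewrite powR_mulrn// real_normK ?num_real.
have nice lambda w : 1 <= `|lambda| -> lipschitz_cpt w -> inLp 2 w /\ nrm 2 w <= C * nrm 2 (resolventA lambda w).
  move=> l1 [mw [M M0 wM] [L wL] [U wU]].
  have hw : inLp 2 w by exact: bounded_cpt_inLp q21 mw wU wM.
  split => //; have hr := resolventA_inLp lambda p2 hw.
  have h := rellich_estimate df cG GB fB al0 GH mw M0 wM wL wU l1.
  rewrite -(@ler_pXn2r _ 2)// ?nnegrE ?mulr_ge0 ?nrm_ge0//.
  by rewrite exprMn /C sqr_sqrtr// nrm2// nrm2.
exists C => // lambda l1 u hu.
have [C1 C10 hC1] := bnd1 p2.
have hr := resolventA_inLp lambda p2 hu.
(* Replacing u by a Lipschitz w at distance e costs e in u and C (|lambda| + C1) e in the resolvent.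
   This factor may depend on lambda because e is then sent to 0. *)
suff main e : 0 < e -> nrm 2 u <= C * nrm 2 (resolventA lambda u) + (1 + C * (`|lambda| + C1)) * e.
  apply/ler_addgt0Pr => e e0.
  have k0 : 0 < 1 + C * (`|lambda| + C1) by rewrite ltr_pwDl// mulr_ge0// addr_ge0.
  have := main (e / (1 + C * (`|lambda| + C1))) (divr_gt0 e0 k0).
  by rewrite mulrCA mulfV ?gt_eqF// mulr1.
move=> e0; have [w [nw hd de]] := lipschitz_cpt_dense q21 hu e0.
have [hw ew] := nice _ _ l1 nw.
pose d x := u x - w x; have hd' : inLp 2 d by [].
have hrd := resolventA_inLp lambda p2 hd'; have hrw := resolventA_inLp lambda p2 hw.
have e1 : nrm 2 u <= nrm 2 d + nrm 2 w.
  have -> : u = (fun x => d x + w x) by apply/funext => x; rewrite /d subrK.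
  exact: nrmD.
have e2 : nrm 2 (resolventA lambda w) <= nrm 2 (resolventA lambda u) + nrm 2 (resolventA lambda d).
  have lin := resolventA_linear lambda (-1) p2 hd' hu.
  have ee : (fun z => -1 * d z + u z) = w by apply/funext => z; rewrite /d; ring.
  rewrite ee in lin.
  have hB := inLpB q21 hr hrd.
  have -> : nrm 2 (resolventA lambda w) = nrm 2 (fun x => resolventA lambda u x - resolventA lambda d x).
    by apply: nrm_ae => //; apply: (ae_imp lin) => x ->; ring.
  exact: nrmB.
have e3 : nrm 2 (resolventA lambda d) <= (`|lambda| + C1) * nrm 2 d.
  have [_ hT nT] := hC1 d hd'; have hZ := inLpZ lambda two0 hd'.
  apply: (le_trans (nrmB q21 hZ hT)); rewrite nrmZ// mulrDl lerD2l//.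
have k1 : 0 <= `|lambda| + C1 by rewrite addr_ge0.
have -> : C * nrm 2 (resolventA lambda u) + (1 + C * (`|lambda| + C1)) * e = e + C * (nrm 2 (resolventA lambda u) + (`|lambda| + C1) * e) by ring.
apply: (le_trans e1); apply: lerD => //; apply: (le_trans ew); rewrite ler_wpM2l//.
apply: (le_trans e2); rewrite lerD2l; apply: (le_trans e3); by rewrite ler_wpM2l.
Qed.

(* Apply the L_q estimate to w = A(f) u, which lies in L_q because A(f) improves
   integrability; then u = (h + w) / lambda, and w = A(f) (h + w) / lambda. *)
Lemma resolvent_estimate_step q q' : p <= q <= 2 -> p <= q' <= 2 -> `|q^-1 - q'^-1| < al ->
  resolvent_estimate q -> resolvent_estimate q'.
Proof.
move=> pq pq' dq [C C0 hC].
have /andP[p1 _] := p12; have /andP[qp q2] := pq; have /andP[qp' q2'] := pq'.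
have q1 : 1 <= q by lra.
have q1' : 1 <= q' by lra.
have q0 : 0 < q by lra.
have q0' : 0 < q' by lra.
have d1 : q'^-1 - q^-1 < al by move: dq; rewrite distrC; apply: le_lt_trans; exact: ler_norm.
have d2 : q^-1 - q'^-1 < al by apply: le_lt_trans dq; exact: ler_norm.
have [C1 C10 h1] := bnd pq' pq d1.
have [C3 C30 h3] := bnd pq pq' d2.
have [C2 C20 h2] := bnd1 pq'.
(* Writing u = (h + w) / lambda costs 1. In w = (A(f) h + A(f) w) / lambda the first term costs C2
   and the second C3 C C1, through the L_q norm of w. *)
exists (1 + C2 + C3 * (C * C1)); first by rewrite !addr_ge0 ?mulr_ge0.
move=> lambda l1 u hu.
have l0 : lambda != 0 by rewrite -normr_gt0; lra.
have hr := resolventA_inLp lambda pq' hu; set h := resolventA lambda u in hr *.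
have [_ hw1 _] := h1 u hu; have [_ hw2 _] := h2 u hu; set w := T u in hw1 hw2.
have [_ hTh1 nTh1] := h1 h hr; have [_ hTh2 nTh2] := h2 h hr.
have [_ hTw nTw] := h3 w hw1.
(* Applying A(f) to h = lambda u - w shows that w solves the same equation with right-hand side A(f)
   h, which lies in L_q. *)
have Th : {ae mu, forall x, T h x = lambda * w x - T w x}.
  have hNw := inLpN q0' hw2.
  have l := opA_linear lambda pq' hu hNw; have l' := opA_linear (-1) pq' hw2 (inLp0 q0').
  have z0 x : T (fun _ => 0) x = 0.
    rewrite /opA (_ : (fun y => _) = fun=> 0) ?RI_0 ?mulr0//.
    by apply/funext => y; rewrite mulr0.
  have eN : (fun z => -1 * w z + 0) = (fun z => - w z) by apply/funext => z; ring.
  rewrite eN in l'; apply: (ae_imp2 l l') => x e1 e2.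
  by rewrite -/h in e1; rewrite [LHS]e1 e2 z0 -/w; ring.
have nw : nrm q w <= C * (C1 * nrm q' h).
  apply: (le_trans (hC lambda l1 w hw1)); rewrite ler_wpM2l//.
  apply: le_trans nTh1; rewrite le_eqVlt; apply/orP; left; apply/eqP.
  apply: nrm_ae => //; first exact: resolventA_inLp.
  by apply: (ae_imp Th) => x ->.
have li : `|lambda^-1| <= 1 by rewrite normfV invf_le1//; lra.
have nw' : nrm q' w <= C2 * nrm q' h + C3 * nrm q w.
  have hs := inLpD q1' hTh2 hTw.
  have -> : nrm q' w = nrm q' (fun x => lambda^-1 * (T h x + T w x)).
    apply: nrm_ae => //; first exact: inLpZ.
    by apply: (ae_imp Th) => x ->; rewrite subrK mulKf.
  rewrite nrmZ//; apply: (@le_trans _ _ (1 * nrm q' (fun x => T h x + T w x))).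
    by rewrite ler_wpM2r// nrm_ge0.
  rewrite mul1r; apply: (le_trans (nrmD q1' hTh2 hTw)); exact: lerD.
have nu : nrm q' u <= nrm q' h + nrm q' w.
  have hs := inLpD q1' hr hw2.
  have -> : u = (fun x => lambda^-1 * (h x + w x)).
    by apply/funext => x; rewrite /h /resolventA subrK mulKf.
  rewrite nrmZ//; apply: (@le_trans _ _ (1 * nrm q' (fun x => h x + w x))).
    by rewrite ler_wpM2r// nrm_ge0.
  rewrite mul1r; exact: nrmD.
have := ler_wpM2l C30 nw.
have -> : (1 + C2 + C3 * (C * C1)) * nrm q' h = nrm q' h + (C2 * nrm q' h + C3 * (C * (C1 * nrm q' h))) by ring.
move=> h4; apply: (le_trans nu); rewrite lerD2l; apply: (le_trans nw'); by rewrite lerD2l.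
Qed.

Theorem resolvent_estimate_p : resolvent_estimate p.
Proof.
have /andP[p1 p2] := p12.
pose D := p^-1 - 2^-1.
have D0 : 0 <= D by rewrite subr_ge0 lef_pV2 ?posrE.
have D1 : D < 1 by rewrite /D; have h : p^-1 < 1 by [rewrite invf_lt1]; lra.
pose N := Num.bound (al^-1).
have N0 : al^-1 < N%:R by apply: archi_boundP; rewrite invr_ge0 ltW.
have Npos : 0 < N%:R :> R by apply: lt_trans N0; rewrite invr_gt0.
(* Reciprocals of the exponents, equally spaced from 1/2 to 1/p; N > 1/al and D < 1 make each step
   shorter than al. *)
pose iq (i : nat) : R := 2^-1 + i%:R * (D / N%:R).
have step0 : 0 <= D / N%:R by rewrite divr_ge0// ltW.
have stepal : D / N%:R < al.
  rewrite ltr_pdivrMr//; apply: (lt_trans D1).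
  by rewrite -ltr_pdivrMl// mulr1.
have iq_gt0 i : 0 < iq i by rewrite /iq ltr_pwDl ?invr_gt0// mulr_ge0.
have main i : (i <= N)%N -> resolvent_estimate (iq i)^-1.
  elim: i => [|i IH] iN.
    by rewrite /iq mul0r addr0 invrK; exact: resolvent_estimate2.
  have bounds j : (j <= N)%N -> p <= (iq j)^-1 <= 2.
    move=> jN; have j1 : iq j <= p^-1.
      have -> : p^-1 = iq N by rewrite /iq mulrC divfK ?gt_eqF// /D; ring.
      by rewrite /iq lerD2l ler_wpM2r// ler_nat.
    have j2 : 2^-1 <= iq j by rewrite /iq lerDl mulr_ge0.
    apply/andP; split.
      by rewrite -[leLHS]invrK lef_pV2 ?posrE ?invr_gt0.
    by rewrite -[leRHS]invrK lef_pV2 ?posrE ?invr_gt0.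
  apply: (resolvent_estimate_step (bounds i (ltnW iN)) (bounds _ iN)); last by apply: IH; exact: ltnW.
  rewrite !invrK; have -> : iq i - iq i.+1 = - (D / N%:R).
    by rewrite /iq -natr1; move: (D / N%:R) => c; ring.
  by rewrite normrN ger0_norm.
have := main N (leqnn N).
have -> : iq N = p^-1 by rewrite /iq mulrC divfK ?gt_eqF// /D; ring.
by rewrite invrK.
Qed.

End Estimates.

(** * Surjectivity *)

Section RieszFischer.
Context {R : realType}.
Local Notation mu := (@lebesgue_measure R).
Variables (q c th : R) (u : nat -> R -> R).
Hypothesis q1 : 1 <= q.
Hypothesis c0 : 0 <= c.
Hypothesis th0 : 0 <= th.
Hypothesis th1 : th < 1.
Hypothesis hu : forall n, inLp q (u n).
Hypothesis nu : forall n, nrm q (u n) <= c * th ^+ n.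

Let q0 : 0 < q. Proof. exact: lt_le_trans ltr01 q1. Qed.

Lemma fatou_bound (F : nat -> R -> R) (g : R -> \bar R) (b : R) : (forall n, L1 (F n)) ->
  (forall n x, 0 <= F n x) -> (forall x, (F n x)%:E @[n --> \oo] --> g x) ->
  (forall n, RI (F n) <= b) -> (\int[mu]_x g x <= b%:E)%E.
Proof.
move=> iF Fge0 Fg Fb.
have eg : g = (fun x => limn_einf (fun n => (F n x)%:E)).
  by apply/funext => x; have [-> _] := cvg_limn_einf_sup (Fg x).
rewrite eg; apply: (@le_trans _ _ (limn_einf (fun n => \int[mu]_x (F n x)%:E)%E)).
  apply: (@fatou _ (measurableTypeR R) R mu setT measurableT (fun n x => (F n x)%:E)).
    by move=> n; apply/measurable_EFinP; exact: L1_measurable (iF n).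
  by move=> n x _; rewrite lee_fin.
rewrite limn_einf_lim; apply: lime_le; first exact: is_cvg_einfs.
apply: nearW => n; apply: (@le_trans _ _ (\int[mu]_x (F n x)%:E)%E).
  by apply: ereal_inf_lbound; exists n => //=.
by rewrite RI_EFin// lee_fin.
Qed.

Let D := c / (1 - th).

Let D0 : 0 <= D. Proof. by rewrite divr_ge0// subr_ge0 ltW. Qed.

Let DE n : c * th ^+ n = D * th ^+ n - D * th ^+ n.+1.
Proof. by rewrite /D exprS; field; rewrite subr_eq0 gt_eqF. Qed.

Let ps n x := \sum_(0 <= k < n) u k x.
Let pa n x := \sum_(0 <= k < n) `|u k x|.

Let psS n x : ps n.+1 x = ps n x + u n x.
Proof. by rewrite /ps big_nat_recr. Qed.
Let paS n x : pa n.+1 x = pa n x + `|u n x|.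
Proof. by rewrite /pa big_nat_recr. Qed.
Let ps0 x : ps 0 x = 0. Proof. by rewrite /ps big_geq. Qed.
Let pa0 x : pa 0 x = 0. Proof. by rewrite /pa big_geq. Qed.

Let pa_ge0 n x : 0 <= pa n x. Proof. exact: sumr_ge0. Qed.

Let hpa n : inLp q (pa n) /\ nrm q (pa n) <= D - D * th ^+ n.
Proof.
elim: n => [|n [h1 h2]].
  have -> : pa 0 = (fun=> 0) by apply/funext => x; exact: pa0.
  by rewrite nrm0// expr0 mulr1 subrr; split => //; exact: inLp0.
have e : pa n.+1 = (fun x => pa n x + `|u n x|) by apply/funext => x; exact: paS.
have ha := inLpabs q0 (hu n); rewrite e; split; first exact: inLpD.
apply: (le_trans (nrmD q1 h1 ha)); rewrite nrmabs//; have := nu n; rewrite DE; lra.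
Qed.

Let hps n j : inLp q (fun x => ps (n + j) x - ps n x) /\
  nrm q (fun x => ps (n + j) x - ps n x) <= D * th ^+ n - D * th ^+ (n + j).
Proof.
elim: j => [|j [h1 h2]].
  rewrite addn0; have -> : (fun x => ps n x - ps n x) = (fun=> 0) by apply/funext => x; rewrite subrr.
  by rewrite nrm0// subrr; split => //; exact: inLp0.
have e : (fun x => ps (n + j.+1) x - ps n x) = (fun x => (ps (n + j) x - ps n x) + u (n + j)%N x).
  by apply/funext => x; rewrite addnS psS; ring.
rewrite e; split; first exact: inLpD.
apply: (le_trans (nrmD q1 h1 (hu _))); have := nu (n + j)%N; rewrite DE addnS; lra.
Qed.

(** The q-th power of the series of absolute values, possibly infinite. Fatou bounds its integral by
    D^q, so it is finite almost everywhere, and there the series converges absolutely. *)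
Let g x : \bar R := limn (fun n => (pa n x `^ q)%:E).

Let g_cvg x : (pa n x `^ q)%:E @[n --> \oo] --> g x.
Proof.
apply: ereal_nondecreasing_is_cvgn; apply/nondecreasing_seqP => n.
by rewrite lee_fin ge0_ler_powR ?nnegrE ?(ltW q0)// paS lerDl.
Qed.

Let g_le n x : ((pa n x `^ q)%:E <= g x)%E.
Proof.
apply: lime_ge; first exact: g_cvg.
near=> m; rewrite lee_fin ge0_ler_powR ?nnegrE ?(ltW q0)//.
have : (n <= m)%N by near: m; exact: nbhs_infty_ge.
move=> nm; rewrite -(subnKC nm); elim: (m - n)%N => [|j IH]; first by rewrite addn0.
by rewrite addnS paS (le_trans IH)// lerDl.
Unshelve. all: by end_near. Qed.

Let mpa n : measurable_fun setT (pa n). Proof. exact: inLp_measurable (hpa n).1. Qed.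

Let mg : measurable_fun setT g.
Proof.
apply: (emeasurable_fun_cvg (fun n x => (pa n x `^ q)%:E)); last by move=> x _; exact: g_cvg.
by move=> n; apply/measurable_EFinP; have := mpa n => ?; meas.
Qed.

Let A : set R := [set x | g x \is a fin_num].

Let mA : measurable A.
Proof. by rewrite -[A]setTI; exact: (emeasurable_fin_num measurableT mg). Qed.

Let aeA : {ae mu, forall x, \1_A x = 1 :> R}.
Proof.
have ig : mu.-integrable setT g.
  apply/integrableP; split => //; apply: (@le_lt_trans _ _ (D `^ q)%:E); last exact: ltry.
  have -> : (\int[mu]_x `|g x| = \int[mu]_x g x)%E.
    by apply: eq_integral => x _; rewrite gee0_abs//; apply: le_trans (g_le 0 x); rewrite lee_fin powR_ge0.
  apply: (@fatou_bound (fun n x => pa n x `^ q)).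
  - move=> n; have := inLp_L1 q0 (hpa n).1; congr L1; apply/funext => x.
    by rewrite ger0_norm.
  - by move=> n x; exact: powR_ge0.
  - exact: g_cvg.
  - move=> n; have -> : (fun x => pa n x `^ q) = (fun x => `|pa n x| `^ q) by apply/funext => x; rewrite ger0_norm.
    rewrite -nrm_powR ?(hpa n).1//; last by have [] := hpa n.
    rewrite ge0_ler_powR ?nnegrE ?nrm_ge0 ?(ltW q0)//; have [_ h] := hpa n; apply: (le_trans h).
    by rewrite gerBl mulr_ge0// exprn_ge0.
apply: (ae_imp (integrable_ae measurableT ig)) => x /(_ I) gx.
by rewrite indicE mem_set.
Qed.

(** Cut to the convergence set, the partial sums converge at every point, so their limit is
    measurable. *)
Let ps' n x := \1_A x * ps n x.

Let ps'_cvg x : cvgn (ps' ^~ x).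
Proof.
rewrite /ps'; have [xA|xA] := boolP (x \in A); last first.
  by under eq_fun do rewrite indicE (negbTE xA) mul0r; exact: is_cvg_cst.
apply: is_cvgM; first exact: is_cvg_cst.
have nd : nondecreasing_seq (pa ^~ x) by apply/nondecreasing_seqP => n; rewrite paS lerDl.
apply: normed_cvg; apply: (nondecreasing_is_cvgn nd).
exists ((fine (g x)) `^ q^-1) => _ [n _ <-]; rewrite -/(pa n x).
rewrite inE /A /= in xA; have := g_le n x; rewrite -(fineK xA) lee_fin => h.
rewrite -[leLHS](@powRr1 _ (pa n x))// -(mulfV (_ : q != 0)) ?gt_eqF// powRrM.
rewrite ge0_ler_powR ?nnegrE ?powR_ge0 ?invr_ge0 ?(ltW q0)//.
by apply: le_trans h; exact: powR_ge0.
Qed.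

(** Completeness of L_q in the form used by the Neumann series. The tail bound follows from Fatou's
    lemma in m applied to the increments between ranks n and n + m. *)
Theorem riesz_fischer : exists2 v, inLp q v & forall n,
  inLp q (fun x => v x - \sum_(0 <= k < n) u k x) /\
  nrm q (fun x => v x - \sum_(0 <= k < n) u k x) <= c / (1 - th) * th ^+ n.
Proof.
pose v x := lim (ps' n x @[n --> \oo]).
have mps n : measurable_fun setT (ps n).
  have := inLp_measurable (hps 0 n).1; congr measurable_fun; apply/funext => x.
  by rewrite add0n ps0 subr0.
have mi : measurable_fun setT (\1_A : R -> R) by exact: measurable_indic.
have mps' n : measurable_fun setT (ps' n) by have := mps n => ?; rewrite /ps'; meas.
have mv : measurable_fun setT v.
  by apply: (measurable_fun_cvg (h := ps')) => // x _; exact: ps'_cvg.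
have key n : inLp q (fun x => v x - ps' n x) /\ nrm q (fun x => v x - ps' n x) <= D * th ^+ n.
  pose K := D * th ^+ n; have K0 : 0 <= K by rewrite mulr_ge0// exprn_ge0.
  pose F m x := `|ps' (n + m)%N x - ps' n x| `^ q.
  have iF m : L1 (F m) /\ RI (F m) <= K `^ q.
    have [h1 h2] := hps n m.
    have mm : measurable_fun setT (fun x => ps' (n + m)%N x - ps' n x).
      by have := mps' (n + m)%N; have := mps' n => ? ?; meas.
    have le x : `|ps' (n + m)%N x - ps' n x| <= `|ps (n + m)%N x - ps n x|.
      by rewrite /ps' -mulrBr normrM ger0_norm ?indic_ge0// ler_piMl ?indic_le1.
    have h3 := inLp_le q0 mm h1 le; split; first exact: inLp_L1.
    rewrite /F -nrm_powR// ge0_ler_powR ?nnegrE ?nrm_ge0 ?(ltW q0)//.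
    apply: (le_trans (nrm_le q0 h3 h1 le)); apply: (le_trans h2).
    by rewrite gerBl mulr_ge0// exprn_ge0.
  have mvn : measurable_fun setT (fun x => v x - ps' n x) by have := mps' n => ?; meas.
  have bd : (\int[mu]_x (`|v x - ps' n x| `^ q)%:E <= (K `^ q)%:E)%E.
    apply: (@fatou_bound F).
    - by move=> m; have [] := iF m.
    - by move=> m x; exact: powR_ge0.
    - move=> x; apply: cvg_EFin; first exact: nearW.
      apply: (cvg_norm_powR q0 (a := fun m => ps' (n + m)%N x - ps' n x)).
      apply: cvgB; last exact: cvg_cst.
      rewrite (_ : (fun m => ps' (n + m)%N x) = (fun m => ps' (m + n)%N x)); last by apply/funext => m; rewrite addnC.
      rewrite (cvg_shiftn n (ps' ^~ x)); exact: ps'_cvg.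
    - by move=> m; have [] := iF m.
  have iL : L1 (fun x => `|v x - ps' n x| `^ q).
    apply/L1_ge0P; [by meas|by move=> x; exact: powR_ge0|].
    by apply: le_lt_trans bd _; exact: ltry.
  have hv : inLp q (fun x => v x - ps' n x) by apply/inLpP.
  split => //; have bd' : RI (fun x => `|v x - ps' n x| `^ q) <= K `^ q by rewrite -lee_fin -RI_EFin.
  rewrite nrmE//; have -> : D * th ^+ n = (K `^ q) `^ q^-1 by rewrite -powRrM mulfV ?gt_eqF// powRr1.
  rewrite ge0_ler_powR ?nnegrE ?powR_ge0 ?invr_ge0 ?(ltW q0)//.
  by apply: RI_ge0 => x; exact: powR_ge0.
have ae n : {ae mu, forall x, v x - ps' n x = v x - ps n x}.
  by apply: (ae_imp aeA) => x; rewrite /ps' => ->; rewrite mul1r.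
exists v.
  have [h _] := key 0%N; move: h; congr (inLp q); apply/funext => x.
  by rewrite /ps' ps0 mulr0 subr0.
move=> n; have [h1 h2] := key n.
have mm : measurable_fun setT (fun x => v x - ps n x) by have := mps n => ?; meas.
have h3 := inLp_ae q0 mm h1 (ae n).
by split => //; rewrite -(nrm_ae q0 h1 h3 (ae n)).
Qed.

End RieszFischer.

(** * Neumann series for operators defined up to null sets *)

Section Perturbation.
Context {R : realType}.
Local Notation mu := (@lebesgue_measure R).
Implicit Types (S P : (R -> R) -> R -> R).
Variable q : R.
Hypothesis q1 : 1 <= q.

Let q0 : 0 < q. Proof. exact: lt_le_trans ltr01 q1. Qed.

Definition bounded_linear S (C : R) := [/\ forall u, inLp q u -> inLp q (S u),
  forall (a : R) u v, inLp q u -> inLp q v ->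
    {ae mu, forall x, S (fun z => a * u z + v z) x = a * S u x + S v x} &
  forall u, inLp q u -> nrm q (S u) <= C * nrm q u].

Definition surjective_ae S := forall h, inLp q h -> exists2 u, inLp q u & {ae mu, forall x, S u x = h x}.

Lemma bounded_linearD S P (C C' : R) : bounded_linear S C -> bounded_linear P C' ->
  bounded_linear (fun u x => S u x + P u x) (C + C').
Proof.
move=> [S1 S2 S3] [P1 P2 P3]; split.
- by move=> u hu; apply: inLpD => //; [exact: S1|exact: P1].
- move=> a u v hu hv; apply: (ae_imp2 (S2 a u v hu hv) (P2 a u v hu hv)) => x -> ->; ring.
- move=> u hu; apply: (le_trans (nrmD q1 (S1 u hu) (P1 u hu))).
  by rewrite mulrDl lerD ?S3 ?P3.
Qed.

Lemma bounded_linear_id (c : R) : bounded_linear (fun u x => c * u x) `|c|.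
Proof.
split=> [u hu|a u v _ _|u hu]; first exact: inLpZ.
  by apply: aeW => x; ring.
by rewrite nrmZ.
Qed.

Lemma bounded_linearN S (C : R) : bounded_linear S C -> bounded_linear (fun u x => - S u x) C.
Proof.
move=> [S1 S2 S3]; split.
- by move=> u hu; apply: inLpN => //; exact: S1.
- by move=> a u v hu hv; apply: (ae_imp (S2 a u v hu hv)) => x ->; ring.
- by move=> u hu; rewrite nrmN ?S3//; exact: S1.
Qed.

(* Neumann series for (S + P) u = h: correct the defect with the inverse of S. *)
Lemma surjective_perturbation S P (Cs C de : R) : bounded_linear S Cs -> bounded_linear P de ->
  0 <= C -> 0 <= de -> C * de < 1 -> 0 <= Cs ->
  (forall u, inLp q u -> nrm q u <= C * nrm q (S u)) -> surjective_ae S ->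
  surjective_ae (fun u x => S u x + P u x).
Proof.
move=> bS bP C0 de0 Cde Cs0 est surj h0 hh0.
have [[S1 S2 S3] [P1 P2 P3]] := (bS, bP).
have th0 : 0 <= C * de by exact: mulr_ge0.
(* A solution picked by choice. It need not depend linearly on h: only its equation and its norm
   bound enter. *)
pose sol h := xget (fun _ => 0) [set u | inLp q u /\ {ae mu, forall x, S u x = h x}].
have solP h : inLp q h -> inLp q (sol h) /\ {ae mu, forall x, S (sol h) x = h x}.
  by move=> /surj[u hu eu]; apply: (xgetPex (fun _ => 0) (P := [set u | inLp q u /\ {ae mu, forall x, S u x = h x}])); exists u.
(* The defects: [Qps] shows that S + P sends the n-th partial sum of the corrections to h0 - h n. *)
pose h n := iter n (fun k x => - P (sol k) x) h0.
have hS n : h n.+1 = (fun x => - P (sol (h n)) x) by [].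
have nsol k : inLp q k -> nrm q (sol k) <= C * nrm q k.
  move=> hk; have [hs es] := solP k hk; apply: (le_trans (est _ hs)).
  by rewrite (nrm_ae q0 (S1 _ hs) hk es).
have hh n : inLp q (h n) /\ nrm q (h n) <= (C * de) ^+ n * nrm q h0.
  elim: n => [|n [i1 i2]]; first by rewrite expr0 mul1r.
  have [hs _] := solP _ i1; rewrite hS; split; first by apply: inLpN => //; exact: P1.
  rewrite nrmN//; last exact: P1.
  apply: (le_trans (P3 _ hs)); rewrite exprS -!mulrA (mulrCA C) ler_wpM2l//.
  by apply: (le_trans (nsol _ i1)); rewrite ler_wpM2l.
pose u n := sol (h n).
have hu n : inLp q (u n) by have [] := solP _ (hh n).1.
have nu n : nrm q (u n) <= C * nrm q h0 * (C * de) ^+ n.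
  apply: (le_trans (nsol _ (hh n).1)); rewrite -mulrA ler_wpM2l// mulrC; exact: (hh n).2.
have c0 : 0 <= C * nrm q h0 by rewrite mulr_ge0// nrm_ge0.
have [v hv ev] := riesz_fischer q1 c0 th0 Cde hu nu.
exists v => //.
pose Q w x := S w x + P w x.
have [Q1 Q2 Q3] : bounded_linear Q (Cs + de) by exact: bounded_linearD.
pose ps n x := \sum_(0 <= k < n) u k x.
have hps n : inLp q (ps n).
  have -> : ps n = (fun x => v x - (v x - ps n x)) by apply/funext => x; ring.
  by apply: inLpB => //; have [] := ev n.
have Qps n : {ae mu, forall x, Q (ps n) x = h0 x - h n x}.
  elim: n => [|n IH].
    have := Q2 (-1) (fun=> 0) (fun=> 0) (inLp0 q0) (inLp0 q0).
    have -> : (fun z : R => -1 * 0 + 0) = (fun=> 0 : R) by apply/funext => z; ring.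
    have -> : ps 0%N = (fun=> 0) by apply/funext => x; rewrite /ps big_geq.
    by move=> e; apply: (ae_imp e) => x ->; rewrite /h /=; ring.
  have e : ps n.+1 = (fun z => 1 * ps n z + u n z) by apply/funext => z; rewrite /ps big_nat_recr//= mul1r.
  rewrite e; have l := Q2 1 _ _ (hps n) (hu n); have [_ es] := solP _ (hh n).1.
  apply: (ae_imp2 l (ae_imp2 IH es (fun x a b => conj a b))) => x -> [e1 e2].
  by rewrite e1 /Q e2 hS; rewrite -/(u n); ring.
have hQv := Q1 v hv.
have hd := inLpB q1 hQv hh0.
suff nd0 : nrm q (fun x => Q v x - h0 x) = 0.
  by apply: (ae_imp (nrm_eq0 q0 hd nd0)) => x /eqP; rewrite subr_eq0 => /eqP.
(* Two errors at rank n, both of order (C de)^n: the operator applied to the tail of the series, and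
   the remaining defect. *)
pose K := (Cs + de) * (C * nrm q h0 / (1 - C * de)) + nrm q h0.
have bd n : nrm q (fun x => Q v x - h0 x) <= (C * de) ^+ n * K.
  have [hr nr] := ev n; set r := (fun x => _) in hr nr.
  have hQr := Q1 r hr; have hn := (hh n).1.
  have hB := inLpB q1 hQr hn.
  have -> : nrm q (fun x => Q v x - h0 x) = nrm q (fun x => Q r x - h n x).
    apply: nrm_ae => //.
    have l := Q2 (-1) _ _ (hps n) hv.
    have er : (fun z => -1 * ps n z + v z) = r by apply/funext => z; rewrite /r /ps; ring.
    rewrite er in l; apply: (ae_imp2 l (Qps n)) => x -> ->; ring.
  apply: (le_trans (nrmB q1 hQr hn)); rewrite /K mulrDr; apply: lerD; last exact: (hh n).2.
  apply: (le_trans (Q3 r hr)); rewrite mulrCA ler_wpM2l ?addr_ge0//.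
  by apply: (le_trans nr); rewrite mulrC.
apply/eqP; rewrite eq_le nrm_ge0 andbT.
have cv : (C * de) ^+ n * K @[n --> \oo] --> (0 : R) * K.
  apply: cvgM; last exact: cvg_cst.
  by apply: cvg_expr; rewrite ger0_norm.
rewrite mul0r in cv; apply: (cvgr_to_ge cv); exact: nearW.
Qed.

End Perturbation.

(** * Continuation in lambda *)

Section Surjectivity.
Context {R : realType}.
Local Notation mu := (@lebesgue_measure R).
Variables (p s : R) (f G : R -> R) (B F0 H : R).
Hypothesis p12 : 1 < p <= 2.
Hypothesis sp : 1 + p^-1 < s < 2.
Hypothesis Wf : W_sp p s f G.
Local Notation al := (s - 1 - p^-1).
Hypothesis df : forall x : R, is_derive x 1 f (G x).
Hypothesis cG : continuous G.
Hypothesis GB : forall x, `|G x| <= B.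
Hypothesis fB : forall x, `|f x| <= F0.
Hypothesis GH : forall x y, `|G x - G y| <= H * `|x - y| `^ al.

Let p1 : 1 <= p. Proof. by case/andP : p12 => /ltW. Qed.
Let p0 : 0 < p. Proof. exact: lt_le_trans ltr01 p1. Qed.
Let pp : p <= p <= 2. Proof. by rewrite lexx; case/andP : p12. Qed.

Lemma opA_bounded_linear : exists2 C, 0 <= C & bounded_linear p (opA f G) C.
Proof.
have dp : p^-1 - p^-1 < al by rewrite subrr; exact: hoelder_exponent_gt0 sp.
have [C C0 h] := opA_bounded p12 sp Wf GB fB GH pp pp dp.
exists C => //; split=> [u hu|a u v hu hv|u hu]; first by have [] := h u hu.
  exact: (opA_linear p12 sp Wf GB fB GH a pp hu hv).
by have [] := h u hu.
Qed.

Theorem resolventA_surjective lambda : 1 <= `|lambda| -> surjective_ae p (resolventA f G lambda).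
Proof.
move=> l1; have [CT CT0 bT] := opA_bounded_linear.
have [C C0 est] := resolvent_estimate_p p12 sp Wf df cG GB fB GH.
have l0 : 0 < `|lambda| by lra.
have bres (t : R) : bounded_linear p (resolventA f G (lambda * t)) (`|lambda * t| + CT).
  exact: (bounded_linearD p1 (bounded_linear_id p1 (lambda * t)) (bounded_linearN p1 bT)).
(* |lambda t0| exceeds the bound [CT] of A(f), so multiplication by lambda t0 absorbs A(f) as a
   perturbation. *)
pose t0 : R := CT + 1.
have start : surjective_ae p (resolventA f G (lambda * t0)).
  have t00 : 0 < t0 by rewrite /t0; lra.
  have lt0 : 0 < `|lambda * t0| by rewrite normrM (gtr0_norm t00) mulr_gt0.
  apply: (@surjective_perturbation _ p p1 (fun u x => lambda * t0 * u x) (fun u x => - opA f G u x) _ `|lambda * t0|^-1 _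
    (bounded_linear_id p1 _) (bounded_linearN p1 bT)) => //.
  - by rewrite mulrC ltr_pdivrMr// mul1r normrM (gtr0_norm t00) /t0; nra.
  - by move=> u hu; rewrite nrmZ// mulKf// gt_eqF.
  - move=> h hh; exists (fun x => (lambda * t0)^-1 * h x); first exact: inLpZ.
    by apply: aeW => x; rewrite mulVKf// -normr_gt0.
have step (t t' : R) : 1 <= t -> C * (`|lambda| * `|t' - t|) < 1 ->
    surjective_ae p (resolventA f G (lambda * t)) -> surjective_ae p (resolventA f G (lambda * t')).
  move=> t1 small surj.
  have := @surjective_perturbation _ p p1 _ (fun u x => lambda * (t' - t) * u x) _ C _
    (bres t) (bounded_linear_id p1 _) C0 (normr_ge0 _).
  rewrite normrM => /(_ small); rewrite addr_ge0// => /(_ isT).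
  have tt : 1 <= `|lambda * t| by rewrite normrM (ger0_norm (_ : 0 <= t)); [nra|lra].
  move=> /(_ (est _ tt) surj); congr surjective_ae; apply/funext => u; apply/funext => x.
  by rewrite /resolventA; ring.
pose N := (Num.bound (C * (`|lambda| * CT))).+1.
have Npos : 0 < N%:R :> R by rewrite ltr0n.
have Nbig : C * (`|lambda| * CT) < N%:R.
  have b0 : 0 <= C * (`|lambda| * CT) by rewrite !mulr_ge0.
  by apply: (lt_trans (archi_boundP b0)); rewrite ltr_nat.
(* Along the ray from lambda t0 down to lambda every parameter keeps absolute value at least 1, so
   the same C serves throughout; N is taken so large that C times the length of a step is below
   1. *)
pose t (i : nat) : R := t0 - i%:R * (CT / N%:R).
have main i : (i <= N)%N -> surjective_ae p (resolventA f G (lambda * t i)).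
  elim: i => [|i IH] iN; first by rewrite /t mul0r subr0.
  apply: (step (t i)); last by apply: IH; exact: ltnW.
    rewrite /t /t0; have : i%:R * (CT / N%:R) <= CT.
      rewrite mulrCA -[leRHS]mulr1 ler_wpM2l// ler_pdivrMr// mul1r ler_nat; exact: ltnW.
    lra.
  have -> : t i.+1 - t i = - (CT / N%:R) by rewrite /t -natr1; move: (CT / N%:R) => c; ring.
  have -> : `|- (CT / N%:R)| = CT / N%:R by rewrite normrN ger0_norm// divr_ge0// ltW.
  have -> : C * (`|lambda| * (CT / N%:R)) = C * (`|lambda| * CT) / N%:R by rewrite !mulrA.
  by rewrite ltr_pdivrMr// mul1r.
have := main N (leqnn N); rewrite /t mulrC /t0.
have -> : CT + 1 - N%:R * (CT / N%:R) = 1 by field; rewrite gt_eqF.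
by rewrite mul1r.
Qed.

End Surjectivity.

(** * The principal value operator *)

Section Assembly.
Context {R : realType}.
Local Notation mu := (@lebesgue_measure R).

Lemma cpt_cont_bounded (w : R -> R) : compactly_supported_cont w ->
  [/\ measurable_fun setT w, exists2 M : R, 0 <= M & forall x, M < `|x| -> w x = 0 &
      exists U : R, forall x, `|w x| <= U].
Proof.
move=> [cw [M0 wM0]]; pose M := `|M0|; have MM : 0 <= M := normr_ge0 M0.
have wM x : M < `|x| -> w x = 0 by move=> h; apply: wM0; apply: le_lt_trans h; exact: ler_norm.
split; [exact: continuous_measurable_fun|by exists M|].
have ab : - M <= M by lra.
have [c _ hc] := @EVT_max R (fun x => `|w x|) (- M) M ab
  (continuous_subspaceT (fun x => cvg_norm (cw x))).
exists `|w c| => x; have [xM|xM] := leP `|x| M; last by rewrite wM// normr0.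
by apply: hc; rewrite in_itv/= -ler_norml.
Qed.

Lemma lipschitz_cpt_cont (w : R -> R) : lipschitz_cpt w -> compactly_supported_cont w.
Proof.
move=> [mw [M _ wM] [L wL] _]; split; last by exists M.
have K0 : 0 < `|L| + 1 by rewrite ltr_wpDl.
move=> x; apply/cvgrPdist_le => e e0; have d0 := divr_gt0 e0 K0.
near=> y; rewrite distrC; apply: (le_trans (wL x y)).
apply: (@le_trans _ _ ((`|L| + 1) * `|x - y|)).
  by rewrite ler_wpM2r// (le_trans (ler_norm L))// lerDl.
rewrite mulrC -ler_pdivlMr//.
Unshelve. all: by end_near. Qed.

(** The full integral converges absolutely, so removing |y| <= eps and letting eps tend to 0 is
    dominated convergence. The derivative enters the kernel only at x, so g and G need to agree only
    there. *)
Lemma truncA_cvg (f g G w : R -> R) (x : R) : g x = G x -> L1 (fun s => kerS f G x s * w s) ->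
  truncA f g w eps x @[eps --> 0^'+] --> opA f G w x.
Proof.
move=> gx iK; pose h y := kerA f g x y * w (x - y).
have hE y : h y = kerS f G x (x - y) * w (x - y).
  by rewrite /h /kerA /kerS gx; have -> : x - (x - y) = y by ring.
have ih : L1 h.
  by have := L1_reflect x iK; congr L1; apply/funext => y; rewrite hE.
have mh := L1_measurable ih.
have eh : RI h = RI (fun s => kerS f G x s * w s).
  by rewrite -(RI_reflect x (L1_measurable iK)); congr RI; apply/funext => y; rewrite hE.
(* The quotient 0 / 0 is 0, so the integrand vanishes at the one point that every truncation
   removes. *)
have h0 : h 0 = 0 by rewrite hE subr0 /kerS !subrr mul0r subrr !mul0r.
apply/cvg_at_rightP => e [e0 ecv].
rewrite /truncA /opA -eh; apply: cvgM; first exact: cvg_cst.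
have mE n : measurable [set y : R | e n < `|y|].
  have -> : [set y : R | e n < `|y|] = ~` [set` `[- e n, e n]].
    apply/seteqP; split => y /=; rewrite in_itv/= -ler_norml; last by move/negP; rewrite -ltNge.
    by move=> h1; apply/negP; rewrite -ltNge.
  exact: measurableC.
have [_] : L1 h /\ RI (fun y => \1_[set y : R | e n < `|y|] y * h y) @[n --> \oo] --> RI h.
  apply: (RI_dct (g := fun y => `|h y|)) => //.
  - move=> n; have mi : measurable_fun setT (\1_[set y : R | e n < `|y|] : R -> R) by exact: measurable_indic.
    by meas.
  - apply: aeW => y; have [->|y0] := eqVneq y 0.
      by rewrite h0; under eq_fun do rewrite mulr0; exact: cvg_cst.
    have /cvgrPdist_lt/(_ `|y|) := ecv; rewrite normr_gt0 => /(_ y0) ny.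
    apply: cvg_near_cst; apply: filterS ny => n; rewrite sub0r normrN => en.
    have en' : e n < `|y| by apply: le_lt_trans en; exact: ler_norm.
    by rewrite indicE mem_set ?mul1r.
  - by move=> n y; rewrite normrM ger0_norm ?indic_ge0// ler_piMl ?indic_le1.
  - exact: L1abs.
by rewrite (_ : (fun n => RI _) = (fun n => Rintegral mu [set y | e n < `|y|] h)); last by apply/funext => n; rewrite RI_restrict.
Qed.

Lemma bounded_Lp_opP (p : R) T : 1 <= p -> bounded_Lp_op p T -> exists2 C, 0 <= C & bounded_linear p T C.
Proof.
move=> p1 [T1 _ T2 [C TC]]; exists `|C| => //; split=> // u hu.
have := TC u hu; rewrite -!nrm_EFin//; last exact: T1.
rewrite -EFinM lee_fin => h; apply: (le_trans h); rewrite ler_wpM2r ?nrm_ge0//.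
exact: ler_norm.
Qed.

Lemma bounded_linear_Lp_op (p C : R) T : bounded_linear p T C ->
  (forall u v, inLp p u -> inLp p v -> {ae mu, forall x, u x = v x} -> {ae mu, forall x, T u x = T v x}) ->
  bounded_Lp_op p T.
Proof.
move=> [T1 T2 T3] Tc; split => //; exists C => u hu.
by rewrite -!nrm_EFin//; [rewrite -EFinM lee_fin T3|exact: T1].
Qed.

End Assembly.

(** Existence of an extension is proved along with the isomorphism, so the second clause is not
    vacuous. The witness is the integral operator with the continuous derivative G, to which every
    other extension is equal almost everywhere. *)
Theorem theorem3p4 (R : realType) (p s : R) (f g : R -> R) (lambda : R) :
  1 < p <= 2 -> 1 + p^-1 < s < 2 -> W_sp p s f g -> 1 <= `|lambda| ->
  (exists T, is_opA p f g T) /\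
  (forall T, is_opA p f g T ->
     isom_Lp p (fun u x => lambda * u x - T u x)).
Proof.
move=> p12 sp Wfg l1.
have [G [B [F0 [H [[df cG GB fB GH] [Wf Gg]]]]]] := regular_representative p12 sp Wfg.
have p1 : 1 <= p by case/andP : p12 => /ltW.
have p0 : 0 < p := lt_le_trans ltr01 p1.
have pp : p <= p <= 2 by rewrite lexx; case/andP : p12.
have [C0 C00 bA] := opA_bounded_linear p12 sp Wf GB fB GH.
have pv w : compactly_supported_cont w ->
    {ae (@lebesgue_measure R), forall x, truncA f g w eps x @[eps --> 0^'+] --> opA f G w x}.
  move=> cw; have [mw [M M0 wM] [U wU]] := cpt_cont_bounded cw.
  have hw : inLp p w by exact: bounded_cpt_inLp p1 mw wU wM.
  have dp : p^-1 - p^-1 < s - 1 - p^-1 by rewrite subrr; exact: hoelder_exponent_gt0 sp.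
  have [C _ /(_ w hw)[iw _ _]] := opA_bounded p12 sp Wf GB fB GH pp pp dp.
  by apply: (ae_imp2 Gg iw) => x Gx ix; apply: truncA_cvg.
split.
  exists (opA f G); split => //; apply: (bounded_linear_Lp_op bA) => u v hu hv uv.
  by apply: aeW => x; apply: (opA_congr Wf) => //; exact: inLp_measurable (_ : inLp p _).
move=> T [bT pvT]; have [CT CT0 bT'] := bounded_Lp_opP p1 bT.
have [T1 T2 T3] := bT'; have [A1 A2 A3] := bA.
(* On Lipschitz functions of compact support both operators are limits of the same truncations;
   boundedness and density extend the equality. The summand 1 in CT + C0 + 1 keeps the divisor
   positive. *)
have TA u : inLp p u -> {ae (@lebesgue_measure R), forall x, T u x = opA f G u x}.
  move=> hu; have hTu := T1 u hu; have hAu := A1 u hu; have hB := inLpB p1 hTu hAu.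
  suff n0 : nrm p (fun x => T u x - opA f G u x) = 0.
    by apply: (ae_imp (nrm_eq0 p0 hB n0)) => x /eqP; rewrite subr_eq0 => /eqP.
  apply/eqP; rewrite eq_le nrm_ge0 andbT; apply/ler_addgt0Pr => e e0; rewrite add0r.
  have K0 : 0 < CT + C0 + 1 by lra.
  have [w [nw hd nd]] := lipschitz_cpt_dense p1 hu (divr_gt0 e0 K0).
  set d := (fun x => u x - w x) in hd nd.
  have cw := lipschitz_cpt_cont nw.
  have hw : inLp p w.
    have -> : w = (fun x => u x - d x) by apply/funext => x; rewrite /d; ring.
    exact: inLpB.
  have Tw : {ae (@lebesgue_measure R), forall x, T w x = opA f G w x}.
    apply: (ae_imp2 (pvT w cw) (pv w cw)) => x c1 c2; exact: (cvg_unique _ c1 c2).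
  have eu : u = (fun x => 1 * w x + d x) by apply/funext => x; rewrite /d; ring.
  have lT := T2 1 w d hw hd; have lA := A2 1 w d hw hd; rewrite -eu in lT lA.
  have hTd := T1 d hd; have hAd := A1 d hd; have hBd := inLpB p1 hTd hAd.
  have -> : nrm p (fun x => T u x - opA f G u x) = nrm p (fun x => T d x - opA f G d x).
    apply: nrm_ae => //.
    apply: (ae_imp2 lT (ae_imp2 lA Tw (fun x a b => conj a b))) => x -> [-> ->]; ring.
  apply: (le_trans (nrmB p1 hTd hAd)).
  apply: (@le_trans _ _ ((CT + C0) * nrm p d)); first by rewrite mulrDl lerD ?T3 ?A3.
  apply: (@le_trans _ _ ((CT + C0 + 1) * (e / (CT + C0 + 1)))).
    by apply: ler_pM => //; [exact: addr_ge0|exact: nrm_ge0|lra].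
  by rewrite mulrC divfK// gt_eqF.
have bS := bounded_linearD p1 (bounded_linear_id p1 lambda) (bounded_linearN p1 bT').
have [S1 S2 S3] := bS.
have Sr u : inLp p u -> {ae (@lebesgue_measure R), forall x, lambda * u x - T u x = resolventA f G lambda u x}.
  by move=> hu; apply: (ae_imp (TA u hu)) => x; rewrite /resolventA => ->.
split.
- apply: (bounded_linear_Lp_op bS) => u v hu hv uv; have [_ Tc _ _] := bT.
  by apply: (ae_imp2 uv (Tc u v hu hv uv)) => x -> ->.
- move=> h hh; have [u hu eu] := resolventA_surjective p12 sp Wf df cG GB fB GH l1 hh.
  by exists u => //; apply: (ae_imp2 (Sr u hu) eu) => x ->.
- have [C C1 est] := resolvent_estimate_p p12 sp Wf df cG GB fB GH.
  exists C => u hu; have hS := S1 u hu; have hr := resolventA_inLp p12 sp Wf GB fB GH lambda pp hu.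
  rewrite -!nrm_EFin// -EFinM lee_fin (nrm_ae p0 hS hr (Sr u hu)).
  exact: est.
Qed.
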